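(* Let $\boldsymbol{F}$ be a family of bicomplex holomorphic functions in a domain $\Omega\subset\mathbb{T}$. Suppose there are $\alpha,\beta\in\mathbb{T}$ such that (a) $\alpha-\beta$ is invertible in $\mathbb{T}$, and (b) $S\cap\mathcal{R}(f)=\varnothing$ for all $f\in\boldsymbol{F}$, where $S=\{w\in\mathbb{T}: w-\alpha\in\mathcal{NC}\}\cup\{w\in\mathbb{T}: w-\beta\in\mathcal{NC}\}$ and $\mathcal{R}(f)$ denotes the range of $f$. Then $\boldsymbol{F}$ is a normal family in $\Omega$.
   Context: Bicomplex numbers: $\mathbb{T}=\{z_1+z_2\mathbf{i_2} : z_1,z_2\in\mathbb{C}(\mathbf{i_1})\}$, where $\mathbb{C}(\mathbf{i_1})=\{x+y\mathbf{i_1}: x,y\in\mathbb{R}\}$ is the field of complex numbers with imaginary unit $\mathbf{i_1}$, $\mathbf{i_1}^2=\mathbf{i_2}^2=-1$, $\mathbf{i_1}\mathbf{i_2}=\mathbf{i_2}\mathbf{i_1}=\mathbf{j}$, $\mathbf{j}^2=1$; $\mathbb{T}$ is identified with $\mathbb{R}^4$ and carries the Euclidean topology. The projections $\mathcal{P}_1,\mathcal{P}_2:\mathbb{T}\to\mathbb{C}(\mathbf{i_1})$ are $\mathcal{P}_1(z_1+z_2\mathbf{i_2})=z_1-z_2\mathbf{i_1}$, $\mathcal{P}_2(z_1+z_2\mathbf{i_2})=z_1+z_2\mathbf{i_1}$. With $\mathbf{e_1}=(1+\mathbf{j})/2$, $\mathbf{e_2}=(1-\mathbf{j})/2$, every $w\in\mathbb{T}$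 is uniquely $w=\mathcal{P}_1(w)\mathbf{e_1}+\mathcal{P}_2(w)\mathbf{e_2}$, and the ring operations act componentwise. A domain is a nonempty open connected set. The null-cone is $\mathcal{NC}=\{z_1+z_2\mathbf{i_2}\in\mathbb{T}: z_1^2+z_2^2=0\}$; $w\in\mathbb{T}$ is invertible if and only if $w\notin\mathcal{NC}$. Extended bicomplex plane: $\overline{\mathbb{T}}$ is the set of all formal $w=w_1\mathbf{e_1}+w_2\mathbf{e_2}$ with $w_1,w_2\in\overline{\mathbb{C}(\mathbf{i_1})}=\mathbb{C}(\mathbf{i_1})\cup\{\infty\}$; $\mathcal{P}_i(w)=w_i$ extends the projections to $\overline{\mathbb{T}}$. Chordal metrics: $\chi$ is the chordal metric on $\overline{\mathbb{C}(\mathbf{i_1})}$, $\chi(a,b)=\frac{|a-b|}{\sqrt{1+|a|^2}\sqrt{1+|b|^2}}$ for finite $a,b$, $\chi(a,\infty)=\frac{1}{\sqrt{1+|a|^2}}$ for finite $a$, $\chi(\infty,\infty)=0$. The bicomplex chordal metric on $\overline{\mathbb{T}}$ is $\chi_e(z,w)=\sqrt{\frac{\chi^2(\mathcal{P}_1(z),\mathcal{P}_1(w))+\chi^2(\mathcal{P}_2(z),\mathcal{P}_2(w))}{2}}$. Bicomplex holomorphic functions: $f:\Omega\to\mathbb{T}$ is bicomplex holomorphic ($\mathbb{T}$-holomorphic) if there are holomorphic functions $f_{e1}:\mathcal{P}_1(\Omega)\to\mathbb{C}(\mathbf{i_1})$ and $f_{e2}:\mathcal{P}_2(\Omega)\to\mathbb{C}(\mathbf{i_1})$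 such that $f(w)=f_{e1}(\mathcal{P}_1(w))\mathbf{e_1}+f_{e2}(\mathcal{P}_2(w))\mathbf{e_2}$ for all $w\in\Omega$. Normality: a sequence $\{f_n\}$ of $\overline{\mathbb{T}}$-valued functions converges bispherically uniformly to $f$ on a set $E$ if for every $\epsilon>0$ there is $n_0$ with $\chi_e(f_n(w),f(w))<\epsilon$ for all $n\ge n_0$ and $w\in E$. A family $\boldsymbol{F}$ of such functions in $\Omega$ is normal in $\Omega$ if every sequence in $\boldsymbol{F}$ contains a subsequence which converges bispherically uniformly on compact subsets of $\Omega$ (to some $\overline{\mathbb{T}}$-valued function). *)

(* Defs.v *)
From HB Require Import structures.
From mathcomp Require Import all_boot all_order all_algebra.
From mathcomp Require Import complex ring.
From mathcomp Require Import all_classical all_reals all_analysis.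

Set Implicit Arguments.
Unset Strict Implicit.
Unset Printing Implicit Defensive.

Import Order.TTheory GRing.Theory Num.Theory.
Import numFieldNormedType.Exports.

Local Open Scope classical_set_scope.
Local Open Scope ring_scope.
Local Open Scope complex_scope.

(* R[i] with the topology and normed structure of its modulus. *)
HB.instance Definition _ (R : rcfType) := NormedModule.copy R[i] R[i]^o.

(* The pair (z1, z2) stands for z1 + z2 i2. The alias carries the product
   topology, i.e. that of R^4, and its own multiplication, which is not the
   componentwise product of pairs. *)
Definition bicomplex (R : rcfType) : Type := (R[i] * R[i])%type.

HB.instance Definition _ (R : rcfType) :=
  GRing.Zmodule.copy (bicomplex R) (R[i] * R[i])%type.
HB.instance Definition _ (R : rcfType) :=
  Topological.copy (bicomplex R) (R[i] * R[i])%type.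

Section bicomplex_ring.
Variable R : rcfType.
Implicit Types u v w : bicomplex R.

Definition bc_one : bicomplex R := (1, 0).

Definition bc_mul u v : bicomplex R :=
  (u.1 * v.1 - u.2 * v.2, u.1 * v.2 + u.2 * v.1).

Fact bc_mulA : associative bc_mul.
Proof. by move=> [? ?] [? ?] [? ?]; rewrite /bc_mul /=; congr pair; ring. Qed.

Fact bc_mulC : commutative bc_mul.
Proof. by move=> [? ?] [? ?]; rewrite /bc_mul /=; congr pair; ring. Qed.

Fact bc_mul1 : left_id bc_one bc_mul.
Proof. by move=> [? ?]; rewrite /bc_mul /=; congr pair; ring. Qed.

Fact bc_mulDl : left_distributive bc_mul +%R.
Proof.
by move=> [a b] [c d] [e f]; congr pair; rewrite /=; ring.
Qed.

Fact bc_one_neq0 : bc_one != 0.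
Proof. by apply/eqP => -[/eqP]; rewrite oner_eq0. Qed.

HB.instance Definition _ := GRing.Zmodule_isComNzRing.Build (bicomplex R)
  bc_mulA bc_mulC bc_mul1 bc_mulDl bc_one_neq0.

Definition bc_unit : pred (bicomplex R) :=
  fun w => w.1 ^+ 2 + w.2 ^+ 2 != 0.

Definition bc_inv w : bicomplex R :=
  if bc_unit w then
    (w.1 / (w.1 ^+ 2 + w.2 ^+ 2), - w.2 / (w.1 ^+ 2 + w.2 ^+ 2))
  else w.

Fact bc_mulVr : {in bc_unit, left_inverse 1 bc_inv *%R}.
Proof.
move=> [a b] uab; rewrite /bc_inv ifT //.
by move: uab; rewrite unfold_in /= => ?; congr pair => /=; field.
Qed.

Fact bc_unitP u v : v * u = 1 -> bc_unit u.
Proof.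
case: u v => [a b] [c d] [e1 e2]; apply/eqP => /= ab0.
have : (c ^+ 2 + d ^+ 2) * (a ^+ 2 + b ^+ 2) =
  (c * a - d * b) ^+ 2 + (c * b + d * a) ^+ 2 by ring.
rewrite ab0 e1 e2 mulr0 expr1n expr0n addr0 => /esym/eqP.
by rewrite oner_eq0.
Qed.

Fact bc_inv_out : {in [predC bc_unit], bc_inv =1 id}.
Proof. by move=> w /negbTE uw; rewrite /bc_inv -[bc_unit w]/(w \in bc_unit) uw. Qed.

HB.instance Definition _ := GRing.ComNzRing_hasMulInverse.Build (bicomplex R)
  bc_mulVr bc_unitP bc_inv_out.

Definition ofC (z : R[i]) : bicomplex R := (z, 0).

Definition bi1 : bicomplex R := ofC 'i%C.
Definition bi2 : bicomplex R := (0, 1).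
Definition bj : bicomplex R := bi1 * bi2.

Definition e1 : bicomplex R := (1 + bj) / 2%:R.
Definition e2 : bicomplex R := (1 - bj) / 2%:R.

Lemma bi1_sqr : bi1 * bi1 = -1.
Proof.
have i2 : 'i%C * 'i%C = -1 :> R[i] by rewrite -expr2 sqr_i.
by congr pair; rewrite /= ?i2; ring.
Qed.

Lemma bi2_sqr : bi2 * bi2 = -1.
Proof. by congr pair => /=; ring. Qed.

Lemma bj_sqr : bj * bj = 1.
Proof. by rewrite /bj mulrACA bi1_sqr bi2_sqr mulrNN mulr1. Qed.

Definition P1 w : R[i] := w.1 - w.2 * 'i%C.
Definition P2 w : R[i] := w.1 + w.2 * 'i%C.

Definition null_cone : set (bicomplex R) :=
  [set w | w.1 ^+ 2 + w.2 ^+ 2 = 0].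

Lemma bicomplexE w : w = ofC w.1 + ofC w.2 * bi2.
Proof. by case: w => a b; congr pair => /=; ring. Qed.

Lemma unit_null_cone w : w \is a GRing.unit <-> ~ null_cone w.
Proof. by split=> [/negP h /eqP|h]; [exact: h|apply/negP => /eqP]. Qed.

Let two_unit : (2%:R : bicomplex R) \is a GRing.unit.
Proof.
have -> : (2%:R : bicomplex R) = (2%:R, 0) by congr pair; rewrite /= addr0.
by apply/unit_null_cone => /= /eqP; rewrite expr0n addr0 sqrf_eq0 pnatr_eq0.
Qed.

Lemma idempotent_repr w : w = ofC (P1 w) * e1 + ofC (P2 w) * e2.
Proof.
have E1 : e1 * 2%:R = 1 + bj by rewrite divrK.
have E2 : e2 * 2%:R = 1 - bj by rewrite divrK.
apply: (mulIr two_unit); rewrite mulrDl -(mulrA _ e1) E1 -(mulrA _ e2) E2.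
have i2 : 'i%C * 'i%C = -1 :> R[i] by rewrite -expr2 sqr_i.
case: w => a b; congr pair => /=; rewrite /P1 /P2 /=.
  by ring.
rewrite [LHS](_ : _ = - (b *+ 2) * ('i%C * 'i%C)); first by ring.
by rewrite i2; ring.
Qed.

End bicomplex_ring.

Arguments e1 {R}.
Arguments e2 {R}.
Arguments null_cone {R}.

Definition riemann_sphere (R : rcfType) : Type :=
  one_point_compactification R[i].

(* Here, unlike in [bicomplex], the pair (w1, w2) stands for w1 e1 + w2 e2. *)
Definition ebicomplex (R : rcfType) : Type :=
  (riemann_sphere R * riemann_sphere R)%type.

Section chordal.
Variable R : rcfType.

Definition ext_bicomplex (w : bicomplex R) : ebicomplex R :=
  (Some (P1 w), Some (P2 w)).

Definition modC (z : R[i]) : R := ComplexField.Normc.normc z.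

Definition chordal (a b : riemann_sphere R) : R :=
  match a, b with
  | Some a, Some b =>
      modC (a - b) / (Num.sqrt (1 + modC a ^+ 2) * Num.sqrt (1 + modC b ^+ 2))
  | Some a, None => 1 / Num.sqrt (1 + modC a ^+ 2)
  | None, Some b => 1 / Num.sqrt (1 + modC b ^+ 2)
  | None, None => 0
  end.

Definition bichordal (z w : ebicomplex R) : R :=
  Num.sqrt ((chordal z.1 w.1 ^+ 2 + chordal z.2 w.2 ^+ 2) / 2%:R).

End chordal.

(* Functions on a set [Omega] are represented by total functions, of which
   only the values on [Omega] matter. *)

Section normality.
Variable R : rcfType.

Definition domain (T : topologicalType) (Omega : set T) : Prop :=
  [/\ Omega !=set0, open Omega & connected Omega].

(* Derivability over the field R[i] is complex differentiability; this is
   holomorphy on [U] when [U] is open. *)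
Definition holomorphic_on (U : set R[i]) (g : R[i] -> R[i]) : Prop :=
  forall z, U z -> derivable g z 1.

(* P1 and P2 are open maps, so the images of an open [Omega] are open. *)
Definition bicomplex_holomorphic (Omega : set (bicomplex R))
    (f : bicomplex R -> bicomplex R) : Prop :=
  exists fe1 fe2 : R[i] -> R[i],
    [/\ holomorphic_on (@P1 R @` Omega) fe1,
        holomorphic_on (@P2 R @` Omega) fe2 &
        forall w, Omega w ->
          f w = ofC (fe1 (P1 w)) * e1 + ofC (fe2 (P2 w)) * e2].

Definition bispherically_uniform (E : set (bicomplex R))
    (f_ : nat -> bicomplex R -> ebicomplex R)
    (f : bicomplex R -> ebicomplex R) : Prop :=
  forall eps : R, 0 < eps -> exists n0 : nat,
    forall n w, (n0 <= n)%N -> E w -> bichordal (f_ n w) (f w) < eps.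

Definition normal_family (Omega : set (bicomplex R))
    (F : set (bicomplex R -> ebicomplex R)) : Prop :=
  forall f_ : nat -> bicomplex R -> ebicomplex R, (forall n, F (f_ n)) ->
    exists phi : nat -> nat, increasing_seq phi /\
      exists f : bicomplex R -> ebicomplex R,
        forall K : set (bicomplex R), compact K -> K `<=` Omega ->
          bispherically_uniform K (f_ \o phi) f.

Definition null_cone_translates (alpha beta : bicomplex R) :
    set (bicomplex R) :=
  [set w | null_cone (w - alpha)] `|` [set w | null_cone (w - beta)].

End normality.

(* Main.v *)
Require Import Defs.
From mathcomp Require Import all_boot all_order all_algebra.
From mathcomp Require Import complex ring lra.
From mathcomp Require Import all_classical all_reals all_analysis.

(** Why the theorem holds. In the idempotent coordinates a bicomplex holomorphic
    function is a pair of holomorphic functions of one complex variable each. The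
    hypotheses say that each of them omits two distinct values, the same for the
    whole family. The theorem is thus a form of Montel's criterion: holomorphic
    functions that omit two fixed values form a normal family for the chordal
    metric.

    Montel's criterion is proved by differential geometry in the style of Ahlfors
    and Robinson. The plane without [0] and [1] carries an explicit conformal
    metric whose curvature is bounded above by a negative constant and which
    dominates the spherical metric up to a factor ([curvature_ineq],
    [density_lower]). Ahlfors' lemma compares its pullback by a holomorphic
    function [g] of a disc with the hyperbolic metric of the disc: at a maximum of
    their ratio the Laplacian of the logarithm is nonpositive, and this bounds
    the ratio. The result is a bound on the spherical derivative of [g] that
    depends on the disc only ([spherical_bound]). Followed along segments, it
    makes the functions chordally equicontinuous, with constants common to the
    family ([chordal_lipschitz], [omitting_equicontinuous]). The Riemann sphere
    being compact, the theorem of Arzela and Ascoli ([ascoli]) extracts the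
    locally uniformly convergent subsequence.

    The Laplacian of [ln |g'|] involves the third derivative of [g], while
    holomorphy only means that [g] is complex differentiable at each point. The
    first half of the file closes this gap by the classical route: Goursat's
    theorem for rectangles ([goursat]), Cauchy's formula ([cauchy_formula]), and
    from it the differentiability of the derivative and Taylor expansions
    ([holo_holo_cderiv], [holo_taylor]). Laplacians are read off second-order
    expansions ([jet]), which makes the second derivative test ([jet_max])
    elementary. One bisection principle, [cousin_square], passes from local to
    global throughout: in Goursat's theorem, in the mean value inequalities, and
    for the existence of a maximum on a disc. *)

Set Implicit Arguments.
Unset Strict Implicit.
Unset Printing Implicit Defensive.

Import Order.TTheory GRing.Theory Num.Theory.
Import numFieldNormedType.Exports.

Local Open Scope classical_set_scope.
Local Open Scope ring_scope.
Local Open Scope complex_scope.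

(** * Continuity and differentiability in the complex plane *)

Section modulus.
Variable R : realType.
Implicit Types z w : R[i].

Lemma normE z : `|z| = (modC z)%:C.
Proof. by rewrite normc_def; case: z. Qed.

Lemma modC_ge0 z : 0 <= modC z.
Proof. by case: z => a b; rewrite /modC /= sqrtr_ge0. Qed.

Lemma modC0 : modC (0 : R[i]) = 0.
Proof. exact: ComplexField.Normc.normc0. Qed.

Lemma modC1 : modC (1 : R[i]) = 1.
Proof. exact: ComplexField.Normc.normc1. Qed.

Lemma modCM z w : modC (z * w) = modC z * modC w.
Proof. exact: ComplexField.Normc.normcM. Qed.

Lemma modCV z : modC z^-1 = (modC z)^-1.
Proof. exact: ComplexField.Normc.normcV. Qed.

Lemma modCN z : modC (- z) = modC z.
Proof. exact: normcN. Qed.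

Lemma modCD z w : modC (z + w) <= modC z + modC w.
Proof. exact: le_normcD. Qed.

Lemma modCB z w : modC (z - w) = modC (w - z).
Proof. by rewrite -modCN opprB. Qed.

Lemma modCX z n : modC (z ^+ n) = modC z ^+ n.
Proof. by elim: n => [|n IH]; rewrite ?expr0 ?modC1// !exprS modCM IH. Qed.

Lemma modC_eq0 z : (modC z == 0) = (z == 0).
Proof.
apply/eqP/eqP => [|->]; last exact: modC0.
exact: ComplexField.Normc.eq0_normc.
Qed.

Lemma modC_gt0 z : (0 < modC z) = (z != 0).
Proof. by rewrite lt_neqAle modC_ge0 andbT eq_sym modC_eq0. Qed.

Lemma modC_real (x : R) : modC x%:C = `|x|.
Proof. by rewrite /modC /= expr0n addr0 sqrtr_sqr. Qed.

Lemma modCi : modC ('i : R[i]) = 1.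
Proof. by rewrite /modC /= expr0n add0r expr1n sqrtr1. Qed.

Lemma modC_sqr z : modC z ^+ 2 = complex.Re z ^+ 2 + complex.Im z ^+ 2.
Proof. by case: z => a b; rewrite /modC /= sqr_sqrtr // addr_ge0 // sqr_ge0. Qed.

Lemma le_Re_modC z : `|complex.Re z| <= modC z.
Proof.
rewrite -(ler_pXn2r (n := 2)) ?nnegrE ?modC_ge0// modC_sqr real_normK ?num_real//.
by rewrite lerDl sqr_ge0.
Qed.

Lemma le_Im_modC z : `|complex.Im z| <= modC z.
Proof.
rewrite -(ler_pXn2r (n := 2)) ?nnegrE ?modC_ge0// modC_sqr real_normK ?num_real//.
by rewrite lerDr sqr_ge0.
Qed.

Lemma modC_le_ReIm z : modC z <= `|complex.Re z| + `|complex.Im z|.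
Proof.
rewrite -(ler_pXn2r (n := 2)) ?nnegrE ?modC_ge0 ?addr_ge0// modC_sqr.
rewrite sqrrD !real_normK ?num_real// addrAC lerDl.
by rewrite mulrn_wge0 ?mulr_ge0.
Qed.

Lemma Re_le_modC (z : R[i]) : complex.Re z <= modC z.
Proof. by have := le_Re_modC z; have := ler_norm (complex.Re z); lra. Qed.

Lemma ReD (z w : R[i]) : complex.Re (z + w) = complex.Re z + complex.Re w.
Proof. by case: z w => [? ?] [? ?]. Qed.

Lemma ReN (z : R[i]) : complex.Re (- z) = - complex.Re z.
Proof. by case: z. Qed.

Lemma ReZ (r : R) (z : R[i]) : complex.Re (r%:C * z) = r * complex.Re z.
Proof. by case: z => x y /=; rewrite mul0r subr0. Qed.

Lemma ReB z w : complex.Re (z - w) = complex.Re z - complex.Re w.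
Proof. by case: z w => [? ?] [? ?]. Qed.

Lemma ImB z w : complex.Im (z - w) = complex.Im z - complex.Im w.
Proof. by case: z w => [? ?] [? ?]. Qed.

Lemma modC_conjc z : modC (conjc z) = modC z.
Proof. by case: z => x y; rewrite /modC /= sqrrN. Qed.

Lemma nbhsC z (A : set R[i]) :
  nbhs z A <-> exists2 d : R, 0 < d & forall w, modC (w - z) < d -> A w.
Proof.
split.
  case/nbhs_ballP => e /= e0 eA; exists (complex.Re e).
    by move: e0; rewrite ltcE => /andP[].
  move=> w wz; apply: eA; rewrite /ball /= distrC normE ltcE /= wz andbT.
  by move: e0; rewrite ltcE => /andP[].
case=> d d0 dA; apply/nbhs_ballP; exists (d%:C) => /=; first by rewrite ltcR.
by move=> w; rewrite /ball /= distrC normE ltcR; exact: dA.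
Qed.

(** The norm of [R[i]] takes its values in [R[i]]; continuity and
    differentiability are expressed here with the real modulus [modC]. *)
Definition ccont (f : R[i] -> R[i]) z := forall e : R, 0 < e ->
  exists2 d : R, 0 < d & forall w, modC (w - z) < d -> modC (f w - f z) < e.

Lemma ccont_cst c z : ccont (fun=> c) z.
Proof. by move=> e e0; exists 1 => // w _; rewrite subrr modC0. Qed.

Lemma ccont_id z : ccont id z.
Proof. by move=> e e0; exists e. Qed.

Lemma ccontD f g z : ccont f z -> ccont g z -> ccont (fun w => f w + g w) z.
Proof.
move=> fc gc e e0; have e2 : 0 < e / 2 by lra.
have [a a0 aA] := fc _ e2; have [b b0 bB] := gc _ e2.
exists (Num.min a b); first by rewrite lt_min a0.
move=> w; rewrite lt_min => /andP[wa wb].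
have -> : f w + g w - (f z + g z) = (f w - f z) + (g w - g z).
  by rewrite opprD addrACA.
have := modCD (f w - f z) (g w - g z); have := aA _ wa; have := bB _ wb; lra.
Qed.

Lemma ccontN f z : ccont f z -> ccont (fun w => - f w) z.
Proof.
move=> fc e /fc[d d0 dA]; exists d => // w /dA.
by rewrite -opprD modCN.
Qed.

Lemma ccontB f g z : ccont f z -> ccont g z -> ccont (fun w => f w - g w) z.
Proof. by move=> fc gc; apply: ccontD fc (ccontN gc). Qed.

Lemma ccontM f g z : ccont f z -> ccont g z -> ccont (fun w => f w * g w) z.
Proof.
move=> fc gc e e0.
pose M := 1 + modC (f z) + modC (g z).
have M1 : 1 <= M by have := modC_ge0 (f z); have := modC_ge0 (g z); rewrite /M; lra.
pose t := Num.min 1 (e / M).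
have t0 : 0 < t by rewrite lt_min ltr01 divr_gt0 //; lra.
have t1 : t <= 1 by rewrite ge_min lexx.
have tM : t * M <= e by rewrite -ler_pdivlMr ?ge_min ?lexx ?orbT //; lra.
have [a a0 aA] := fc _ t0; have [b b0 bB] := gc _ t0.
exists (Num.min a b); first by rewrite lt_min a0.
move=> w; rewrite lt_min => /andP[/aA wa /bB wb].
have -> : f w * g w - f z * g z = (f w - f z) * (g w - g z)
   + f z * (g w - g z) + (f w - f z) * g z by ring.
have := modCD ((f w - f z) * (g w - g z) + f z * (g w - g z)) ((f w - f z) * g z).
have := modCD ((f w - f z) * (g w - g z)) (f z * (g w - g z)).
rewrite !modCM => H1 H2.
have p0 := modC_ge0 (f w - f z); have q0 := modC_ge0 (g w - g z).
have P0 := modC_ge0 (f z); have Q0 := modC_ge0 (g z).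
move: H1 H2 tM wa wb p0 q0 P0 Q0; rewrite /M.
set p := modC (f w - f z); set q := modC (g w - g z).
set P := modC (f z); set Q := modC (g z) => H1 H2 tM wa wb p0 q0 P0 Q0.
have pq : p * q <= p by rewrite ler_piMr //; lra.
have Pq : P * q <= P * t by rewrite ler_wpM2l // ltW.
have pQ : p * Q <= t * Q by rewrite ler_wpM2r // ltW.
by move: H2 H1; lra.
Qed.

Lemma ccontV z w : z != w -> ccont (fun u => (u - w)^-1) z.
Proof.
move=> zw e e0; have zw0 : z - w != 0 by rewrite subr_eq0.
have m0 : 0 < modC (z - w) by rewrite modC_gt0.
set m := modC (z - w) in m0.
exists (Num.min (m / 2) (e * m ^+ 2 / 2)).
  by rewrite lt_min divr_gt0//= divr_gt0// mulr_gt0// exprn_gt0.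
move=> u; rewrite lt_min => /andP[um ue].
have mu : m / 2 < modC (u - w).
  have := modCD (z - u) (u - w); rewrite addrA subrK -/m modCB; lra.
have uw0 : u - w != 0 by rewrite -modC_gt0; lra.
have -> : (u - w)^-1 - (z - w)^-1 = (z - u) * ((u - w)^-1 * (z - w)^-1).
  by field; rewrite zw0 uw0.
rewrite !modCM !modCV (modCB z) -/m -invfM ltr_pdivrMr; last by rewrite mulr_gt0//; lra.
apply: (lt_le_trans ue).
have : m / 2 * m <= modC (u - w) * m by rewrite ler_wpM2r // ltW.
move=> H; have : e * (m / 2 * m) <= e * (modC (u - w) * m) by rewrite ler_wpM2l // ltW.
by rewrite expr2; lra.
Qed.

(** Caratheodory's form of complex differentiability: differentiation rules
    become algebra on the continuous slope [q]. *)
Definition cdiff (f : R[i] -> R[i]) z (a : R[i]) :=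
  exists q : R[i] -> R[i], [/\ ccont q z, q z = a &
    forall w, f w - f z = q w * (w - z)].

Lemma derivable_cdiff (f : R[i] -> R[i]) z : derivable f z 1 ->
  exists a, cdiff f z a.
Proof.
move=> /cvg_ex[/= a fa]; exists a.
exists (fun w => if w == z then a else (f w - f z) / (w - z)); split.
- move=> e e0; rewrite eqxx.
  have : nbhs a [set y | modC (y - a) < e] by apply/nbhsC; exists e.
  move=> /fa; rewrite /nbhs/= /dnbhs /= => /nbhsC[d d0 dA].
  exists d => // w wd /=; case: (eqVneq w z) => [_|wz]; first by rewrite subrr modC0.
  have := dA (w - z); rewrite subr0 subr_eq0 => /(_ wd wz).
  rewrite /GRing.scale /= mulr1 subrK mulrC.
  by apply.
- by rewrite eqxx.
- move=> w; case: (eqVneq w z) => [->|wz]; first by rewrite !subrr mulr0.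
  by rewrite mulfVK // subr_eq0.
Qed.

Lemma cdiff_cont f z a : cdiff f z a -> ccont f z.
Proof.
case=> q [qc qa qE].
have -> : f = fun w => f z + q w * (w - z).
  by apply: funext => w; rewrite -qE addrC subrK.
apply: ccontD; first exact: ccont_cst.
by apply: ccontM => //; apply: ccontB; [exact: ccont_id|exact: ccont_cst].
Qed.

Lemma cdiff_eps f z a : cdiff f z a -> forall e : R, 0 < e ->
  exists2 d : R, 0 < d & forall w, modC (w - z) < d ->
    modC (f w - f z - a * (w - z)) <= e * modC (w - z).
Proof.
case=> q [qc qa qE] e e0; move: qc => /(_ _ e0)[d d0 dA].
exists d => // w wd; rewrite qE -mulrBl modCM -qa.
by rewrite ler_wpM2r ?modC_ge0// ltW // dA.
Qed.

Lemma cdiffM f g z a b : cdiff f z a -> cdiff g z b ->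
  cdiff (fun w => f w * g w) z (a * g z + f z * b).
Proof.
move=> df dg; have fc := cdiff_cont df; have gc := cdiff_cont dg.
case: df dg => p [pc pa pE] [q [qc qb qE]].
exists (fun w => p w * g w + f z * q w); split.
- by apply: ccontD; apply: ccontM => //; exact: ccont_cst.
- by rewrite pa qb.
- move=> w; have -> : f w = f z + p w * (w - z) by rewrite -pE addrC subrK.
  have -> : g w = g z + q w * (w - z) by rewrite -qE addrC subrK.
  by ring.
Qed.

Lemma cdiffVB z w : z != w -> cdiff (fun u => (u - w)^-1) z (- (z - w)^-2).
Proof.
move=> zw; have zw0 : z - w != 0 by rewrite subr_eq0.
have zwm : 0 < modC (z - w) by rewrite modC_gt0.
exists (fun u => if u == w then (z - w)^-1 * (z - w)^-1
                 else - ((u - w)^-1 * (z - w)^-1)); split.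
- have : ccont (fun u => - ((u - w)^-1 * (z - w)^-1)) z.
    by apply: ccontN; apply: ccontM; [exact: ccontV|exact: ccont_cst].
  move=> H e /H[d d0 dA].
  exists (Num.min d (modC (z - w))); first by rewrite lt_min d0.
  move=> u; rewrite lt_min => /andP[ud uzw].
  rewrite (negbTE zw); case: (eqVneq u w) => [uw|_]; last exact: dA.
  by move: uzw; rewrite uw modCB ltxx.
- by rewrite (negbTE zw) expr2 invfM.
- move=> u; case: eqVneq => [->|uw].
    by rewrite subrr invr0 sub0r -[w - z]opprB mulrN mulfVK.
  have uw0 : u - w != 0 by rewrite subr_eq0.
  by field; rewrite zw0 uw0.
Qed.

End modulus.

(** * Bisection *)

Section cousin.
Variable R : realType.

Lemma halving_lt (s e : R) : 0 < s -> 0 < e -> exists n, s / 2 ^+ n < e.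
Proof.
move=> s0 e0; exists (Num.bound (s / e)).
have H : s / e < (Num.bound (s / e))%:R.
  by apply: archi_boundP; rewrite divr_ge0// ltW.
rewrite ltr_pdivrMr ?exprn_gt0// mulrC -ltr_pdivrMr//.
apply: (lt_le_trans H); rewrite -natrX ler_nat.
exact: (ltnW (ltn_expl _ _)).
Qed.

(** Bisection: if [P] failed on the whole square, it would fail on one of its
    quarters, then on a quarter of that one, and so on; this contradicts [P]
    near the limit of the nested squares. *)
Lemma cousin_square (P : R -> R -> R -> Prop) (x0 y0 s0 : R) : 0 < s0 ->
  (forall x y s, 0 < s ->
    P x y (s / 2) -> P (x + s / 2) y (s / 2) ->
    P x (y + s / 2) (s / 2) -> P (x + s / 2) (y + s / 2) (s / 2) -> P x y s) ->
  (forall a b, x0 <= a <= x0 + s0 -> y0 <= b <= y0 + s0 ->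
    exists2 d : R, 0 < d & forall x y s, 0 < s -> s < d ->
      x0 <= x -> x + s <= x0 + s0 -> y0 <= y -> y + s <= y0 + s0 ->
      x <= a <= x + s -> y <= b <= y + s -> P x y s) ->
  P x0 y0 s0.
Proof.
move=> s00 Padd Ploc; apply: contrapT => nP0.
pose bad (u : R * R * R) := 0 < u.2 /\ ~ P u.1.1 u.1.2 u.2.
pose quarter (u v : R * R * R) := [/\ v.2 = u.2 / 2,
  (v.1.1 = u.1.1 \/ v.1.1 = u.1.1 + u.2 / 2) &
  (v.1.2 = u.1.2 \/ v.1.2 = u.1.2 + u.2 / 2)].
have step u : exists v, bad u -> bad v /\ quarter u v.
  have [[u0 nPu]|] := pselect (bad u); last by exists u.
  have h0 : 0 < u.2 / 2 by rewrite divr_gt0.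
  have [p1|p1] := pselect (P u.1.1 u.1.2 (u.2 / 2)); last first.
    by exists (u.1.1, u.1.2, u.2 / 2); split; split => //=; left.
  have [p2|p2] := pselect (P (u.1.1 + u.2 / 2) u.1.2 (u.2 / 2)); last first.
    by exists (u.1.1 + u.2 / 2, u.1.2, u.2 / 2); split; split => //=; [right|left].
  have [p3|p3] := pselect (P u.1.1 (u.1.2 + u.2 / 2) (u.2 / 2)); last first.
    by exists (u.1.1, u.1.2 + u.2 / 2, u.2 / 2); split; split => //=; [left|right].
  have [p4|p4] := pselect (P (u.1.1 + u.2 / 2) (u.1.2 + u.2 / 2) (u.2 / 2)); last first.
    by exists (u.1.1 + u.2 / 2, u.1.2 + u.2 / 2, u.2 / 2);
      split; split => //=; right.
  by exfalso; apply: nPu; apply: Padd.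
have [nx nxP] := choice step.
pose u n := iter n nx (x0, y0, s0).
have badu n : bad (u n).
  by elim: n => [|n /nxP[]].
have qu n : quarter (u n) (u n.+1) by case: (nxP _ (badu n)).
have sn n : (u n).2 = s0 / 2 ^+ n.
  elim: n => [|n IH]; first by rewrite expr0 divr1.
  by case: (qu n) => -> _ _; rewrite IH exprS; field; rewrite expf_neq0.
have s_gt0 n : 0 < (u n).2 by case: (badu n).
have xm n : (u n).1.1 <= (u n.+1).1.1 /\ (u n.+1).1.1 + (u n.+1).2 <= (u n).1.1 + (u n).2.
  by case: (qu n) => -> [->|->] _; have := s_gt0 n; split; lra.
have ym n : (u n).1.2 <= (u n.+1).1.2 /\ (u n.+1).1.2 + (u n.+1).2 <= (u n).1.2 + (u n).2.
  by case: (qu n) => -> _ [->|->]; have := s_gt0 n; split; lra.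
have xmm n k : (u n).1.1 <= (u (n + k)%N).1.1 /\
    (u (n + k)%N).1.1 + (u (n + k)%N).2 <= (u n).1.1 + (u n).2.
  elim: k => [|k [IH1 IH2]]; first by rewrite addn0.
  by rewrite addnS; case: (xm (n + k)%N) => h1 h2; split; lra.
have ymm n k : (u n).1.2 <= (u (n + k)%N).1.2 /\
    (u (n + k)%N).1.2 + (u (n + k)%N).2 <= (u n).1.2 + (u n).2.
  elim: k => [|k [IH1 IH2]]; first by rewrite addn0.
  by rewrite addnS; case: (ym (n + k)%N) => h1 h2; split; lra.
have limP (f : nat -> R) : (forall n k, f n <= f (n + k)%N /\
    f (n + k)%N + (u (n + k)%N).2 <= f n + (u n).2) ->
    forall n, f n <= sup (range f) <= f n + (u n).2.
  move=> fm n.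
  have ub m : ubound (range f) (f m + (u m).2).
    move=> _ [k _ <-]; have [mk|km] := leqP m k.
      have [_] := fm m (k - m)%N; rewrite subnKC//.
      by have := s_gt0 k; lra.
    have [h _] := fm k (m - k)%N; move: h; rewrite subnKC 1?ltnW//.
    by have := s_gt0 m; lra.
  apply/andP; split.
    by apply: ub_le_sup; [exists (f n + (u n).2)|exists n].
  by apply: ge_sup; [exists (f n), n|].
pose a := sup (range (fun n => (u n).1.1)).
pose b := sup (range (fun n => (u n).1.2)).
have an := limP _ xmm : forall n, (u n).1.1 <= a <= _.
have bn := limP _ ymm : forall n, (u n).1.2 <= b <= _.
have [d d0 dP] := Ploc a b (an 0%N) (bn 0%N).
have [n nd] := halving_lt s00 d0.
have [_] := badu n; apply; have [xa xb] := xmm 0%N n; have [ya yb] := ymm 0%N n.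
by apply: dP => //; rewrite sn.
Qed.

(** A property of intervals is a property of squares that ignores the second
    coordinate. *)
Lemma cousin_itv (P : R -> R -> Prop) (a b : R) : a < b ->
  (forall x y z, x <= y -> y <= z -> P x y -> P y z -> P x z) ->
  (forall t, a <= t <= b -> exists2 d : R, 0 < d &
    forall x y, a <= x -> x <= t -> t <= y -> y <= b -> y - x < d -> P x y) ->
  P a b.
Proof.
move=> ab Padd Ploc.
have := @cousin_square (fun x _ s => P x (x + s)) a 0 (b - a).
rewrite subrKC; apply; first by rewrite subr_gt0.
- move=> x _ s s0 h1 h2 _ _; apply: Padd h1 _; [lra|lra|].
  by move: h2; rewrite -addrA -splitr.
- move=> t c /Ploc[d d0 dP] _; exists d => // x _ s s0 sd ax sb _ _ /andP[xt ts] _.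
  by apply: dP => //; lra.
Qed.

End cousin.

(** * Primitives of continuous paths *)

Section primitive.
Variable R : realType.
Implicit Types (F G Phi Psi : R -> R[i]) (a b t : R).

Definition pcont F t := forall e : R, 0 < e ->
  exists2 d : R, 0 < d & forall s, `|s - t| < d -> modC (F s - F t) < e.

(** Only increments inside [[a, b]] count, so that a primitive can be
    restricted to a smaller interval. *)
Definition prim Phi F a b := forall t, a <= t -> t <= b ->
  forall e : R, 0 < e -> exists2 d : R, 0 < d &
    forall s, a <= s -> s <= b -> `|s - t| < d ->
      modC (Phi s - Phi t - (s - t)%:C * F t) <= e * `|s - t|.

(** Mean value inequality, by bisection. The constant [c] serves to test the
    increment in any direction of the plane. *)
Lemma prim_Re_le Phi F a b (c : R[i]) M : a <= b -> prim Phi F a b ->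
  (forall t, a <= t -> t <= b -> complex.Re (c * F t) <= M) ->
  complex.Re (c * (Phi b - Phi a)) <= M * (b - a).
Proof.
rewrite le_eqVlt => /predU1P[->|ab] pF FM.
  by rewrite !subrr !mulr0 /=.
apply/ler_addgt0Pr => e e0; set e' := e / (b - a).
have ba0 : 0 < b - a by rewrite subr_gt0.
have e'0 : 0 < e' by rewrite divr_gt0.
have -> : M * (b - a) + e = (M + e') * (b - a) by rewrite mulrDl divfK ?gt_eqF.
apply: (@cousin_itv R (fun x y => complex.Re (c * (Phi y - Phi x)) <= (M + e') * (y - x))) => //.
  move=> x y z xy yz h1 h2; have -> : Phi z - Phi x = (Phi y - Phi x) + (Phi z - Phi y) by ring.
  rewrite mulrDr ReD; lra.
move=> t /andP[at_ tb]; have c1 : 0 < modC c + 1 by have := modC_ge0 c; lra.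
have [d d0 dP] := pF t at_ tb _ (divr_gt0 e'0 c1).
have dP' s : a <= s -> s <= b -> `|s - t| < d ->
    complex.Re (c * (Phi s - Phi t - (s - t)%:C * F t)) <= e' * `|s - t| /\
    - complex.Re (c * (Phi s - Phi t - (s - t)%:C * F t)) <= e' * `|s - t|.
  move=> as_ sb sd; have := dP s as_ sb sd; set r := (X in modC X) => rP.
  have cr : modC (c * r) <= e' * `|s - t|.
    rewrite modCM; apply: (le_trans (y := (modC c + 1) * modC r)).
      by rewrite ler_wpM2r ?modC_ge0//; lra.
    by rewrite mulrC -ler_pdivlMr// mulrAC.
  have := Re_le_modC (c * r); have := Re_le_modC (- (c * r)).
  by rewrite modCN ReN; split; lra.
exists d => // x y ax xt ty yb yxd.
have xE : `|x - t| = t - x by rewrite distrC ger0_norm//; lra.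
have yE : `|y - t| = y - t by rewrite ger0_norm//; lra.
have xd : `|x - t| < d by rewrite xE; lra.
have yd : `|y - t| < d by rewrite yE; lra.
have [_] := dP' x ax (le_trans xt tb) xd; have [+ _] := dP' y (le_trans at_ ty) yb yd.
rewrite xE yE => hy hx.
have := FM t at_ tb => hF.
have -> : c * (Phi y - Phi x) = c * (Phi y - Phi t - (y - t)%:C * F t)
   - c * (Phi x - Phi t - (x - t)%:C * F t) + (y - x)%:C * (c * F t).
  by rewrite !rmorphB; ring.
rewrite !ReD ReN ReZ.
have : (y - x) * complex.Re (c * F t) <= (y - x) * M by rewrite ler_wpM2l//; lra.
by lra.
Qed.

(** The increment is tested in its own direction. *)
Lemma prim_modC_le Phi F a b M : a <= b -> prim Phi F a b ->
  (forall t, a <= t -> t <= b -> modC (F t) <= M) ->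
  modC (Phi b - Phi a) <= M * (b - a).
Proof.
move=> ab pF FM; set D := Phi b - Phi a.
have M0 : 0 <= M by apply: le_trans (FM a (lexx _) ab); exact: modC_ge0.
have [->|D0] := eqVneq D 0; first by rewrite modC0 mulr_ge0// subr_ge0.
have mD : 0 < modC D by rewrite modC_gt0.
have conjm : modC (conjc D) = modC D.
  by case: (D) => x y; rewrite /modC /= sqrrN.
have conjD : complex.Re (conjc D * D) = modC D ^+ 2.
  by rewrite modC_sqr; case: (D) => x y /=; ring.
have := @prim_Re_le _ _ _ _ (conjc D) (modC D * M) ab pF.
rewrite -/D conjD expr2 -mulrA ler_pM2l//; apply => t at_ tb.
apply: le_trans (Re_le_modC _) _; rewrite modCM conjm ler_wpM2l ?modC_ge0//.
exact: FM.
Qed.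

Lemma primD Phi F Psi G a b : prim Phi F a b -> prim Psi G a b ->
  prim (fun t => Phi t + Psi t) (fun t => F t + G t) a b.
Proof.
move=> pF pG t at_ tb e e0; have e2 : 0 < e / 2 by lra.
have [d d0 dP] := pF t at_ tb _ e2; have [d' d'0 dP'] := pG t at_ tb _ e2.
exists (Num.min d d'); first by rewrite lt_min d0.
move=> s as_ sb; rewrite lt_min => /andP[sd sd'].
have := dP s as_ sb sd; have := dP' s as_ sb sd'.
set u := Psi s - _ - _; set v := Phi s - _ - _ => hu hv.
have -> : Phi s + Psi s - (Phi t + Psi t) - (s - t)%:C * (F t + G t) = u + v.
  by rewrite /u /v; ring.
by have := modCD u v; lra.
Qed.

Lemma primZ Phi F c a b : prim Phi F a b ->
  prim (fun t => c * Phi t) (fun t => c * F t) a b.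
Proof.
move=> pF t at_ tb e e0; have c1 : 0 < modC c + 1 by have := modC_ge0 c; lra.
have [d d0 dP] := pF t at_ tb _ (divr_gt0 e0 c1).
exists d => // s as_ sb sd.
have -> : c * Phi s - c * Phi t - (s - t)%:C * (c * F t) =
  c * (Phi s - Phi t - (s - t)%:C * F t) by ring.
rewrite modCM; have := dP s as_ sb sd; set r := modC _ => hr.
apply: (le_trans (y := (modC c + 1) * r)).
  by rewrite ler_wpM2r ?modC_ge0//; lra.
by rewrite mulrC -ler_pdivlMr// mulrAC.
Qed.

Lemma prim_unique Phi Psi F a b : a <= b -> prim Phi F a b -> prim Psi F a b ->
  Phi b - Phi a = Psi b - Psi a.
Proof.
move=> ab pF pG; have := primD pF (primZ (-1) pG).
move=> /(prim_modC_le (M := 0) ab) h0; have {h0} := h0 _.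
have F0 t : a <= t -> t <= b -> modC (F t + -1 * F t) <= 0.
  by move=> _ _; rewrite mulN1r subrr modC0.
move=> /(_ F0).
move=> /= h; apply/eqP; rewrite -subr_eq0 -modC_eq0 eq_le modC_ge0 andbT.
move: h; rewrite mul0r; congr (modC _ <= _); ring.
Qed.

Lemma prim_sub Phi F a b a' b' : a <= a' -> b' <= b -> prim Phi F a b ->
  prim Phi F a' b'.
Proof.
move=> aa bb pF t at_ tb e e0.
have [d d0 dP] := pF t (le_trans aa at_) (le_trans tb bb) e e0.
by exists d => // s as_ sb; apply: dP; lra.
Qed.

Lemma eq_prim Phi F G a b : (forall t, a <= t -> t <= b -> F t = G t) ->
  prim Phi F a b -> prim Phi G a b.
Proof.
move=> FG pF t at_ tb e e0; rewrite -FG//; exact: pF.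
Qed.

Lemma prim_cst c a b : prim (fun t => t%:C * c) (fun=> c) a b.
Proof.
move=> t _ _ e e0; exists 1 => // s _ _ _.
rewrite rmorphB (_ : _ - _ = 0) ?modC0 ?mulr_ge0// ?ltW//; ring.
Qed.

Lemma prim_id a b : prim (fun t => (t ^+ 2 / 2)%:C) (fun t => t%:C) a b.
Proof.
move=> t _ _ e e0; exists e => // s _ _ se.
have -> : (s ^+ 2 / 2)%:C - (t ^+ 2 / 2)%:C - (s - t)%:C * t%:C = ((s - t) ^+ 2 / 2)%:C.
  by rewrite -rmorphM -!rmorphB; congr (_%:C); field.
rewrite modC_real ger0_norm ?divr_ge0 ?sqr_ge0// -real_normK ?num_real// expr2.
have : `|s - t| * `|s - t| <= e * `|s - t| by rewrite ler_wpM2r// ltW.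
by have := normr_ge0 (s - t); set x := `|s - t| => x0; have := mulr_ge0 x0 x0; lra.
Qed.

Lemma derivable_eps (G : R -> R) x : derivable G x 1 -> forall e : R, 0 < e ->
  exists2 d : R, 0 < d & forall s, `|s - x| < d ->
    `|G s - G x - (s - x) * derive1 G x| <= e * `|s - x|.
Proof.
move=> dG e e0; rewrite derive1E.
have : h^-1 *: (G (h *: 1 + x) - G x) @[h --> 0^'] --> 'D_1 G x by exact: dG.
move=> /cvgrPdist_lt /(_ _ e0); rewrite /nbhs/= /dnbhs /= => /nbhs_ballP[d d0 dP].
exists d => // s sd; have [->|sx] := eqVneq s x.
  by rewrite !subrr mul0r subrr normr0 mulr0.
have sx0 : s - x != 0 by rewrite subr_eq0.
have := dP (s - x); rewrite /ball /= sub0r normrN => /(_ sd sx0).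
rewrite /GRing.scale /= mulr1 subrK.
set D := 'D_1 G x; set g := G s - G x => h.
have -> : g - (s - x) * D = - ((s - x) * (D - (s - x)^-1 * g)).
  by field.
by rewrite normrN normrM mulrC ler_wpM2r// ltW.
Qed.

(** Extending [f] by its values at [a] and at [b] makes every point of [[a, b]]
    interior to an interval on which the fundamental theorem of calculus
    applies. *)
Lemma exists_real_prim (f : R -> R) a b : a <= b ->
  (forall t, a <= t -> t <= b -> {for t, continuous f}) ->
  exists G : R -> R, forall t, a <= t -> t <= b -> forall e : R, 0 < e ->
    exists2 d : R, 0 < d & forall s, a <= s -> s <= b -> `|s - t| < d ->
     `|G s - G t - (s - t) * f t| <= e * `|s - t|.
Proof.
move=> ab fc; pose g t := f (Num.max a (Num.min b t)).
have gE t : a <= t -> t <= b -> g t = f t.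
  by move=> at_ tb; rewrite /g (min_idPr tb) (max_idPr at_).
have gc : continuous g.
  move=> t; apply: (@continuous_comp _ _ _ (fun t => Num.max a (Num.min b t)) f).
    apply: (@continuous_max R _ (fun=> a) (fun t => Num.min b t)).
      exact: cvg_cst.
    apply: (@continuous_min R _ (fun=> b) id); [exact: cvg_cst|exact: cvg_id].
  by apply: fc; rewrite ?le_max ?lexx// ge_max ab ge_min lexx.
exists (fun x => \int[lebesgue_measure]_(t in `[a - 1, x]) g t)%R.
move=> t at_ tb e e0; rewrite -gE//.
have [] := @continuous_FTC1_closed R g (a - 1) t (b + 1).
- lra.
- apply: continuous_compact_integrable; first exact: segment_compact.
  exact: continuous_subspaceT.
- lra.
- exact: gc.
move=> dG <-; have [d d0 dP] := derivable_eps dG e0.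
by exists d => // s _ _; exact: dP.
Qed.

Lemma exists_prim F a b : a <= b ->
  (forall t, a <= t -> t <= b -> pcont F t) -> exists Phi, prim Phi F a b.
Proof.
move=> ab Fc.
have [] := @exists_real_prim (fun t => complex.Re (F t)) a b ab.
  move=> t at_ tb; apply/cvgrPdist_lt => e /(Fc t at_ tb)[d d0 dP].
  apply/nbhs_ballP; exists d => // s; rewrite /ball /= distrC => /dP.
  apply: le_lt_trans; apply: le_trans (le_Re_modC _).
  by rewrite distrC; case: (F s) (F t) => [? ?] [? ?].
move=> G GP.
have [] := @exists_real_prim (fun t => complex.Im (F t)) a b ab.
  move=> t at_ tb; apply/cvgrPdist_lt => e /(Fc t at_ tb)[d d0 dP].
  apply/nbhs_ballP; exists d => // s; rewrite /ball /= distrC => /dP.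
  apply: le_lt_trans; apply: le_trans (le_Im_modC _).
  by rewrite distrC; case: (F s) (F t) => [? ?] [? ?].
move=> H HP; exists (fun t => G t +i* H t) => t at_ tb e e0.
have e2 : 0 < e / 2 by lra.
have [d d0 dP] := GP t at_ tb _ e2; have [d' d'0 dP'] := HP t at_ tb _ e2.
exists (Num.min d d'); first by rewrite lt_min d0.
move=> s as_ sb; rewrite lt_min => /andP[sd sd'].
have := dP s as_ sb sd; have := dP' s as_ sb sd'.
have := modC_le_ReIm (G s +i* H s - (G t +i* H t) - (s - t)%:C * F t).
have -> : complex.Re (G s +i* H s - (G t +i* H t) - (s - t)%:C * F t) =
  G s - G t - (s - t) * complex.Re (F t).
  by case: (F t) => x y /=; ring.
have -> : complex.Im (G s +i* H s - (G t +i* H t) - (s - t)%:C * F t) =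
  H s - H t - (s - t) * complex.Im (F t).
  by case: (F t) => x y /=; ring.
by lra.
Qed.

End primitive.

(** * Integrals along rectangles *)

Section contour.
Variable R : realType.
Implicit Types (f g : R[i] -> R[i]) (a b t x y : R).

(** The integral is the increment of a primitive: additivity, linearity and
    invariance under translation are then evident on primitives, and integration
    theory is only behind the existence of one. *)
Definition cint (F : R -> R[i]) a b : R[i] :=
  let Phi := xget (fun=> 0) [set Phi | prim Phi F a b] in Phi b - Phi a.

Lemma cintE Phi F a b : a <= b -> prim Phi F a b -> cint F a b = Phi b - Phi a.
Proof.
move=> ab pF; rewrite /cint; apply: (prim_unique (F := F) ab); last exact: pF.
exact: (@xgetPex _ (fun=> 0) [set Phi | prim Phi F a b] (ex_intro _ Phi pF)).
Qed.

Lemma cint_prim F a b : a <= b -> (forall t, a <= t -> t <= b -> pcont F t) ->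
  exists2 Phi, prim Phi F a b & cint F a b = Phi b - Phi a.
Proof.
by move=> ab /(exists_prim ab)[Phi pF]; exists Phi => //; exact: cintE.
Qed.

Lemma eq_cint F G a b : a <= b -> (forall t, a <= t -> t <= b -> F t = G t) ->
  (forall t, a <= t -> t <= b -> pcont F t) -> cint F a b = cint G a b.
Proof.
move=> ab FG /(cint_prim ab)[Phi pF ->]; apply/esym/cintE => //.
exact: eq_prim pF.
Qed.

Lemma cintD F G a b : a <= b -> (forall t, a <= t -> t <= b -> pcont F t) ->
  (forall t, a <= t -> t <= b -> pcont G t) ->
  cint (fun t => F t + G t) a b = cint F a b + cint G a b.
Proof.
move=> ab /(cint_prim ab)[Phi pF ->] /(cint_prim ab)[Psi pG ->].
rewrite (cintE ab (primD pF pG)); ring.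
Qed.

Lemma cintZ c F a b : a <= b -> (forall t, a <= t -> t <= b -> pcont F t) ->
  cint (fun t => c * F t) a b = c * cint F a b.
Proof.
move=> ab /(cint_prim ab)[Phi pF ->]; rewrite (cintE ab (primZ c pF)); ring.
Qed.

Lemma cint_cat F a b c : a <= b -> b <= c ->
  (forall t, a <= t -> t <= c -> pcont F t) ->
  cint F a c = cint F a b + cint F b c.
Proof.
move=> ab bc /(cint_prim (le_trans ab bc))[Phi pF ->].
rewrite (cintE ab (prim_sub (lexx _) bc pF)) (cintE bc (prim_sub ab (lexx _) pF)).
by ring.
Qed.

Lemma cint_modC_le F a b M : a <= b -> (forall t, a <= t -> t <= b -> pcont F t) ->
  (forall t, a <= t -> t <= b -> modC (F t) <= M) ->
  modC (cint F a b) <= M * (b - a).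
Proof. by move=> ab /(cint_prim ab)[Phi pF ->]; exact: prim_modC_le. Qed.

Lemma cint_Re_le F a b c M : a <= b -> (forall t, a <= t -> t <= b -> pcont F t) ->
  (forall t, a <= t -> t <= b -> complex.Re (c * F t) <= M) ->
  complex.Re (c * cint F a b) <= M * (b - a).
Proof. by move=> ab /(cint_prim ab)[Phi pF ->]; exact: prim_Re_le. Qed.

Lemma cint_affine (c d : R[i]) a b : a <= b ->
  cint (fun t => c + d * t%:C) a b =
  (b - a)%:C * c + ((b ^+ 2 - a ^+ 2) / 2)%:C * d.
Proof.
move=> ab; rewrite (cintE ab (primD (@prim_cst R c a b) (primZ d (@prim_id R a b)))).
rewrite mulrBl !rmorphB; ring.
Qed.

Lemma cint_shift F r a b : a <= b ->
  (forall t, a + r <= t -> t <= b + r -> pcont F t) ->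
  cint (fun t => F (t + r)) a b = cint F (a + r) (b + r).
Proof.
move=> ab Fc; have ab' : a + r <= b + r by rewrite lerD2r.
have [Phi pF ->] := cint_prim ab' Fc.
apply: (cintE (Phi := fun t => Phi (t + r))) => // t at_ tb e e0.
have tr1 : a + r <= t + r by rewrite lerD2r.
have tr2 : t + r <= b + r by rewrite lerD2r.
have [d d0 dP] := pF _ tr1 tr2 e e0.
exists d => // s as_ sb sd.
have sr1 : a + r <= s + r by rewrite lerD2r.
have sr2 : s + r <= b + r by rewrite lerD2r.
have := dP (s + r) sr1 sr2; have -> : s + r - (t + r) = s - t by ring.
by apply.
Qed.

Lemma pairE x y : x +i* y = x%:C + 'i * y%:C :> R[i].
Proof. exact: (complexE (x +i* y)). Qed.

Definition hseg f y : R -> R[i] := fun t => f (t +i* y).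
Definition vseg f x : R -> R[i] := fun t => f (x +i* t).

Lemma pcont_hseg f y t : ccont f (t +i* y) -> pcont (hseg f y) t.
Proof.
move=> fc e /fc[d d0 dP]; exists d => // s sd; apply: dP.
have -> : (s +i* y) - (t +i* y) = (s - t)%:C.
  by apply/eqP; rewrite eq_complex /=; apply/andP; split; apply/eqP; ring.
by rewrite modC_real.
Qed.

Lemma pcont_vseg f x t : ccont f (x +i* t) -> pcont (vseg f x) t.
Proof.
move=> fc e /fc[d d0 dP]; exists d => // s sd; apply: dP.
have -> : (x +i* s) - (x +i* t) = 'i * (s - t)%:C.
  by apply/eqP; rewrite eq_complex /=; apply/andP; split; apply/eqP; ring.
by rewrite modCM modCi mul1r modC_real.
Qed.

Definition rect x1 x2 y1 y2 : set R[i] :=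
  [set z | [/\ x1 <= complex.Re z, complex.Re z <= x2,
               y1 <= complex.Im z & complex.Im z <= y2]].

Definition frame x1 x2 y1 y2 : set R[i] :=
  [set z | rect x1 x2 y1 y2 z /\
    [\/ complex.Re z = x1, complex.Re z = x2, complex.Im z = y1 |
        complex.Im z = y2]].

(** The sides are traversed counterclockwise. *)
Definition bint f x1 x2 y1 y2 : R[i] :=
  cint (hseg f y1) x1 x2 - cint (hseg f y2) x1 x2
  + 'i * (cint (vseg f x2) y1 y2 - cint (vseg f x1) y1 y2).

Section fixed_rect.
Variables x1 x2 y1 y2 : R.
Hypotheses (x12 : x1 <= x2) (y12 : y1 <= y2).

Definition bcont f := forall z, frame x1 x2 y1 y2 z -> ccont f z.

Lemma frame_h t y : x1 <= t -> t <= x2 -> y = y1 \/ y = y2 ->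
  frame x1 x2 y1 y2 (t +i* y).
Proof.
move=> ? ? [] ->; split; try by split => //=.
  by apply: Or43.
by apply: Or44.
Qed.

Lemma frame_v t x : y1 <= t -> t <= y2 -> x = x1 \/ x = x2 ->
  frame x1 x2 y1 y2 (x +i* t).
Proof.
move=> ? ? [] ->; split; try by split => //=.
  by apply: Or41.
by apply: Or42.
Qed.

Lemma bcont_h f y : bcont f -> y = y1 \/ y = y2 ->
  forall t, x1 <= t -> t <= x2 -> pcont (hseg f y) t.
Proof. by move=> fc yE t t1 t2; apply/pcont_hseg/fc/frame_h. Qed.

Lemma bcont_v f x : bcont f -> x = x1 \/ x = x2 ->
  forall t, y1 <= t -> t <= y2 -> pcont (vseg f x) t.
Proof. by move=> fc yE t t1 t2; apply/pcont_vseg/fc/frame_v. Qed.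

Lemma bintD f g : bcont f -> bcont g ->
  bint (fun z => f z + g z) x1 x2 y1 y2 = bint f x1 x2 y1 y2 + bint g x1 x2 y1 y2.
Proof.
move=> fc gc; rewrite /bint.
rewrite !(@cintD (hseg f _) (hseg g _))//; do ?[by apply: bcont_h => //; auto].
rewrite !(@cintD (vseg f _) (vseg g _))//; do ?[by apply: bcont_v => //; auto].
by ring.
Qed.

Lemma bintZ c f : bcont f ->
  bint (fun z => c * f z) x1 x2 y1 y2 = c * bint f x1 x2 y1 y2.
Proof.
move=> fc; rewrite /bint.
rewrite !(@cintZ c (hseg f _))//; do ?[by apply: bcont_h => //; auto].
rewrite !(@cintZ c (vseg f _))//; do ?[by apply: bcont_v => //; auto].
by ring.
Qed.

Lemma eq_bint f g : bcont f -> (forall z, frame x1 x2 y1 y2 z -> f z = g z) ->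
  bint f x1 x2 y1 y2 = bint g x1 x2 y1 y2.
Proof.
move=> fc fg; rewrite /bint.
congr (_ - _ + _ * (_ - _)); apply: eq_cint => //.
all: do ?[by apply: bcont_h => //; auto]; do ?[by apply: bcont_v => //; auto].
all: move=> t t1 t2; apply: fg; do ?[by apply: frame_h => //; auto];
  by apply: frame_v => //; auto.
Qed.

Lemma bint_modC_le f M : bcont f ->
  (forall z, frame x1 x2 y1 y2 z -> modC (f z) <= M) ->
  modC (bint f x1 x2 y1 y2) <= M * (2 * (x2 - x1 + (y2 - y1))).
Proof.
move=> fc fM; rewrite /bint.
have h y : y = y1 \/ y = y2 -> modC (cint (hseg f y) x1 x2) <= M * (x2 - x1).
  move=> yE; apply: cint_modC_le => //; first exact: bcont_h.
  by move=> t t1 t2; apply/fM/frame_h.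
have v x : x = x1 \/ x = x2 -> modC (cint (vseg f x) y1 y2) <= M * (y2 - y1).
  move=> xE; apply: cint_modC_le => //; first exact: bcont_v.
  by move=> t t1 t2; apply/fM/frame_v.
have := h y1 (or_introl erefl); have := h y2 (or_intror erefl).
have := v x1 (or_introl erefl); have := v x2 (or_intror erefl).
set A := cint _ _ _; set B := cint _ _ _; set C := cint _ _ _; set D := cint _ _ _.
have := modCD (D - C) ('i * (A - B)); have := modCD D (- C).
by rewrite modCM modCi mul1r modCN; have := modCD A (- B); rewrite modCN; lra.
Qed.

Lemma bint_affine c d : bint (fun z => c + d * z) x1 x2 y1 y2 = 0.
Proof.
have hE y : cint (hseg (fun z => c + d * z) y) x1 x2 =
    (x2 - x1)%:C * (c + d * 'i * y%:C) + ((x2 ^+ 2 - x1 ^+ 2) / 2)%:C * d.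
  rewrite -cint_affine//; congr cint; apply: funext => t; rewrite /hseg.
  by rewrite pairE; ring.
have vE x : cint (vseg (fun z => c + d * z) x) y1 y2 =
    (y2 - y1)%:C * (c + d * x%:C) + ((y2 ^+ 2 - y1 ^+ 2) / 2)%:C * (d * 'i).
  rewrite -cint_affine//; congr cint; apply: funext => t; rewrite /vseg.
  by rewrite pairE; ring.
by rewrite /bint !hE !vE !rmorphB /=; ring.
Qed.

End fixed_rect.

Lemma bint_vcut f x1 x x2 y1 y2 : x1 <= x -> x <= x2 ->
  (forall t y, x1 <= t -> t <= x2 -> y = y1 \/ y = y2 -> ccont f (t +i* y)) ->
  bint f x1 x2 y1 y2 = bint f x1 x y1 y2 + bint f x x2 y1 y2.
Proof.
move=> x1x xx2 fc; rewrite /bint.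
rewrite (cint_cat (F := hseg f y1) x1x xx2); last first.
  by move=> t ? ?; apply/pcont_hseg/fc => //; left.
rewrite (cint_cat (F := hseg f y2) x1x xx2); last first.
  by move=> t ? ?; apply/pcont_hseg/fc => //; right.
by ring.
Qed.

Lemma bint_hcut f x1 x2 y1 y y2 : y1 <= y -> y <= y2 ->
  (forall t x, y1 <= t -> t <= y2 -> x = x1 \/ x = x2 -> ccont f (x +i* t)) ->
  bint f x1 x2 y1 y2 = bint f x1 x2 y1 y + bint f x1 x2 y y2.
Proof.
move=> y1y yy2 fc; rewrite /bint.
rewrite (cint_cat (F := vseg f x1) y1y yy2); last first.
  by move=> t ? ?; apply/pcont_vseg/fc => //; left.
rewrite (cint_cat (F := vseg f x2) y1y yy2); last first.
  by move=> t ? ?; apply/pcont_vseg/fc => //; right.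
by ring.
Qed.

End contour.

(** * Goursat's theorem *)

Section goursat.
Variable R : realType.
Implicit Types (f g : R[i] -> R[i]) (t x y : R).

Lemma rectW x1 x2 y1 y2 a1 a2 b1 b2 : x1 <= a1 -> a2 <= x2 -> y1 <= b1 ->
  b2 <= y2 -> rect a1 a2 b1 b2 `<=` rect x1 x2 y1 y2.
Proof.
move=> ? ? ? ? z [za1 za2 zb1 zb2].
by split; [apply: le_trans za1|apply: le_trans za2 _|apply: le_trans zb1|
  apply: le_trans zb2 _].
Qed.

Lemma bint_quarter f x1 x x2 y1 y y2 : x1 <= x -> x <= x2 -> y1 <= y -> y <= y2 ->
  (forall z, rect x1 x2 y1 y2 z -> ccont f z) ->
  bint f x1 x2 y1 y2 = bint f x1 x y1 y + bint f x x2 y1 y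
    + bint f x1 x y y2 + bint f x x2 y y2.
Proof.
move=> c1 c2 d1 d2 fc.
have x12 := le_trans c1 c2; have y12 := le_trans d1 d2.
rewrite (bint_vcut c1 c2); last first.
  by move=> t u t1 t2 [] ->; apply: fc; split.
rewrite (@bint_hcut R f _ _ _ _ _ d1 d2); last first.
  by move=> t u t1 t2 [] ->; apply: fc; split.
rewrite (@bint_hcut R f x _ _ _ _ d1 d2); last first.
  by move=> t u t1 t2 [] ->; apply: fc; split.
by ring.
Qed.

(** Near a point [f] is affine up to an error that is small compared with the
    distance. The integral of an affine function vanishes, and the integral of
    the error over a small rectangle is small compared with its area; bisection
    then bounds the integral over the whole rectangle by an arbitrarily small
    multiple of its area. *)
Lemma goursat f x1 x2 y1 y2 : x1 <= x2 -> y1 <= y2 ->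
  (forall z, rect x1 x2 y1 y2 z -> exists a, cdiff f z a) ->
  bint f x1 x2 y1 y2 = 0.
Proof.
move=> x12 y12 fd; set W := x2 - x1; set H := y2 - y1.
have W0 : 0 <= W by rewrite subr_ge0.
have H0 : 0 <= H by rewrite subr_ge0.
have fc z : rect x1 x2 y1 y2 z -> ccont f z by move=> /fd[a /cdiff_cont].
apply/eqP; rewrite -modC_eq0 eq_le modC_ge0 andbT.
apply/ler_addgt0Pr => e e0; rewrite add0r.
(* the bisection takes place in the unit square, mapped onto the rectangle *)
pose X u := x1 + u * W; pose Y u := y1 + u * H.
have X01 u : 0 <= u -> u <= 1 -> x1 <= X u /\ X u <= x2.
  move=> u0 u1; have h1 : 0 <= u * W by rewrite mulr_ge0.
  have h2 : u * W <= W by rewrite ler_piMl.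
  by rewrite /X; move: h2; rewrite {2}/W; split; lra.
have Y01 u : 0 <= u -> u <= 1 -> y1 <= Y u /\ Y u <= y2.
  move=> u0 u1; have h1 : 0 <= u * H by rewrite mulr_ge0.
  have h2 : u * H <= H by rewrite ler_piMl.
  by rewrite /Y; move: h2; rewrite {2}/H; split; lra.
have Xle u v : u <= v -> X u <= X v by move=> uv; rewrite lerD2l ler_wpM2r.
have Yle u v : u <= v -> Y u <= Y v by move=> uv; rewrite lerD2l ler_wpM2r.
pose P u v s := 0 <= u -> u + s <= 1 -> 0 <= v -> v + s <= 1 ->
  modC (bint f (X u) (X (u + s)) (Y v) (Y (v + s))) <= e * s ^+ 2.
suff : P 0 0 1.
  rewrite /P add0r expr1n mulr1 /X /Y !mul0r !mul1r !addr0 /W /H !subrKC.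
  by apply.
apply: cousin_square => //.
  move=> u v s s0 p1 p2 p3 p4 u0 us v0 vs.
  have hs : s / 2 + s / 2 = s by rewrite -splitr.
  have h0 : 0 < s / 2 by lra.
  have E u' : u' + s / 2 + s / 2 = u' + s by rewrite -addrA hs.
  move: p1 p2 p3 p4; rewrite /P !E => p1 p2 p3 p4.
  have us2 : u + s / 2 <= 1 by apply: le_trans us; rewrite lerD2l; lra.
  have vs2 : v + s / 2 <= 1 by apply: le_trans vs; rewrite lerD2l; lra.
  have us3 : 0 <= u + s / 2 by rewrite addr_ge0// ltW.
  have vs3 : 0 <= v + s / 2 by rewrite addr_ge0// ltW.
  have {}p1 := p1 u0 us2 v0 vs2; have {}p2 := p2 us3 us v0 vs2.
  have {}p3 := p3 u0 us2 vs3 vs; have {}p4 := p4 us3 us vs3 vs.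
  have [us0 vs0] : u <= 1 /\ v <= 1.
    by split; [apply: le_trans us2|apply: le_trans vs2]; rewrite lerDl ltW.
  have [us1 vs1] : 0 <= u + s /\ 0 <= v + s by split; rewrite addr_ge0// ltW.
  have [a1 a2] := X01 u u0 us0; have [b1 b2] := Y01 v v0 vs0.
  have [a3 a4] := X01 (u + s) us1 us; have [b3 b4] := Y01 (v + s) vs1 vs.
  have c1 : X u <= X (u + s / 2) by apply: Xle; rewrite lerDl ltW.
  have c2 : X (u + s / 2) <= X (u + s) by apply: Xle; rewrite lerD2l; lra.
  have d1 : Y v <= Y (v + s / 2) by apply: Yle; rewrite lerDl ltW.
  have d2 : Y (v + s / 2) <= Y (v + s) by apply: Yle; rewrite lerD2l; lra.
  rewrite (bint_quarter c1 c2 d1 d2); last by move=> z /(rectW a1 a4 b1 b4)/fc.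
  move: p1 p2 p3 p4; set A := bint f _ _ _ _; set B := bint f _ _ _ _.
  set C := bint f _ _ _ _; set D := bint f _ _ _ _ => p1 p2 p3 p4.
  have -> : e * s ^+ 2 = e * (s / 2) ^+ 2 + e * (s / 2) ^+ 2
    + e * (s / 2) ^+ 2 + e * (s / 2) ^+ 2 by field.
  apply: le_trans (modCD _ _) _; apply: lerD p4.
  apply: le_trans (modCD _ _) _; apply: lerD p3.
  by apply: le_trans (modCD _ _) _; apply: lerD.
move=> a b; rewrite add0r => /andP[a0 a1] /andP[b0 b1].
have [Xa1 Xa2] := X01 a a0 a1; have [Yb1 Yb2] := Y01 b b0 b1.
have z0R : rect x1 x2 y1 y2 (X a +i* Y b) by split.
set z0 := X a +i* Y b in z0R.
have [l fl] := fd z0 z0R; set K := 2 * (W + H) ^+ 2 + 1.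
have K0 : 0 < K by have := sqr_ge0 (W + H); rewrite /K; lra.
have [d d0 dP] := cdiff_eps fl (divr_gt0 e0 K0).
have WH1 : 0 < W + H + 1 by lra.
exists (d / (W + H + 1)); first exact: divr_gt0.
move=> u v s s0 sd _ _ _ _ /andP[ua au] /andP[vb bv] u0 us v0 vs.
have [us0 vs0] : u <= 1 /\ v <= 1.
  by split; [apply: le_trans us|apply: le_trans vs]; rewrite lerDl ltW.
have [us1 vs1] : 0 <= u + s /\ 0 <= v + s by split; rewrite addr_ge0// ltW.
have [p1 _] := X01 u u0 us0; have [q1 _] := Y01 v v0 vs0.
have [_ p4] := X01 (u + s) us1 us; have [_ q4] := Y01 (v + s) vs1 vs.
have XX : X u <= X (u + s) by apply: Xle; rewrite lerDl ltW.
have YY : Y v <= Y (v + s) by apply: Yle; rewrite lerDl ltW.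
have subR := rectW p1 p4 q1 q4.
pose r z := f z - f z0 - l * (z - z0).
have rc z : rect x1 x2 y1 y2 z -> ccont r z.
  move=> /fc fz; apply: ccontB; first by apply: ccontB => //; exact: ccont_cst.
  apply: ccontM; first exact: ccont_cst.
  by apply: ccontB; [exact: ccont_id|exact: ccont_cst].
pose A z := (f z0 - l * z0) + l * z.
have Ac z : ccont A z.
  apply: ccontD; first exact: ccont_cst.
  by apply: ccontM; [exact: ccont_cst|exact: ccont_id].
have -> : f = fun z => A z + r z by apply: funext => z; rewrite /A /r; ring.
have bA : bcont (X u) (X (u + s)) (Y v) (Y (v + s)) A by move=> z _; exact: Ac.
have br : bcont (X u) (X (u + s)) (Y v) (Y (v + s)) r by move=> z [/subR/rc].
rewrite (bintD XX YY bA br) bint_affine// add0r.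
have zd z : rect (X u) (X (u + s)) (Y v) (Y (v + s)) z ->
    modC (z - z0) <= s * (W + H).
  case=> h1 h2 h3 h4; apply: le_trans (modC_le_ReIm _) _.
  have -> : complex.Re (z - z0) = complex.Re z - X a by case: (z).
  have -> : complex.Im (z - z0) = complex.Im z - Y b by case: (z).
  have k1 : X (u + s) = X u + s * W by rewrite /X; ring.
  have k2 : Y (v + s) = Y v + s * H by rewrite /Y; ring.
  have k3 := Xle _ _ ua; have k4 := Xle _ _ au.
  have k5 := Yle _ _ vb; have k6 := Yle _ _ bv.
  clear - h1 h2 h3 h4 k1 k2 k3 k4 k5 k6.
  by rewrite mulrDr lerD// ler_norml; apply/andP; split; lra.
have WHd : s * (W + H) < d.
  have h : s * (W + H + 1) < d by rewrite -ltr_pdivlMr.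
  by lra.
apply: le_trans (bint_modC_le (M := e / K * (s * (W + H))) XX YY br _) _.
- move=> z [zR _]; have zz := zd z zR.
  apply: le_trans (dP z (le_lt_trans zz WHd)) _.
  by rewrite ler_wpM2l// ltW// divr_gt0.
have -> : X (u + s) - X u + (Y (v + s) - Y v) = s * (W + H) by rewrite /X /Y; ring.
have -> : e / K * (s * (W + H)) * (2 * (s * (W + H))) =
   e * s ^+ 2 * (2 * (W + H) ^+ 2 / K) by field; rewrite gt_eqF.
rewrite ler_piMr//; first by rewrite mulr_ge0 ?sqr_ge0// ltW.
by rewrite ler_pdivrMr// mul1r /K; lra.
Qed.

(** Four cuts reduce the boundary integral over a large rectangle to the one
    over a small rectangle inside it: the four pieces that are cut off avoid
    the inside of the small one. *)
Lemma bint_deform f x1 x2 y1 y2 a1 a2 b1 b2 :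
  x1 <= a1 -> a1 <= a2 -> a2 <= x2 -> y1 <= b1 -> b1 <= b2 -> b2 <= y2 ->
  (forall z, rect x1 x2 y1 y2 z ->
    ~ [/\ a1 < complex.Re z, complex.Re z < a2, b1 < complex.Im z &
          complex.Im z < b2] -> exists l, cdiff f z l) ->
  bint f x1 x2 y1 y2 = bint f a1 a2 b1 b2.
Proof.
move=> h1 h2 h3 k1 k2 k3 fd.
have fL z : rect x1 x2 y1 y2 z -> complex.Re z <= a1 -> exists l, cdiff f z l.
  by move=> zR h; apply: fd => // -[]; rewrite ltNge h.
have fR z : rect x1 x2 y1 y2 z -> a2 <= complex.Re z -> exists l, cdiff f z l.
  by move=> zR h; apply: fd => // -[_]; rewrite ltNge h.
have fB z : rect x1 x2 y1 y2 z -> complex.Im z <= b1 -> exists l, cdiff f z l.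
  by move=> zR h; apply: fd => // -[_ _]; rewrite ltNge h.
have fT z : rect x1 x2 y1 y2 z -> b2 <= complex.Im z -> exists l, cdiff f z l.
  by move=> zR h; apply: fd => // -[_ _ _]; rewrite ltNge h.
have cD z : (exists l, cdiff f z l) -> ccont f z by case=> l /cdiff_cont.
have y12 : y1 <= y2 by apply: le_trans k1 (le_trans k2 k3).
have b1y : b1 <= y2 by apply: le_trans k2 k3.
have a1x : a1 <= x2 by apply: le_trans h2 h3.
have x1a : x1 <= a2 by apply: le_trans h1 h2.
have yb2 : y1 <= b2 by apply: le_trans k1 k2.
rewrite (@bint_vcut _ f x1 a1)//; last first.
  move=> t y t1 t2 [] ->; apply: cD; [apply: fB|apply: fT] => //.
rewrite (@goursat f x1 a1)//; last first.
  by move=> z zR; apply: fL; [apply: rectW zR|case: zR].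
rewrite (@bint_vcut _ f a1 a2)//; last first.
  move=> t y t1 t2 [] ->; apply: cD; [apply: fB|apply: fT] => //;
  by split => //=; apply: le_trans t1.
rewrite (@goursat f a2 x2)//; last first.
  by move=> z zR; apply: fR; [apply: rectW zR|case: zR].
rewrite (@bint_hcut _ f a1 a2 y1 b1)//; last first.
  by move=> t y t1 t2 [] ->; apply: cD; [apply: fL|apply: fR].
rewrite (@goursat f a1 a2 y1)//; last first.
  by move=> z zR; apply: fB; [apply: rectW zR|case: zR].
rewrite (@bint_hcut _ f a1 a2 b1 b2)//; last first.
  move=> t y t1 t2 [] ->; apply: cD; [apply: fL|apply: fR] => //;
  by split => //=; apply: le_trans t1.
rewrite (@goursat f a1 a2 b2)//; last first.
  by move=> z zR; apply: fT; [apply: rectW zR|case: zR].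
by ring.
Qed.

End goursat.

(** * Cauchy's integral formula *)

Section cauchy.
Variable R : realType.
Implicit Types (f g : R[i] -> R[i]) (t x y : R) (w z : R[i]).

Lemma cdiff_inv z : z != 0 -> cdiff (fun u : R[i] => u^-1) z (- z^-2).
Proof.
move=> z0; have := @cdiffVB R z 0 z0; rewrite subr0.
by congr cdiff; apply: funext => u; rewrite subr0.
Qed.

(** For [t > 0] this is [2 * pi * 'i], the constant of Cauchy's formula. *)
Definition winding t : R[i] := bint (fun z => z^-1) (- t) t (- t) t.

Lemma winding_const s t : 0 < s -> 0 < t -> winding s = winding t.
Proof.
wlog st : s t / s <= t.
  move=> H s0 t0; have [st|/ltW ts] := leP s t; first exact: H.
  by apply/esym; exact: H.
move=> s0 t0; apply/esym; rewrite /winding; apply: bint_deform; rewrite ?lerN2//.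
1,2: by rewrite ge0_cp// ltW.
move=> z _ zi; exists (- z^-2); apply: cdiff_inv; apply/eqP => z0.
by apply: zi; rewrite z0 /= oppr_lt0.
Qed.

Lemma winding_shift w t : 0 < t ->
  bint (fun z => (z - w)^-1) (complex.Re w - t) (complex.Re w + t)
    (complex.Im w - t) (complex.Im w + t) = winding t.
Proof.
move=> t0; have tt : - t <= t by rewrite ge0_cp// ltW.
pose a := complex.Re w; pose b := complex.Im w; have wE : w = a +i* b by rewrite /a /b; case: (w).
rewrite -/a -/b.
have hE y : y = - t \/ y = t -> cint (hseg (fun z => (z - w)^-1) (b + y)) (a - t) (a + t) =
    cint (hseg (fun z => z^-1) y) (- t) t.
  move=> yE; rewrite ![a + _]addrC -cint_shift//; last first.
    move=> u _ _; apply/pcont_hseg/ccontV; rewrite wE eq_complex /= negb_and.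
    apply/orP; right; rewrite -subr_eq0 addrAC subrr add0r.
    by case: yE => ->; rewrite ?oppr_eq0 gt_eqF.
  congr cint; apply: funext => u; rewrite /hseg wE; congr (_^-1).
  by apply/eqP; rewrite eq_complex /=; apply/andP; split; apply/eqP; ring.
have vE x : x = - t \/ x = t -> cint (vseg (fun z => (z - w)^-1) (a + x)) (b - t) (b + t) =
    cint (vseg (fun z => z^-1) x) (- t) t.
  move=> xE; rewrite ![b + _]addrC -cint_shift//; last first.
    move=> u _ _; apply/pcont_vseg/ccontV; rewrite wE eq_complex /= negb_and.
    apply/orP; left; rewrite -subr_eq0 addrAC subrr add0r.
    by case: xE => ->; rewrite ?oppr_eq0 gt_eqF.
  congr cint; apply: funext => u; rewrite /vseg wE; congr (_^-1).
  by apply/eqP; rewrite eq_complex /=; apply/andP; split; apply/eqP; ring.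
by rewrite /winding /bint !hE ?vE; auto.
Qed.

(** For [t = 1], along each side of the square the integrand has imaginary part at least
    [1 / 2], and each side has length [2]. The value is the same for every [t]. *)
Lemma winding_neq0 t : 0 < t -> winding t != 0.
Proof.
move=> t0; rewrite (winding_const t0 ltr01).
have n1 : (-1 : R) <= 1 by lra.
have sq1 (s : R) : -1 <= s -> s <= 1 -> - (s ^+ 2 + 1)^-1 <= - (1 / 2) :> R.
  move=> s1 s2; have : (1 - s) * (1 + s) >= 0 by rewrite mulr_ge0//; lra.
  have -> : (1 - s) * (1 + s) = 1 - s ^+ 2 by ring.
  by move=> ?; rewrite lerN2 div1r lef_pV2 ?posrE; have := sqr_ge0 s; lra.
have n0 s : s ^+ 2 + 1 != 0 :> R by rewrite gt_eqF// ltr_wpDl ?sqr_ge0.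
have side (F : R -> R[i]) (c : R[i]) : (forall s, pcont F s) ->
    (forall s, complex.Re (c * F s) = - (s ^+ 2 + 1)^-1) ->
    complex.Re (c * cint F (-1) 1) <= -1.
  move=> Fc FE.
  apply: (le_trans (y := - (1 / 2) * (1 - -1))); last by lra.
  apply: cint_Re_le => // s s1 s2; rewrite FE; exact: sq1.
have ci z : z != 0 -> ccont (fun u : R[i] => u^-1) z by move=> /cdiff_inv/cdiff_cont.
have hB : complex.Re ('i * cint (hseg (fun z => z^-1) (-1)) (-1) 1) <= -1.
  apply: side => s.
    apply/pcont_hseg/ci; rewrite eq_complex /= negb_and oppr_eq0 oner_eq0 orbT //.
  by rewrite /hseg /= sqrrN expr1n; field.
have hT : complex.Re (- 'i * cint (hseg (fun z => z^-1) 1) (-1) 1) <= -1.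
  apply: side => s.
    apply/pcont_hseg/ci; rewrite eq_complex /= negb_and oner_eq0 orbT //.
  by rewrite /hseg /= expr1n; field.
have vR : complex.Re (-1 * cint (vseg (fun z => z^-1) 1) (-1) 1) <= -1.
  apply: side => s.
    apply/pcont_vseg/ci; rewrite eq_complex /= negb_and oner_eq0 //.
  by rewrite /vseg /= expr1n addrC; field.
have vL : complex.Re (1 * cint (vseg (fun z => z^-1) (-1)) (-1) 1) <= -1.
  apply: side => s.
    apply/pcont_vseg/ci; rewrite eq_complex /= negb_and oppr_eq0 oner_eq0 //.
  by rewrite /vseg /= sqrrN expr1n addrC; field.
apply/eqP => J0.
have : complex.Re ('i * winding 1) = 0 by rewrite J0 mulr0.
have i2 : 'i * 'i = -1 :> R[i] by rewrite -expr2 sqr_i.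
rewrite /winding /bint.
move: hB hT vR vL; set A := cint _ _ _; set B := cint _ _ _.
set C := cint _ _ _; set D := cint _ _ _ => hB hT vR vL.
have -> : 'i * (A - B + 'i * (C - D)) = 'i * A + - 'i * B + -1 * C + 1 * D.
  have -> : 'i * (A - B + 'i * (C - D)) = 'i * (A - B) + ('i * 'i) * (C - D) by ring.
  by rewrite i2; ring.
by rewrite !ReD; lra.
Qed.

(** Cauchy's integral formula. The contour can be deformed to a square of side
    [2 * t] around [w]. There [f] differs from [f w] by [O(t)], while the kernel
    is [O(1 / t)] and the length of the contour is [O(t)]: replacing [f] by [f w]
    costs [O(t)], for every small [t]. *)
Lemma cauchy_formula f x1 x2 y1 y2 w :
  x1 < complex.Re w -> complex.Re w < x2 -> y1 < complex.Im w -> complex.Im w < y2 ->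
  (forall z, rect x1 x2 y1 y2 z -> exists a, cdiff f z a) ->
  bint (fun z => f z * (z - w)^-1) x1 x2 y1 y2 = winding 1 * f w.
Proof.
move=> w1 w2 w3 w4 fd.
have wR : rect x1 x2 y1 y2 w by split; exact: ltW.
have [l fl] := fd w wR; set K := modC l + 1.
have K1 : 1 <= K by rewrite lerDr modC_ge0.
have [d d0 dP] := cdiff_eps fl ltr01.
have dK z : modC (z - w) < d -> modC (f z - f w) <= K * modC (z - w).
  move=> /dP h; have -> : f z - f w = l * (z - w) + (f z - f w - l * (z - w)) by ring.
  by apply: le_trans (modCD _ _) _; rewrite modCM mulrDl lerD.
pose m := Num.min (Num.min (complex.Re w - x1) (x2 - complex.Re w))
  (Num.min (complex.Im w - y1) (y2 - complex.Im w)).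
have m0 : 0 < m by rewrite !lt_min !subr_gt0 w1 w2 w3 w4.
have kd z : z != w -> (exists a, cdiff f z a) ->
    exists a, cdiff (fun z => f z * (z - w)^-1) z a.
  by move=> zw [a fa]; exists (a * (z - w)^-1 + f z * - (z - w)^-2);
    apply: cdiffM => //; exact: cdiffVB.
apply/eqP; rewrite -subr_eq0 -modC_eq0 eq_le modC_ge0 andbT.
apply/ler_addgt0Pr => e e0; rewrite add0r.
pose t := Num.min m (Num.min (d / 3) (e / (16 * K))).
have K160 : 0 < 16 * K by rewrite mulr_gt0//; lra.
have t0 : 0 < t by rewrite lt_min m0 lt_min !divr_gt0.
have tm : t <= m by rewrite /t ge_min lexx.
have td : t <= d / 3 by rewrite /t ge_min [X in _ || X]ge_min lexx orbT.
have te : t <= e / (16 * K) by rewrite /t ge_min [X in _ || X]ge_min lexx !orbT.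
have [t1 t2 t3 t4] : [/\ t <= complex.Re w - x1, t <= x2 - complex.Re w,
    t <= complex.Im w - y1 & t <= y2 - complex.Im w].
  by move: tm; rewrite !le_min => /andP[/andP[-> ->] /andP[-> ->]].
clearbody t; clear tm.
pose a := complex.Re w; pose b := complex.Im w.
have at1 : x1 <= a - t by rewrite /a; lra.
have at2 : a + t <= x2 by rewrite /a; lra.
have bt1 : y1 <= b - t by rewrite /b; lra.
have bt2 : b + t <= y2 by rewrite /b; lra.
have aa : a - t <= a + t by lra.
have bb : b - t <= b + t by lra.
have neq z : frame (a - t) (a + t) (b - t) (b + t) z -> t <= modC (z - w).
  have Rz : complex.Re (z - w) = complex.Re z - a by rewrite ReB.
  have Iz : complex.Im (z - w) = complex.Im z - b by rewrite ImB.
  case=> _; case=> E.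
  - apply: le_trans (le_Re_modC _); rewrite Rz E addrAC subrr add0r normrN.
    exact: ler_norm.
  - apply: le_trans (le_Re_modC _); rewrite Rz E addrAC subrr add0r.
    exact: ler_norm.
  - apply: le_trans (le_Im_modC _); rewrite Iz E addrAC subrr add0r normrN.
    exact: ler_norm.
  - apply: le_trans (le_Im_modC _); rewrite Iz E addrAC subrr add0r.
    exact: ler_norm.
have zw z : frame (a - t) (a + t) (b - t) (b + t) z -> z != w.
  by move=> /neq h; rewrite -subr_eq0 -modC_gt0; apply: lt_le_trans h.
have near z : frame (a - t) (a + t) (b - t) (b + t) z -> modC (z - w) <= 2 * t.
  case=> -[h1 h2 h3 h4] _; apply: le_trans (modC_le_ReIm _) _.
  have -> : complex.Re (z - w) = complex.Re z - a by rewrite ReB.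
  have -> : complex.Im (z - w) = complex.Im z - b by rewrite ImB.
  clear - h1 h2 h3 h4.
  by rewrite mulr_natl mulr2n lerD// ler_norml; apply/andP; split; lra.
rewrite (@bint_deform R _ x1 x2 y1 y2 (a - t) (a + t) (b - t) (b + t))//; last first.
  move=> z zR zi; apply: kd; last exact: fd.
  apply/eqP => zE; apply: zi; rewrite zE -/a -/b.
  by clear - t0; split; lra.
have kc : bcont (a - t) (a + t) (b - t) (b + t) (fun z => (z - w)^-1).
  by move=> z /zw; exact: ccontV.
have fc : bcont (a - t) (a + t) (b - t) (b + t) f.
  by move=> z [/(rectW at1 at2 bt1 bt2)/fd[l' /cdiff_cont]].
pose g z := (f z - f w) * (z - w)^-1.
have gc : bcont (a - t) (a + t) (b - t) (b + t) g.
  move=> z zF; apply: ccontM; last exact: kc.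
  by apply: ccontB; [exact: fc|exact: ccont_cst].
have -> : (fun z => f z * (z - w)^-1) = fun z => f w * (z - w)^-1 + g z.
  by apply: funext => z; rewrite /g; ring.
rewrite (bintD aa bb _ gc); last first.
  by move=> z zF; apply: ccontM; [exact: ccont_cst|exact: kc].
rewrite (bintZ aa bb _ kc) winding_shift// (winding_const t0 ltr01).
rewrite addrAC mulrC subrr add0r.
apply: le_trans (bint_modC_le (M := K) aa bb gc _) _.
  move=> z zF; rewrite /g modCM modCV ler_pdivrMr; last first.
    by rewrite modC_gt0 subr_eq0 zw.
  by apply: dK; apply: le_lt_trans (near z zF) _; clear -td d0; lra.
have -> : K * (2 * (a + t - (a - t) + (b + t - (b - t)))) = t * (16 * K) / 2 by field.
have : t * (16 * K) <= e by rewrite -ler_pdivlMr.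
by clear -e0; lra.
Qed.

End cauchy.

(** * Regularity of holomorphic functions *)

Section taylor.
Variable R : realType.
Implicit Types (f g : R[i] -> R[i]) (t x y : R) (w z : R[i]).

Lemma cdiff_unique f z a b : cdiff f z a -> cdiff f z b -> a = b.
Proof.
move=> fa fb; apply/eqP; rewrite -subr_eq0 -modC_eq0 eq_le modC_ge0 andbT.
apply/ler_addgt0Pr => e e0; rewrite add0r; have e2 : 0 < e / 2 by lra.
have [d d0 dP] := cdiff_eps fa e2; have [d' d'0 dP'] := cdiff_eps fb e2.
pose h := (Num.min d d' / 2)%:C.
have mh : modC h = Num.min d d' / 2.
  by rewrite modC_real ger0_norm// divr_ge0// le_min !ltW.
have dd : 0 < Num.min d d' by rewrite lt_min d0.
have h0 : 0 < modC h by rewrite mh divr_gt0.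
have hd : modC (z + h - z) < d.
  by rewrite addrAC subrr add0r mh; have : Num.min d d' <= d by [rewrite ge_min lexx]; lra.
have hd' : modC (z + h - z) < d'.
  by rewrite addrAC subrr add0r mh; have : Num.min d d' <= d' by [rewrite ge_min lexx orbT]; lra.
have := dP _ hd; have := dP' _ hd'; rewrite (addrAC z) subrr add0r.
set p := f (z + h) - f z - b * h; set q := f (z + h) - f z - a * h => hp hq.
rewrite -(ler_pM2r h0) -modCM.
have -> : (a - b) * h = p - q by rewrite /p /q; ring.
by apply: le_trans (modCD _ _) _; rewrite modCN; lra.
Qed.

Lemma cdiff_of_quadratic f z a C d : 0 < d -> (forall h, modC h < d ->
  modC (f (z + h) - f z - a * h) <= C * modC h ^+ 2) -> cdiff f z a.
Proof.
move=> d0 H.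
exists (fun w => if w == z then a else (f w - f z) / (w - z)); split.
- move=> e e0; rewrite eqxx; pose D := `|C| + 1.
  have D0 : 0 < D by rewrite ltr_wpDl.
  exists (Num.min d (e / D)); first by rewrite lt_min d0 divr_gt0.
  move=> w; rewrite lt_min => /andP[wd we] /=.
  case: (eqVneq w z) => [_|wz]; first by rewrite subrr modC0.
  have wz0 : w - z != 0 by rewrite subr_eq0.
  have m0 : 0 < modC (w - z) by rewrite modC_gt0.
  have := H _ wd; rewrite subrKC => h.
  rewrite -(ltr_pM2r m0) -modCM mulrBl divfK//.
  apply: (le_lt_trans h); rewrite expr2 mulrA ltr_pM2r//.
  apply: (@le_lt_trans _ _ (D * modC (w - z))).
    by rewrite ler_wpM2r ?modC_ge0// /D; have := ler_norm C; lra.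
  by rewrite mulrC -ltr_pdivlMr.
- by rewrite eqxx.
- move=> w; case: (eqVneq w z) => [->|wz]; first by rewrite !subrr mulr0.
  by rewrite mulfVK // subr_eq0.
Qed.

(** By bisection, as continuous functions are locally bounded. *)
Lemma bounded_on_square f x y s : 0 < s ->
  (forall z, rect x (x + s) y (y + s) z -> ccont f z) ->
  exists M, forall z, rect x (x + s) y (y + s) z -> modC (f z) <= M.
Proof.
move=> s0 fc.
apply: (@cousin_square R (fun x y s => exists M, forall z,
  rect x (x + s) y (y + s) z -> modC (f z) <= M)) => //.
  move=> {s0 fc} {}x {}y {}s s0 [M1 H1] [M2 H2] [M3 H3] [M4 H4].
  exists (Num.max (Num.max M1 M2) (Num.max M3 M4)) => z [z1 z2 z3 z4].
  have E (u : R) : u + s / 2 + s / 2 = u + s by rewrite -addrA -splitr.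
  rewrite !E in H2 H3 H4 *; rewrite !le_max.
  have [h1|/ltW h1] := leP (complex.Re z) (x + s / 2);
    have [h2|/ltW h2] := leP (complex.Im z) (y + s / 2).
  - by rewrite H1.
  - by rewrite H3 ?orbT.
  - by rewrite H2 ?orbT.
  - by rewrite H4 ?orbT.
move=> a b /andP[a1 a2] /andP[b1 b2].
have [d d0 dP] := fc (a +i* b) (And4 a1 a2 b1 b2) 1 ltr01.
exists (d / 2); first by rewrite divr_gt0.
move=> x' y' s' s'0 s'd _ _ _ _ /andP[a3 a4] /andP[b3 b4].
exists (modC (f (a +i* b)) + 1) => z [z1 z2 z3 z4].
have zd : modC (z - (a +i* b)) < d.
  apply: le_lt_trans (modC_le_ReIm _) _; rewrite ReB ImB /=.
  have : `|complex.Re z - a| <= s'.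
    by clear - z1 z2 a3 a4; rewrite ler_norml; apply/andP; split; lra.
  have : `|complex.Im z - b| <= s'.
    by clear - z3 z4 b3 b4; rewrite ler_norml; apply/andP; split; lra.
  by clear - s'd; lra.
have := dP z zd; have := modCD (f z - f (a +i* b)) (f (a +i* b)).
by rewrite subrK; lra.
Qed.

Section fixed_square.
Variables (f : R[i] -> R[i]) (w0 : R[i]) (r : R).
Hypothesis r0 : 0 < r.
Hypothesis fd : forall z, modC (z - w0) <= 2 * r -> exists a, cdiff f z a.

Let a1 := complex.Re w0 - r.
Let a2 := complex.Re w0 + r.
Let b1 := complex.Im w0 - r.
Let b2 := complex.Im w0 + r.

Lemma square_disc z : rect a1 a2 b1 b2 z -> modC (z - w0) <= 2 * r.
Proof.
case=> h1 h2 h3 h4; apply: le_trans (modC_le_ReIm _) _; rewrite ReB ImB.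
by rewrite mulr_natl mulr2n lerD// ler_norml; apply/andP; split;
  move: h1 h2 h3 h4; rewrite /a1 /a2 /b1 /b2; lra.
Qed.

Lemma frame_disc z : frame a1 a2 b1 b2 z -> r <= modC (z - w0).
Proof.
case=> _; case=> E.
- apply: le_trans (le_Re_modC _); rewrite ReB E addrAC subrr add0r normrN; exact: ler_norm.
- apply: le_trans (le_Re_modC _); rewrite ReB E addrAC subrr add0r; exact: ler_norm.
- apply: le_trans (le_Im_modC _); rewrite ImB E addrAC subrr add0r normrN; exact: ler_norm.
- apply: le_trans (le_Im_modC _); rewrite ImB E addrAC subrr add0r; exact: ler_norm.
Qed.

Let a12 : a1 <= a2. Proof. by rewrite /a1 /a2; have := r0; lra. Qed.
Let b12 : b1 <= b2. Proof. by rewrite /b1 /b2; have := r0; lra. Qed.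

Let fc z : rect a1 a2 b1 b2 z -> ccont f z.
Proof. by move=> /square_disc/fd[a /cdiff_cont]. Qed.

Definition kcont (K : R[i] -> R[i]) := bcont a1 a2 b1 b2 K.

(** The integral of [f] against the kernel [K], normalized so that the kernel
    of Cauchy's formula reproduces [f]. *)
Definition ctrans (K : R[i] -> R[i]) : R[i] :=
  (winding 1)^-1 * bint (fun z => f z * K z) a1 a2 b1 b2.

Let kfc K : kcont K -> bcont a1 a2 b1 b2 (fun z => f z * K z).
Proof. by move=> kc z zF; apply: ccontM; [apply: fc; case: zF|exact: kc]. Qed.

Lemma ctransD K L : kcont K -> kcont L ->
  ctrans (fun z => K z + L z) = ctrans K + ctrans L.
Proof.
move=> kc lc; rewrite /ctrans.
have -> : (fun z => f z * (K z + L z)) = fun z => f z * K z + f z * L z.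
  by apply: funext => z; rewrite mulrDr.
by rewrite (bintD a12 b12 (kfc kc) (kfc lc)) mulrDr.
Qed.

Lemma ctransZ c K : kcont K -> ctrans (fun z => c * K z) = c * ctrans K.
Proof.
move=> kc; rewrite /ctrans.
have -> : (fun z => f z * (c * K z)) = fun z => c * (f z * K z).
  by apply: funext => z; rewrite mulrCA.
by rewrite (bintZ a12 b12 c (kfc kc)) mulrCA.
Qed.

Lemma eq_ctrans K L : kcont K -> (forall z, frame a1 a2 b1 b2 z -> K z = L z) ->
  ctrans K = ctrans L.
Proof.
move=> kc KL; rewrite /ctrans; congr (_ * _); apply: eq_bint => //.
- exact: kfc.
- by move=> z /KL ->.
Qed.

(** As the transform is bounded, expansions of the kernel become expansions of
    the transform. *)
Lemma ctrans_le : exists2 C, 0 <= C & forall K M, 0 <= M -> kcont K ->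
  (forall z, frame a1 a2 b1 b2 z -> modC (K z) <= M) -> modC (ctrans K) <= C * M.
Proof.
have E1 : a2 = a1 + 2 * r by rewrite /a1 /a2; ring.
have E2 : b2 = b1 + 2 * r by rewrite /b1 /b2; ring.
have r2 : 0 < 2 * r by rewrite mulr_gt0.
have [|Mf fM] := @bounded_on_square f a1 b1 (2 * r) r2.
  by rewrite -E1 -E2.
rewrite -E1 -E2 in fM.
have Mf0 : 0 <= Mf.
  apply: le_trans (modC_ge0 _) (fM (a1 +i* b1) _); by split.
pose p := 2 * (a2 - a1 + (b2 - b1)).
have p0 : 0 <= p by rewrite /p mulr_ge0// addr_ge0// subr_ge0.
exists (modC (winding 1)^-1 * (Mf * p)); first by rewrite mulr_ge0 ?modC_ge0// mulr_ge0.
move=> K M M0 kc KM; rewrite /ctrans modCM -mulrA ler_wpM2l ?modC_ge0//.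
rewrite mulrAC; apply: bint_modC_le => //; first exact: kfc.
by move=> z zF; rewrite modCM ler_pM ?modC_ge0//; [apply: fM; case: zF|exact: KM].
Qed.

Lemma kcontM K L : kcont K -> kcont L -> kcont (fun z => K z * L z).
Proof. by move=> kc lc z zF; apply: ccontM; [exact: kc|exact: lc]. Qed.

Lemma kcontZ c K : kcont K -> kcont (fun z => c * K z).
Proof. by move=> kc z zF; apply: ccontM; [exact: ccont_cst|exact: kc]. Qed.

Lemma kcontD K L : kcont K -> kcont L -> kcont (fun z => K z + L z).
Proof. by move=> kc lc z zF; apply: ccontD; [exact: kc|exact: lc]. Qed.

Lemma ctransDZ K c L : kcont K -> kcont L ->
  ctrans (fun z => K z + c * L z) = ctrans K + c * ctrans L.
Proof. by move=> kc lc; rewrite (ctransD kc (kcontZ c lc)) ctransZ. Qed.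

Definition kern w z : R[i] := (z - w)^-1.

Lemma frame_far w z : frame a1 a2 b1 b2 z -> r - modC (w - w0) <= modC (z - w).
Proof.
move=> /frame_disc h; have := modCD (z - w) (w - w0).
by rewrite addrA subrK; lra.
Qed.

Lemma kern_cont w : modC (w - w0) < r -> kcont (kern w).
Proof.
move=> wr z zF; apply: ccontV.
rewrite -subr_eq0 -modC_gt0; apply: lt_le_trans (@frame_far w z zF); lra.
Qed.

Lemma kern_le w m z : 0 < m -> m <= r - modC (w - w0) ->
  frame a1 a2 b1 b2 z -> modC (kern w z) <= m^-1.
Proof.
move=> m0 mr zF; have h := le_trans mr (@frame_far w z zF).
by rewrite /kern modCV lef_pV2 ?posrE// (lt_le_trans m0 h).
Qed.

Lemma ctrans_kern w : modC (w - w0) < r -> ctrans (kern w) = f w.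
Proof.
move=> wr; have := le_Re_modC (w - w0); have := le_Im_modC (w - w0).
rewrite ReB ImB !ler_norml => /andP[i1 i2] /andP[j1 j2].
rewrite /ctrans (cauchy_formula (w := w)) ?mulKf ?winding_neq0//;
  rewrite /a1 /a2 /b1 /b2; try lra.
by move=> z /square_disc/fd.
Qed.

Definition cauchy_deriv w := ctrans (fun z => kern w z ^+ 2).

Lemma kern2_cont w : modC (w - w0) < r -> kcont (fun z => kern w z ^+ 2).
Proof.
by move=> /kern_cont wr; under eq_fun do rewrite expr2; exact: kcontM.
Qed.

Lemma kern3_cont w : modC (w - w0) < r -> kcont (fun z => kern w z ^+ 3).
Proof.
move=> wr; under eq_fun do rewrite exprS; apply: kcontM.
  exact: kern_cont. exact: kern2_cont.
Qed.

Lemma kern_neq0 w z : modC (w - w0) < r -> frame a1 a2 b1 b2 z -> z - w != 0.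
Proof.
move=> wr zF; rewrite -modC_gt0; apply: lt_le_trans (@frame_far w z zF); lra.
Qed.

Lemma near_center w h : modC h < (r - modC (w - w0)) / 2 ->
  (r - modC (w - w0)) / 2 <= r - modC (w + h - w0).
Proof.
move=> hm; have := modCD (w - w0) h; have -> : w - w0 + h = w + h - w0 by ring.
by lra.
Qed.

(** The kernel at [w + h] is a geometric series in [h], here cut after the term
    of order two. *)
Lemma cauchy_taylor w : modC (w - w0) < r ->
  exists c C d, [/\ 0 < d, 0 <= C & forall h, modC h < d ->
    modC (f (w + h) - f w - cauchy_deriv w * h - c * h ^+ 2) <= C * modC h ^+ 3].
Proof.
move=> wr; set m := (r - modC (w - w0)) / 2.
have m0 : 0 < m by rewrite /m; lra.
have mw : m <= r - modC (w - w0) by rewrite /m; lra.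
have [C0 C00 CP] := ctrans_le.
exists (ctrans (fun z => kern w z ^+ 3)), (C0 * m ^- 4), m; split => //.
  by rewrite mulr_ge0// invr_ge0 exprn_ge0// ltW.
move=> h hm; have mwh := near_center hm; rewrite -/m in mwh.
have whr : modC (w + h - w0) < r by lra.
pose K z := kern w z ^+ 3 * kern (w + h) z.
have Kc : kcont K by apply: kcontM; [exact: kern3_cont|exact: kern_cont].
have k1 := kern_cont wr; have k2 := kern2_cont wr; have k3 := kern3_cont wr.
pose A1 z := kern w z + h * kern w z ^+ 2.
pose A2 z := A1 z + h ^+ 2 * kern w z ^+ 3.
have A1c : kcont A1 by apply: kcontD => //; exact: kcontZ.
have A2c : kcont A2 by apply: kcontD => //; exact: kcontZ.
have E : ctrans (kern (w + h)) = ctrans (kern w) + h * cauchy_deriv w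
    + h ^+ 2 * ctrans (fun z => kern w z ^+ 3) + h ^+ 3 * ctrans K.
  rewrite -(ctransDZ h k1 k2) -(ctransDZ (h ^+ 2) A1c k3) -(ctransDZ (h ^+ 3) A2c Kc).
  apply: eq_ctrans; first exact: kern_cont.
  move=> z zF; have z1 := kern_neq0 wr zF; have z2 := kern_neq0 whr zF.
  rewrite /A2 /A1 /K /kern; move: z2; have -> : z - (w + h) = z - w - h by ring.
  by move: z1; set b := z - w => z1 z2; field; rewrite z1 z2.
move: E; rewrite !ctrans_kern// => ->.
set A := ctrans K; set B := ctrans _; set D := cauchy_deriv w.
have -> : f w + h * D + h ^+ 2 * B + h ^+ 3 * A - f w - D * h - B * h ^+ 2 = h ^+ 3 * A by ring.
rewrite modCM modCX mulrC ler_wpM2r ?exprn_ge0 ?modC_ge0//.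
apply: CP => //; first by rewrite invr_ge0 exprn_ge0// ltW.
move=> z zF; rewrite /K modCM modCX -exprVn [leRHS]exprSr.
have kw : modC (kern w z) <= m^-1 by apply: kern_le.
have kwh : modC (kern (w + h) z) <= m^-1 by apply: kern_le.
apply: ler_pM => //; rewrite ?exprn_ge0 ?modC_ge0//.
by rewrite lerXn2r ?nnegrE ?modC_ge0 ?invr_ge0 ?(ltW m0).
Qed.

(** Same argument for the square of the kernel, cut after the term of order
    one. *)
Lemma cauchy_deriv_cdiff w : modC (w - w0) < r ->
  cdiff cauchy_deriv w (2 * ctrans (fun z => kern w z ^+ 3)).
Proof.
move=> wr; set m := (r - modC (w - w0)) / 2.
have m0 : 0 < m by rewrite /m; lra.
have mw : m <= r - modC (w - w0) by rewrite /m; lra.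
have [C0 C00 CP] := ctrans_le.
apply: (@cdiff_of_quadratic _ _ _ (C0 * (4 * m ^- 4)) m) => // h hm.
have mwh := near_center hm; rewrite -/m in mwh.
have whr : modC (w + h - w0) < r by lra.
have k2 := kern2_cont wr; have k3 := kern3_cont wr; have l1 := kern_cont whr.
have l2 := kern2_cont whr.
pose K z := 3 * (kern w z ^+ 3 * kern (w + h) z) + h * (kern w z ^+ 3 * kern (w + h) z ^+ 2).
have Kc : kcont K by apply: kcontD; apply: kcontZ; apply: kcontM.
pose A1 z := kern w z ^+ 2 + 2 * h * kern w z ^+ 3.
have A1c : kcont A1 by apply: kcontD => //; exact: kcontZ.
have E : cauchy_deriv (w + h) = cauchy_deriv w
    + (2 * h) * ctrans (fun z => kern w z ^+ 3) + h ^+ 2 * ctrans K.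
  rewrite /cauchy_deriv -(ctransDZ (2 * h) k2 k3) -(ctransDZ (h ^+ 2) A1c Kc).
  apply: eq_ctrans => //.
  move=> z zF; have z1 := kern_neq0 wr zF; have z2 := kern_neq0 whr zF.
  rewrite /A1 /K /kern; move: z2; have -> : z - (w + h) = z - w - h by ring.
  by move: z1; set b := z - w => z1 z2; field; rewrite z1 z2.
rewrite E; set A := ctrans K; set B := ctrans _; set D := cauchy_deriv w.
have -> : D + 2 * h * B + h ^+ 2 * A - D - 2 * B * h = h ^+ 2 * A by ring.
rewrite modCM modCX mulrC ler_wpM2r ?exprn_ge0 ?modC_ge0//.
have p0 : 0 <= m ^- 4 by rewrite invr_ge0 exprn_ge0// ltW.
apply: CP => //; first by rewrite mulr_ge0.
move=> z zF; have kw : modC (kern w z) <= m^-1 by apply: kern_le.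
have kwh : modC (kern (w + h) z) <= m^-1 by apply: kern_le.
have n3 : modC (3 : R[i]) = 3.
  by have := modC_real (3 : R); rewrite rmorph_nat ger0_norm.
have hm' : modC h * m^-1 <= 1 by rewrite ler_pdivrMr// mul1r ltW.
have k3m : modC (kern w z ^+ 3) <= m^-1 ^+ 3.
  by rewrite modCX lerXn2r ?nnegrE ?modC_ge0 ?invr_ge0 ?(ltW m0).
have i0 : 0 <= m^-1 by rewrite invr_ge0 ltW.
rewrite /K; move: k3m kwh; move: (kern w z ^+ 3) (kern (w + h) z) => p q pm qm.
apply: le_trans (modCD _ _) _; rewrite !modCM n3 -exprVn.
have -> : 4 * m^-1 ^+ 4 = 3 * (m^-1 ^+ 3 * m^-1) + 1 * (m^-1 ^+ 3 * m^-1) by ring.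
apply: lerD; first by rewrite ler_wpM2l// ler_pM ?modC_ge0.
have -> : modC h * (modC p * (modC q * modC q)) =
  (modC h * modC q) * (modC p * modC q) by ring.
apply: ler_pM; rewrite ?mulr_ge0 ?modC_ge0//; last by rewrite ler_pM ?modC_ge0.
by apply: le_trans hm'; rewrite ler_wpM2l ?modC_ge0.
Qed.

Lemma cauchy_deriv_derive w : modC (w - w0) < r -> cdiff f w (cauchy_deriv w).
Proof.
move=> /cauchy_taylor[c [C [d [d0 C0 H]]]].
apply: (@cdiff_of_quadratic _ _ _ (modC c + C) (Num.min 1 d)).
  by rewrite lt_min ltr01.
move=> h; rewrite lt_min => /andP[h1 hd]; have := H h hd.
set p := f (w + h) - f w - cauchy_deriv w * h => hp.
have -> : p = (p - c * h ^+ 2) + c * h ^+ 2 by rewrite subrK.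
apply: le_trans (modCD _ _) _; rewrite modCM modCX mulrDl addrC lerD2l.
apply: le_trans hp _; rewrite ler_wpM2l// exprS ler_piMl ?exprn_ge0 ?modC_ge0//.
exact: ltW.
Qed.

End fixed_square.

Definition holo (U : set R[i]) f := forall z, U z -> exists a, cdiff f z a.

Definition cderiv f z : R[i] := xget 0 [set a | cdiff f z a].

Lemma cderivE f z a : cdiff f z a -> cderiv f z = a.
Proof.
move=> fa; apply: (@cdiff_unique f z) => //.
exact: (@xgetPex _ 0 [set a | cdiff f z a] (ex_intro _ a fa)).
Qed.

Lemma holo_cderiv U f z : holo U f -> U z -> cdiff f z (cderiv f z).
Proof. by move=> /[apply] -[a fa]; rewrite (cderivE fa). Qed.

Lemma open_disc (U : set R[i]) z : open U -> U z ->
  exists2 r : R, 0 < r & forall w, modC (w - z) <= 2 * r -> U w.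
Proof.
move=> oU Uz; have /nbhsC[d d0 dU] : nbhs z U by exact: open_nbhs_nbhs.
by exists (d / 3); [lra|move=> w wz; apply: dU; lra].
Qed.

(** Around each point the derivative is the transform of the squared kernel,
    which depends differentiably on its parameter. *)
Lemma holo_holo_cderiv U f : open U -> holo U f -> holo U (cderiv f).
Proof.
move=> oU fU z Uz; have [r r0 rU] := open_disc oU Uz.
have fd w : modC (w - z) <= 2 * r -> exists a, cdiff f w a by move=> /rU/fU.
have zr : modC (z - z) < r by rewrite subrr modC0.
have [q [qc qz qE]] := cauchy_deriv_cdiff r0 fd zr.
exists (q z), (fun w => if modC (w - z) < r then q w else
   (cderiv f w - cderiv f z) / (w - z)); split.
- move=> e /qc[d d0 dP]; exists (Num.min d r); first by rewrite lt_min d0.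
  move=> w; rewrite lt_min => /andP[wd wr].
  by rewrite wr zr; exact: dP.
- by rewrite zr.
- move=> w; case: ifPn => [wr|wr].
    by rewrite -qE !(cderivE (cauchy_deriv_derive r0 fd _)).
  rewrite divfK// subr_eq0; apply/eqP => wz.
  by move: wr; rewrite wz zr.
Qed.

Lemma holo_taylor U f z : open U -> holo U f -> U z ->
  exists c C d, [/\ 0 < d, 0 <= C & forall h, modC h < d ->
    modC (f (z + h) - f z - cderiv f z * h - c * h ^+ 2) <= C * modC h ^+ 3].
Proof.
move=> oU fU Uz; have [r r0 rU] := open_disc oU Uz.
have fd w : modC (w - z) <= 2 * r -> exists a, cdiff f w a by move=> /rU/fU.
have zr : modC (z - z) < r by rewrite subrr modC0.
by have := cauchy_taylor r0 fd zr; rewrite -(cderivE (cauchy_deriv_derive r0 fd zr)).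
Qed.

End taylor.

(** * Second-order expansions and the Laplacian *)

Section jets.
Variable R : realType.
Implicit Types (u v : R[i] -> R) (phi psi : R -> R) (z w h A B : R[i]).

Definition rcont u z := forall e : R, 0 < e -> exists2 d : R, 0 < d &
  forall w, modC (w - z) < d -> `|u w - u z| < e.

(** Second-order expansion of a real function at a point of the plane. A real
    quadratic form is the sum of [Re (B * h ^+ 2)] and a multiple [C] of
    [modC h ^+ 2]; only [C], a quarter of the Laplacian, is of interest. *)
Definition jet u z A (C : R) := exists B, forall e : R, 0 < e ->
  exists2 d : R, 0 < d & forall h, modC h < d ->
    `|u (z + h) - (u z + complex.Re (A * h) + complex.Re (B * h ^+ 2)
      + C * modC h ^+ 2)| <= e * modC h ^+ 2.

(** [p] and [q] are the first derivative and half the second derivative. *)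
Definition jet1 phi s (p q : R) := forall e : R, 0 < e ->
  exists2 d : R, 0 < d & forall t, `|t| < d ->
    `|phi (s + t) - (phi s + p * t + q * t ^+ 2)| <= e * t ^+ 2.

Lemma Re_sqr z : complex.Re z ^+ 2 = (modC z ^+ 2 + complex.Re (z ^+ 2)) / 2.
Proof. by rewrite modC_sqr expr2 [z ^+ 2]expr2; case: z => x y /=; field. Qed.

Lemma jet_bound u z A C : jet u z A C -> exists T d, [/\ 0 < d, 1 <= T &
  forall h, modC h < d ->
    `|u (z + h) - u z| <= T * modC h /\
    `|u (z + h) - u z - complex.Re (A * h)| <= T * modC h ^+ 2].
Proof.
case=> B /(_ 1 ltr01)[d d0 H]; exists (modC A + modC B + `|C| + 1), (Num.min d 1).
split.
- by rewrite lt_min d0 ltr01.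
- by have := modC_ge0 A; have := modC_ge0 B; have := normr_ge0 C; lra.
move=> h; rewrite lt_min => /andP[hd h1]; have := H h hd.
set x := u (z + h) - _.
have -> : u (z + h) - u z = x + complex.Re (A * h) + complex.Re (B * h ^+ 2) + C * modC h ^+ 2.
  by rewrite /x; ring.
have := le_Re_modC (A * h); have := le_Re_modC (B * h ^+ 2).
rewrite !modCM; set a := complex.Re (A * h); set b := complex.Re _.
have -> : modC h * modC h = modC h ^+ 2 by rewrite expr2.
have m0 := modC_ge0 h; have mm : modC h ^+ 2 <= modC h.
  by rewrite expr2 ler_piMl// ltW.
have m2 : 0 <= modC h ^+ 2 by rewrite exprn_ge0.
have cC : `|C * modC h ^+ 2| = `|C| * modC h ^+ 2 by rewrite normrM (ger0_norm m2).
have := modC_ge0 A; have := modC_ge0 B; have := normr_ge0 C.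
move: cC m0 mm m2; set mh := modC h; set mA := modC A; set mB := modC B; set c := `|C|.
move: (C * mh ^+ 2) => y cC m0 mm m2 c0 B0 A0 hb ha hx.
have n1 : `|x + b + y| <= (mB + c + 1) * mh ^+ 2.
  apply: le_trans (ler_normD _ _) _; rewrite cC.
  have := ler_normD x b.
  have : (mB + c + 1) * mh ^+ 2 = mB * mh ^+ 2 + c * mh ^+ 2 + mh ^+ 2 by ring.
  lra.
have p1 : (mB + c + 1) * mh ^+ 2 <= (mB + c + 1) * mh.
  by rewrite ler_wpM2l// !addr_ge0.
have p2 : 0 <= mA * mh ^+ 2 by rewrite mulr_ge0.
split.
  have -> : x + a + b + y = a + (x + b + y) by ring.
  apply: le_trans (ler_normD _ _) _.
  have -> : (mA + mB + c + 1) * mh = mA * mh + (mB + c + 1) * mh by ring.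
  by lra.
have -> : x + a + b + y - a = x + b + y by ring.
have -> : (mA + mB + c + 1) * mh ^+ 2 = mA * mh ^+ 2 + (mB + c + 1) * mh ^+ 2 by ring.
by lra.
Qed.

Lemma jet_rcont u z A C : jet u z A C -> rcont u z.
Proof.
move=> /jet_bound[T [d [d0 T1 H]]] e e0; have T0 : 0 < T by lra.
exists (Num.min d (e / T)); first by rewrite lt_min d0 divr_gt0.
move=> w; rewrite lt_min => /andP[wd we].
have [h _] := H _ wd; move: h; rewrite subrKC => h.
by apply: le_lt_trans h _; rewrite mulrC -ltr_pdivlMr.
Qed.

Lemma jetD u v z A C A' C' : jet u z A C -> jet v z A' C' ->
  jet (fun w => u w + v w) z (A + A') (C + C').
Proof.
case=> B H [B' H']; exists (B + B') => e e0; have e2 : 0 < e / 2 by lra.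
have [d d0 D] := H _ e2; have [d' d'0 D'] := H' _ e2.
exists (Num.min d d'); first by rewrite lt_min d0.
move=> h; rewrite lt_min => /andP[hd hd'].
have := D h hd; have := D' h hd'; rewrite !mulrDl !ReD.
set x := u (z + h) - _; set y := v (z + h) - _ => hy hx.
set k := (X in `|X|); have -> : k = x + y by rewrite /k /x /y; ring.
by apply: le_trans (ler_normD _ _) _; lra.
Qed.

(** The square of [Re (A * h)] is half of [modC (A * h) ^+ 2], plus a quadratic
    form without Laplacian. *)
Lemma jet_comp phi p q u z A C : jet1 phi (u z) p q -> jet u z A C ->
  jet (fun w => phi (u w)) z (p%:C * A) (p * C + q * modC A ^+ 2 / 2).
Proof.
move=> phiP uJ; have [T [d1 [d10 T1 HT]]] := jet_bound uJ.
case: uJ => B uB; exists (p%:C * B + (q / 2)%:C * A ^+ 2) => e e0.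
have T0 : 0 < T by lra.
have T20 : 0 < T ^+ 2 by rewrite exprn_gt0.
have e3 : 0 < e / 3 by lra.
have [d2 d20 H2] := phiP _ (divr_gt0 e3 T20).
have P0 : 0 < `|p| + 1 by rewrite ltr_wpDl.
have [d3 d30 H3] := uB _ (divr_gt0 e3 P0).
have Q0 : 0 < 3 * (`|q| + 1) * T ^+ 2 by rewrite !mulr_gt0// ltr_wpDl.
pose d4 := e / 3 / (3 * (`|q| + 1) * T ^+ 2).
have d40 : 0 < d4 by rewrite divr_gt0.
exists (Num.min (Num.min d1 (d2 / T)) (Num.min (Num.min d3 d4) 1)).
  by rewrite !lt_min d10 divr_gt0// d30 d40 ltr01.
move=> h; rewrite !lt_min => /andP[/andP[h1 h2] /andP[/andP[h3 h4] h5]].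
have [ht hl] := HT h h1; have := H3 h h3.
set t := u (z + h) - u z in ht hl; set L := complex.Re (A * h) in hl *.
set Q := complex.Re (B * h ^+ 2) + C * modC h ^+ 2.
have -> : u (z + h) - (u z + L + complex.Re (B * h ^+ 2) + C * modC h ^+ 2) = t - L - Q.
  by rewrite /t /Q; ring.
move=> hrho.
have td2 : `|t| < d2 by apply: le_lt_trans ht _; rewrite mulrC -ltr_pdivlMr.
have := H2 t td2; have -> : u z + t = u (z + h) by rewrite /t subrKC.
have m0 := modC_ge0 h.
have reL : L ^+ 2 = (modC A ^+ 2 * modC h ^+ 2 + complex.Re (A ^+ 2 * h ^+ 2)) / 2.
  by rewrite Re_sqr exprMn modCM exprMn.
have reM (a b : R) (x : R[i]) : complex.Re ((a%:C * B + b%:C * A ^+ 2) * x) =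
   a * complex.Re (B * x) + b * complex.Re (A ^+ 2 * x).
  by rewrite mulrDl ReD -!mulrA !ReZ.
rewrite reM -mulrA ReZ -/L; set r1 := phi (u (z + h)) - _ => hr1.
set k := (X in `|X|).
have -> : k = r1 + p * (t - L - Q) + q * ((t - L) * (t + L)).
  have -> : q * ((t - L) * (t + L)) = q * t ^+ 2 - q * L ^+ 2 by ring.
  by rewrite reL /k /r1 /Q; field.
have m20 : 0 <= modC h ^+ 2 by rewrite exprn_ge0.
have mm : modC h ^+ 2 <= modC h by rewrite expr2 ler_piMl// ltW.
have htL : `|t + L| <= 3 * T * modC h.
  have -> : t + L = t + t - (t - L) by ring.
  apply: le_trans (ler_normB _ _) _; have := ler_normD t t.
  have : T * modC h ^+ 2 <= T * modC h by rewrite ler_wpM2l// ltW.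
  by lra.
have b1 : `|r1| <= e / 3 * modC h ^+ 2.
  apply: le_trans hr1 _; rewrite -[leLHS]mulrA ler_wpM2l//; first exact: ltW.
  rewrite mulrC ler_pdivrMr// -exprMn -real_normK ?num_real//.
  by rewrite lerXn2r ?nnegrE// ?mulr_ge0 ?(ltW T0)// mulrC.
have b2 : `|p * (t - L - Q)| <= e / 3 * modC h ^+ 2.
  rewrite normrM; apply: (@le_trans _ _ ((`|p| + 1) * (e / 3 / (`|p| + 1) * modC h ^+ 2))).
    by rewrite ler_pM//; lra.
  by rewrite mulrA (mulrC (_ + 1)) divfK ?gt_eqF.
have b3 : `|q * ((t - L) * (t + L))| <= e / 3 * modC h ^+ 2.
  rewrite !normrM.
  apply: (@le_trans _ _ ((`|q| + 1) * (T * modC h ^+ 2 * (3 * T * modC h)))).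
    by apply: ler_pM; rewrite ?mulr_ge0//; [lra|apply: ler_pM].
  have -> : (`|q| + 1) * (T * modC h ^+ 2 * (3 * T * modC h)) =
    modC h * (3 * (`|q| + 1) * T ^+ 2) * modC h ^+ 2 by ring.
  by rewrite ler_wpM2r// -ler_pdivlMr// ltW.
apply: le_trans (ler_normD _ _) _; have := ler_normD r1 (p * (t - L - Q)).
by lra.
Qed.

(** The second derivative test: summing the expansion over the four points
    [z + t], [z - t], [z + t i], [z - t i] cancels every term but the last. *)
Lemma jet_max u z A C : jet u z A C ->
  (exists2 d : R, 0 < d & forall w, modC (w - z) < d -> u w <= u z) -> C <= 0.
Proof.
case=> B uB [d d0 H]; rewrite leNgt; apply/negP => C0.
have C2 : 0 < C / 2 by lra.
have [d' d'0 H'] := uB _ C2.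
pose t := Num.min d d' / 2.
have dd : 0 < Num.min d d' by rewrite lt_min d0.
have t0 : 0 < t by rewrite divr_gt0.
have td : t < d by have : Num.min d d' <= d by [rewrite ge_min lexx]; rewrite /t; lra.
have td' : t < d'.
  by have : Num.min d d' <= d' by [rewrite ge_min lexx orbT]; rewrite /t; lra.
have t20 : 0 < t ^+ 2 by rewrite exprn_gt0.
have key h : modC h = t -> complex.Re (A * h) + complex.Re (B * h ^+ 2) <= - (C / 2 * t ^+ 2).
  move=> ht; have := H (z + h); rewrite addrAC subrr add0r ht => /(_ td).
  have := H' h; rewrite ht => /(_ td').
  by rewrite ler_norml => /andP[]; lra.
have mt : modC t%:C = t by rewrite modC_real ger0_norm// ltW.
have k1 := key t%:C mt.
have k2 : _ := key (- t%:C) (etrans (modCN _) mt).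
have mi : modC ('i * t%:C) = t by rewrite modCM modCi mul1r.
have k3 : _ := key ('i * t%:C) mi.
have k4 : _ := key (- ('i * t%:C)) (etrans (modCN _) mi).
have i2 : ('i * t%:C) ^+ 2 = - t%:C ^+ 2 by rewrite exprMn sqr_i mulN1r.
move: k1 k2 k3 k4; rewrite !sqrrN i2 !mulrN !ReN.
have : 0 < C / 2 * t ^+ 2 by rewrite mulr_gt0.
by lra.
Qed.

Lemma jet_eq u v z A C : (exists2 d : R, 0 < d & forall w, modC (w - z) < d -> u w = v w) ->
  jet u z A C -> jet v z A C.
Proof.
case=> d d0 uv [B uB]; exists B => e /uB[d' d'0 H].
exists (Num.min d d'); first by rewrite lt_min d0.
move=> h; rewrite lt_min => /andP[hd hd'].
by rewrite -!uv ?subrr ?modC0//; [exact: H|rewrite addrAC subrr add0r].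
Qed.

Lemma jet_conv u z A A' C C' : A = A' -> C = C' -> jet u z A C -> jet u z A' C'.
Proof. by move=> -> ->. Qed.

(** The real part of a holomorphic function is harmonic: its [C] is [0]. *)
Lemma jet_Re (g : R[i] -> R[i]) z a c K d : 0 < d -> 0 <= K ->
  (forall h, modC h < d ->
    modC (g (z + h) - g z - a * h - c * h ^+ 2) <= K * modC h ^+ 3) ->
  jet (fun w => complex.Re (g w)) z a 0.
Proof.
move=> d0 K0 H; exists c => e e0.
have K10 : 0 < K + 1 by lra.
exists (Num.min d (e / (K + 1))); first by rewrite lt_min d0 divr_gt0.
move=> h; rewrite lt_min => /andP[hd he]; rewrite mul0r addr0.
have := H h hd; set x := g (z + h) - _ - _ - _ => hx.
have -> : complex.Re (g (z + h)) - (complex.Re (g z) + complex.Re (a * h) + complex.Re (c * h ^+ 2))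
  = complex.Re x by rewrite /x !ReB; ring.
apply: le_trans (le_Re_modC _) _; apply: le_trans hx _.
rewrite exprS mulrA ler_wpM2r ?exprn_ge0 ?modC_ge0//.
apply: (@le_trans _ _ ((K + 1) * modC h)).
  by rewrite ler_wpM2r ?modC_ge0//; lra.
by rewrite mulrC -ler_pdivlMr// ltW.
Qed.

Lemma jet1_sqr s : jet1 (fun x => x ^+ 2) s (2 * s) 1.
Proof.
move=> e e0; exists 1 => // t _.
have -> : (s + t) ^+ 2 - (s ^+ 2 + 2 * s * t + 1 * t ^+ 2) = 0 by ring.
by rewrite normr0 mulr_ge0 ?sqr_ge0// ltW.
Qed.

(** [|g| ^ 2] is the sum of the squares of the harmonic functions [Re g] and
    [Re (- i g)]. *)
Lemma jet_modC_sqr (g : R[i] -> R[i]) z a c K d : 0 < d -> 0 <= K ->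
  (forall h, modC h < d ->
    modC (g (z + h) - g z - a * h - c * h ^+ 2) <= K * modC h ^+ 3) ->
  jet (fun w => modC (g w) ^+ 2) z (2 * conjc (g z) * a) (modC a ^+ 2).
Proof.
move=> d0 K0 H.
have J1 := jet_Re d0 K0 H.
have H' h : modC h < d -> modC (- 'i * g (z + h) - - 'i * g z - - 'i * a * h
    - - 'i * c * h ^+ 2) <= K * modC h ^+ 3.
  move=> /H; set x := modC _ => hx; apply: le_trans hx.
  rewrite (_ : - 'i * g _ - _ - _ - _ = - 'i *
    (g (z + h) - g z - a * h - c * h ^+ 2)); last by ring.
  by rewrite modCM modCN modCi mul1r.
have J2 := @jet_Re (fun w => - 'i * g w) _ _ _ _ _ d0 K0 H'.
have Im w : complex.Re (- 'i * w) = complex.Im w.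
  by case: (w) => x y /=; rewrite oppr0 mul0r sub0r mulN1r opprK.
have EA : (2 * complex.Re (g z))%:C * a + (2 * complex.Re (- 'i * g z))%:C * (- 'i * a)
   = 2 * conjc (g z) * a.
  rewrite Im !rmorphM /= rmorph_nat.
  have -> : conjc (g z) = (complex.Re (g z))%:C - 'i * (complex.Im (g z))%:C.
    by case: (g z) => x y; rewrite [LHS]complexE /= rmorphN mulrN.
  by ring.
have EC : 2 * complex.Re (g z) * 0 + 1 * modC a ^+ 2 / 2
   + (2 * complex.Re (- 'i * g z) * 0 + 1 * modC (- 'i * a) ^+ 2 / 2) = modC a ^+ 2.
  by rewrite modCM modCN modCi mul1r; field.
have := jet_conv EA EC (jetD (jet_comp (jet1_sqr _) J1) (jet_comp (jet1_sqr _) J2)).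
by apply: jet_eq; exists 1 => // w _; rewrite modC_sqr Im.
Qed.

(** Peano's form of the second-order Taylor formula. *)
Lemma jet1_derive phi psi (s q d : R) : 0 < d ->
  (forall t : R, `|t - s| < d -> is_derive t (1 : R) phi (psi t)) ->
  is_derive s (1 : R) psi q -> jet1 phi s (psi s) (q / 2).
Proof.
move=> d0 phid psid e e0.
have dpsi : derivable psi s 1 by [].
have psi' : derive1 psi s = q by rewrite derive1E; exact: derive_val.
have [d' d'0 H] := derivable_eps dpsi e0; rewrite psi' in H.
exists (Num.min d d') => [|t]; first by rewrite lt_min d0.
rewrite lt_min => /andP[td td'].
pose D (x : R) := phi x - (psi s * (x - s) + q / 2 * (x - s) ^+ 2).
pose D' (x : R) := psi x - (psi s + q * (x - s)).
have dD x : `|x - s| < d -> is_derive x (1 : R) D (D' x).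
  move=> xd; have := phid _ xd => hx.
  apply: is_derive_eq; rewrite /GRing.scale /= /D'.
  by field.
have D's x : `|x - s| < d' -> `|D' x| <= e * `|x - s|.
  move=> /H; congr (`|_| <= _); rewrite /D'; ring.
have MV a b : a <= b -> (forall x, a <= x -> x <= b -> `|x - s| <= `|t|) ->
    exists2 c, `|c - s| <= `|t| & D b - D a = D' c * (b - a).
  move=> ab abt; have [|| c cab cE] := @MVT_segment R D D' a b ab.
  - move=> x; rewrite in_itv /= => /andP[xa xb]; apply: dD.
    by apply: le_lt_trans td; apply: abt; exact: ltW.
  - apply: derivable_within_continuous => x; rewrite in_itv /= => /andP[xa xb].
    have hD : is_derive x (1 : R) D (D' x).
      by apply: dD; apply: le_lt_trans td; exact: abt.
    exact: (@ex_derive _ _ _ _ _ _ _ hD).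
  - exists c; [|exact: cE]; move: cab; rewrite in_itv /= => /andP[ca cb]; exact: abt.
have final c : `|c - s| <= `|t| -> `|D' c * t| <= e * t ^+ 2.
  move=> ct; rewrite normrM -real_normK ?num_real// expr2 mulrA ler_wpM2r//.
  apply: le_trans (D's c (le_lt_trans ct td')) _.
  by rewrite ler_wpM2l// ltW.
have DE : phi (s + t) - (phi s + psi s * t + q / 2 * t ^+ 2) = D (s + t) - D s.
  by rewrite /D; ring.
rewrite DE; have [t0|/ltW t0] := leP 0 t.
  have [|| c ct ->] := MV s (s + t).
  - by rewrite lerDl.
  - by move=> x sx xt; rewrite !ger0_norm; lra.
  by have -> : s + t - s = t by [ring]; exact: final.
have [|| c ct cE] := MV (s + t) s.
- by rewrite gerDl.
- by move=> x sx xt; rewrite !ler0_norm; lra.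
rewrite distrC cE; have -> : s - (s + t) = - t by ring.
by rewrite mulrN normrN; exact: final.
Qed.

End jets.

(** * Maxima on discs, and a convex function *)

Section ahlfors.
Variable R : realType.
Implicit Types (u v V : R[i] -> R) (z w h p : R[i]).

Lemma rcontM u v z : rcont u z -> rcont v z -> rcont (fun w => u w * v w) z.
Proof.
move=> uc vc e e0; pose M := 1 + `|u z| + `|v z|.
have M1 : 1 <= M by have := normr_ge0 (u z); have := normr_ge0 (v z); rewrite /M; lra.
pose t := Num.min 1 (e / M).
have t0 : 0 < t by rewrite lt_min ltr01 divr_gt0 //; lra.
have t1 : t <= 1 by rewrite ge_min lexx.
have tM : t * M <= e by rewrite -ler_pdivlMr ?ge_min ?lexx ?orbT //; lra.
have [a a0 aA] := uc _ t0; have [b b0 bB] := vc _ t0.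
exists (Num.min a b); first by rewrite lt_min a0.
move=> w; rewrite lt_min => /andP[/aA wa /bB wb].
have -> : u w * v w - u z * v z = (u w - u z) * (v w - v z)
   + u z * (v w - v z) + (u w - u z) * v z by ring.
apply: (le_lt_trans (ler_normD _ _)); rewrite normrM.
have := ler_normD ((u w - u z) * (v w - v z)) (u z * (v w - v z)); rewrite !normrM.
have := normr_ge0 (u z); have := normr_ge0 (v z).
have := normr_ge0 (u w - u z); have := normr_ge0 (v w - v z).
move: tM wa wb; rewrite /M; clearbody t; clear - t0 t1.
move: `|u w - u z| `|v w - v z| `|u z| `|v z| => x y P Q tM xt yt y0 x0 Q0 P0 H.
have : x * y <= x by rewrite ler_piMr //; lra.
have : P * y <= P * t by rewrite ler_wpM2l // ltW.
have : x * Q <= t * Q by rewrite ler_wpM2r // ltW.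
by move: H; set n := `|_|; lra.
Qed.

(** By bisection: if no point were a maximum, each small square would be
    beaten by a single value of [V], hence so would the whole disc. *)
Lemma disc_max V p (r : R) : 0 < r -> (forall z, modC (z - p) <= r -> rcont V z) ->
  exists2 z0, modC (z0 - p) <= r & forall z, modC (z - p) <= r -> V z <= V z0.
Proof.
move=> r0 Vc; apply: contrapT => nmax.
have pK : modC (p - p) <= r by rewrite subrr modC0 ltW.
have beat z : modC (z - p) <= r -> exists2 w, modC (w - p) <= r & V z < V w.
  move=> zK; apply: contrapT => nw; apply: nmax; exists z => // w wK.
  by rewrite leNgt; apply/negP => zw; apply: nw; exists w.
have join w1 w2 : modC (w1 - p) <= r -> modC (w2 - p) <= r ->
    exists w, [/\ modC (w - p) <= r, V w1 <= V w & V w2 <= V w].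
  by move=> h1 h2; have [|/ltW] := leP (V w1) (V w2) => h; [exists w2|exists w1].
pose P x y s := exists2 w, modC (w - p) <= r & forall z, modC (z - p) <= r ->
  rect x (x + s) y (y + s) z -> V z < V w.
have : P (complex.Re p - r) (complex.Im p - r) (2 * r).
  apply: cousin_square; first by rewrite mulr_gt0.
    move=> x y s s0 [w1 k1 H1] [w2 k2 H2] [w3 k3 H3] [w4 k4 H4].
    have [w5 [k5 l1 l2]] := join _ _ k1 k2; have [w6 [k6 l3 l4]] := join _ _ k3 k4.
    have [w [k l5 l6]] := join _ _ k5 k6; exists w => // z zK [z1 z2 z3 z4].
    have E (t : R) : t + s / 2 + s / 2 = t + s by rewrite -addrA -splitr.
    rewrite !E in H2 H3 H4.
    have [h1|/ltW h1] := leP (complex.Re z) (x + s / 2);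
      have [h2|/ltW h2] := leP (complex.Im z) (y + s / 2).
    - by apply: lt_le_trans (le_trans l1 l5); apply: H1.
    - by apply: lt_le_trans (le_trans l3 l6); apply: H3.
    - by apply: lt_le_trans (le_trans l2 l5); apply: H2.
    - by apply: lt_le_trans (le_trans l4 l6); apply: H4.
  move=> a b _ _; set z0 := a +i* b.
  have near (d : R) x y s : 0 < s -> s < d / 2 -> x <= a <= x + s -> y <= b <= y + s ->
      forall z, rect x (x + s) y (y + s) z -> modC (z - z0) < d.
    move=> s0 sd /andP[a1 a2] /andP[b1 b2] z [z1 z2 z3 z4].
    apply: le_lt_trans (modC_le_ReIm _) _; rewrite ReB ImB /=.
    have : `|complex.Re z - a| <= s.
      by clear - z1 z2 a1 a2; rewrite ler_norml; apply/andP; split; lra.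
    have : `|complex.Im z - b| <= s.
      by clear - z3 z4 b1 b2; rewrite ler_norml; apply/andP; split; lra.
    by clear - sd; lra.
  have [z0K|z0K] := leP (modC (z0 - p)) r.
    have [w wK zw] := beat _ z0K; have e0 : 0 < V w - V z0 by rewrite subr_gt0.
    have [d d0 H] := Vc _ z0K _ e0; exists (d / 2); first by rewrite divr_gt0.
    move=> x y s s0 sd _ _ _ _ xa yb; exists w => // z zK zR.
    have := H z (near d x y s s0 sd xa yb z zR).
    by move=> /(le_lt_trans (ler_norm _)); lra.
  exists ((modC (z0 - p) - r) / 2); first by lra.
  move=> x y s s0 sd _ _ _ _ xa yb; exists p => // z zK zR.
  have := near (modC (z0 - p) - r) x y s s0 sd xa yb z zR.
  have := modCD (z0 - z) (z - p); rewrite addrA subrK (modCB z0 z); lra.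
case=> w wK H.
have wR : rect (complex.Re p - r) (complex.Re p - r + 2 * r)
    (complex.Im p - r) (complex.Im p - r + 2 * r) w.
  have := le_trans (le_Re_modC _) wK; have := le_trans (le_Im_modC _) wK.
  rewrite ReB ImB !ler_norml => /andP[i1 i2] /andP[j1 j2].
  by clear - i1 i2 j1 j2; split; lra.
by have := H w wK wR; rewrite ltxx.
Qed.

Lemma jet1_exp (s : R) : jet1 (@expR R) s (expR s) (expR s / 2).
Proof. by apply: (@jet1_derive R expR expR s _ 1). Qed.

Lemma is_derive_inv (s : R) : s != 0 -> is_derive s (1 : R) (fun x => x^-1) (- s^-1 ^+ 2).
Proof.
move=> s0; apply: DeriveDef; first exact: derivableV.
rewrite (@deriveV R R id)// derive_id.
by rewrite /GRing.scale /= mulr1 exprVn.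
Qed.

Lemma jet1_ln (s : R) : 0 < s -> jet1 (@ln R) s s^-1 (- s^-1 ^+ 2 / 2).
Proof.
move=> s0; apply: (@jet1_derive R (@ln R) (fun x => x^-1) s _ s) => //.
  by move=> t; rewrite ltr_norml => /andP[ts _]; apply: is_derive1_ln; lra.
by apply: is_derive_inv; rewrite gt_eqF.
Qed.

(** For [s = ln (|w| ^ 2)] the exponential of [metric_log s] is
    [|w| ^ (- 3 / 2) * (1 + |w| ^ (1 / 2)) ^ (1 / 2)]. The product of its values
    at [w] and at [w - 1] is the squared density of a conformal metric on the
    plane without [0] and [1], with curvature bounded above by a negative
    constant. Negative curvature comes from [metric_log] being convex. *)
Definition metric_log (s : R) := ln (1 + expR (s / 4)) / 2 - 3 / 4 * s.

Lemma jet1_metric_log (s : R) (X := expR (s / 4)) :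
  jet1 metric_log s (X / (1 + X) / 8 - 3 / 4) (X / (1 + X) ^+ 2 / 64).
Proof.
have X0 (t : R) : 0 < 1 + expR (t / 4) by rewrite addr_gt0// expR_gt0.
have d1 (t : R) : is_derive t (1 : R) (fun s : R => s / 4) (4^-1).
  by apply: is_derive_eq; rewrite /GRing.scale /=; field.
have d2 (t : R) : is_derive t (1 : R) (fun s => expR (s / 4)) (expR (t / 4) * 4^-1).
  exact: (@is_derive1_comp R expR (fun s => s / 4) t _ _ (is_derive_expR (t / 4)) (d1 t)).
have d3 (t : R) : is_derive t (1 : R) (fun s => 1 + expR (s / 4)) (expR (t / 4) * 4^-1).
  have K := is_deriveD (is_derive_cst (1 : R) t (1 : R)) (d2 t).
  by rewrite add0r in K.
have d4 (t : R) : is_derive t (1 : R) (fun s => ln (1 + expR (s / 4)))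
    ((1 + expR (t / 4))^-1 * (expR (t / 4) * 4^-1)).
  exact: (@is_derive1_comp R (@ln R) (fun s => 1 + expR (s / 4)) t _ _
    (is_derive1_ln (X0 t)) (d3 t)).
have d5 (t : R) : is_derive t (1 : R) metric_log
    (expR (t / 4) / (1 + expR (t / 4)) / 8 - 3 / 4).
  have := d4 t => H; rewrite /metric_log; apply: is_derive_eq.
  by rewrite /GRing.scale /=; field; rewrite gt_eqF.
have nX : 1 + X != 0 by rewrite gt_eqF//; exact: X0.
have -> : X / (1 + X) ^+ 2 / 64 = (X / (1 + X) ^+ 2 / 32) / 2 by field.
apply: (@jet1_derive R metric_log
  (fun t => expR (t / 4) / (1 + expR (t / 4)) / 8 - 3 / 4) s _ 1) => //.
have d6 : is_derive s (1 : R) (fun t => (1 + expR (t / 4))^-1)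
    (- (1 + X)^-1 ^+ 2 * (X * 4^-1)).
  have n0 : 1 + expR (s / 4) != 0 by rewrite gt_eqF.
  exact: (@is_derive1_comp R (fun x => x^-1) (fun s => 1 + expR (s / 4)) s _ _
    (is_derive_inv n0) (d3 s)).
have := d2 s => H; apply: is_derive_eq; rewrite /GRing.scale /= -/X.
by field.
Qed.

End ahlfors.

(** * Ahlfors' lemma for functions omitting 0 and 1 *)

Section bound.
Variable R : realType.
Implicit Types (g : R[i] -> R[i]) (z w h p : R[i]).

Lemma jet_holo_sqr U g z : open U -> holo U g -> U z ->
  jet (fun w => modC (g w) ^+ 2) z (2 * conjc (g z) * cderiv g z)
    (modC (cderiv g z) ^+ 2).
Proof.
move=> oU gU Uz; have [c [K [d [d0 K0 H]]]] := holo_taylor oU gU Uz.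
exact: jet_modC_sqr d0 K0 H.
Qed.

(** [ln |g|] is harmonic. Only the modulus of its gradient enters the curvature of
    a metric pulled back by [g]. *)
Lemma jet_ln_holo U g z : open U -> holo U g -> U z -> g z != 0 ->
  exists2 A, jet (fun w => ln (modC (g w) ^+ 2)) z A 0 &
    modC A = 2 * modC (cderiv g z) / modC (g z).
Proof.
move=> oU gU Uz gz0; have m0 : 0 < modC (g z) by rewrite modC_gt0.
have s0 : 0 < modC (g z) ^+ 2 by rewrite exprn_gt0.
have J := jet_comp (jet1_ln s0) (jet_holo_sqr oU gU Uz).
exists (((modC (g z) ^+ 2)^-1)%:C * (2 * conjc (g z) * cderiv g z)); last first.
  rewrite !modCM modC_conjc modC_real ger0_norm ?invr_ge0 ?ltW//.
  have -> : modC (2 : R[i]) = 2.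
    by have := modC_real (2 : R); rewrite rmorph_nat ger0_norm.
  by field; rewrite gt_eqF.
apply: jet_conv J => //; rewrite !modCM modC_conjc.
have -> : modC (2 : R[i]) = 2.
  by have := modC_real (2 : R); rewrite rmorph_nat ger0_norm.
by field; rewrite gt_eqF.
Qed.

(** The square root of [modC w], written so that it can be differentiated through
    the logarithm; it is [1] at [w = 0]. *)
Definition root_mod w : R := expR (ln (modC w ^+ 2) / 4).

(** The squared density of the metric is [metric_factor w * metric_factor (w - 1)]. *)
Definition metric_factor w : R := expR (metric_log (ln (modC w ^+ 2))).

Lemma root_mod_gt0 w : 0 < root_mod w.
Proof. exact: expR_gt0. Qed.

Lemma root_mod_sqr w : w != 0 -> root_mod w ^+ 2 = modC w.
Proof.
rewrite -modC_gt0 => w0; rewrite /root_mod -expRM_natl lnXn// mulr2n.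
have -> : 2%:R * ((ln (modC w) + ln (modC w)) / 4) = ln (modC w) by field.
by rewrite lnK.
Qed.

Lemma metric_factor_gt0 w : 0 < metric_factor w.
Proof. exact: expR_gt0. Qed.

Lemma metric_factor_sqr w : metric_factor w ^+ 2 = (1 + root_mod w) / root_mod w ^+ 6.
Proof.
rewrite /metric_factor /root_mod; move: (ln (modC w ^+ 2)) => s.
have X0 := expR_gt0 (s / 4).
have E : expR (metric_log s) ^+ 2 * expR (s / 4) ^+ 6 = 1 + expR (s / 4).
  rewrite -!expRM_natl -expRD /metric_log.
  have -> : 2%:R * (ln (1 + expR (s / 4)) / 2 - 3 / 4 * s) + 6%:R * (s / 4) =
    ln (1 + expR (s / 4)) by field.
  by rewrite lnK// posrE addr_gt0.
by rewrite -E mulfK// expf_neq0// gt_eqF.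
Qed.

Lemma jet_metric_factor U g z : open U -> holo U g -> U z -> g z != 0 ->
  exists A, jet (fun w => ln (metric_factor (g w))) z A
    (root_mod (g z) / (1 + root_mod (g z)) ^+ 2 / 32
      * modC (cderiv g z) ^+ 2 / modC (g z) ^+ 2).
Proof.
move=> oU gU Uz gz0; have [A JA mA] := jet_ln_holo oU gU Uz gz0.
have m0 : modC (g z) != 0 by rewrite modC_eq0.
have J := jet_comp (jet1_metric_log _) JA.
have JE : (fun w => metric_log (ln (modC (g w) ^+ 2))) = fun w => ln (metric_factor (g w)).
  by apply: funext => w; rewrite /metric_factor expRK.
rewrite JE -/(root_mod (g z)) in J.
have nX : 1 + root_mod (g z) != 0 by rewrite gt_eqF// addr_gt0// root_mod_gt0.
eexists; apply: jet_conv J; first by [].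
by rewrite mA mulr0 add0r; field; rewrite m0 nX.
Qed.

(** The curvature of the metric stays away from [0]. Here [X] and [Y] are the
    square roots of [|w|] and [|w - 1|]. One of them is at least [1 / 2], hence
    at least a third of its successor, and its term alone suffices. *)
Lemma curvature_ineq (D X Y c : R) : 0 <= D -> 0 < X -> 0 < Y -> 1 <= X ^+ 2 + Y ^+ 2 ->
  D * (Y ^+ 3 / (1 + X) ^+ 2 + X ^+ 3 / (1 + Y) ^+ 2) <= c ->
  D ^+ 2 * ((1 + X) * (1 + Y)) <= (27 * c) ^+ 2.
Proof.
wlog YX : X Y / Y <= X.
  move=> H D0 X0 Y0 XY h; have [YX|/ltW XY'] := leP Y X; first exact: H.
  by rewrite [_ * (1 + Y)]mulrC; apply: H => //; rewrite addrC.
move=> D0 X0 Y0 XY h.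
have X12 : 1 / 2 <= X.
  rewrite leNgt; apply/negP => hX.
  have : X ^+ 2 < 1 / 4.
    have -> : 1 / 4 = (1 / 2) ^+ 2 :> R by field.
    by rewrite ltrXn2r// ?nnegrE ltW.
  have : Y ^+ 2 <= X ^+ 2 by rewrite lerXn2r// nnegrE ltW.
  by lra.
have X1 : 0 < 1 + X by lra.
have Y1 : 0 < 1 + Y by lra.
have k1 : 1 + X <= 27 * (X ^+ 3 / (1 + X) ^+ 2).
  have : (1 + X) ^+ 3 <= (3 * X) ^+ 3 by rewrite lerXn2r ?nnegrE//; lra.
  rewrite mulrA ler_pdivlMr ?exprn_gt0//.
  by rewrite -exprS exprMn; lra.
have k2 : X ^+ 3 / (1 + X) ^+ 2 <= X ^+ 3 / (1 + Y) ^+ 2.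
  rewrite ler_pM2l ?exprn_gt0// lef_pV2 ?posrE ?exprn_gt0//.
  by rewrite lerXn2r ?nnegrE//; lra.
have k3 : 0 <= Y ^+ 3 / (1 + X) ^+ 2 by rewrite divr_ge0// exprn_ge0// ltW.
have k4 : D * (1 + X) <= 27 * c.
  apply: (@le_trans _ _ (27 * (D * (Y ^+ 3 / (1 + X) ^+ 2 + X ^+ 3 / (1 + Y) ^+ 2))));
    last by rewrite ler_wpM2l.
  rewrite mulrCA ler_wpM2l//; lra.
apply: (@le_trans _ _ ((D * (1 + X)) ^+ 2)).
  rewrite -subr_ge0; have -> : (D * (1 + X)) ^+ 2 - D ^+ 2 * ((1 + X) * (1 + Y)) =
    D ^+ 2 * (1 + X) * (X - Y) by ring.
  by rewrite mulr_ge0 ?subr_ge0// mulr_ge0 ?exprn_ge0 ?(ltW X1).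
have k5 : 0 <= D * (1 + X) by rewrite mulr_ge0 ?(ltW X1).
by rewrite lerXn2r ?nnegrE// (le_trans k5).
Qed.

(** The metric dominates a multiple of the spherical metric; [a] and [b] are
    [|w|] and [|w - 1|]. *)
Lemma density_lower (X Y a b : R) : 0 < X -> 0 < Y -> X ^+ 2 = a -> Y ^+ 2 = b ->
  b <= 1 + a -> 1 <= 8 * (1 + a ^+ 2) ^+ 4 * ((1 + X) / X ^+ 6 * ((1 + Y) / Y ^+ 6)).
Proof.
move=> X0 Y0 Xa Yb ba.
have X60 : 0 < X ^+ 6 by rewrite exprn_gt0.
have Y60 : 0 < Y ^+ 6 by rewrite exprn_gt0.
have a0 : 0 < a by rewrite -Xa exprn_gt0.
have b0 : 0 < b by rewrite -Yb exprn_gt0.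
have -> : 8 * (1 + a ^+ 2) ^+ 4 * ((1 + X) / X ^+ 6 * ((1 + Y) / Y ^+ 6)) =
  8 * (1 + a ^+ 2) ^+ 4 * ((1 + X) * (1 + Y)) / (X ^+ 6 * Y ^+ 6).
  by field; rewrite !gt_eqF.
rewrite ler_pdivlMr ?mul1r ?mulr_gt0//.
have -> : X ^+ 6 * Y ^+ 6 = (a * b) ^+ 3 by rewrite -Xa -Yb; ring.
have h1 : a * b <= (1 + a) ^+ 2.
  by rewrite expr2 ler_pM// ?ltW//; lra.
have h2 : (1 + a) ^+ 2 <= 2 * (1 + a ^+ 2).
  rewrite -subr_ge0.
  by have -> : 2 * (1 + a ^+ 2) - (1 + a) ^+ 2 = (1 - a) ^+ 2 by [ring]; exact: sqr_ge0.
have h3 : (a * b) ^+ 3 <= (2 * (1 + a ^+ 2)) ^+ 3.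
  by rewrite lerXn2r ?nnegrE ?mulr_ge0 ?(ltW a0) ?(ltW b0)// ?addr_ge0 ?sqr_ge0//; lra.
apply: (le_trans h3).
have t1 : 1 <= 1 + a ^+ 2 by rewrite lerDl sqr_ge0.
have t2 : (1 + a ^+ 2) ^+ 3 <= (1 + a ^+ 2) ^+ 4.
  by rewrite [leRHS]exprS ler_peMl// exprn_ge0//; lra.
have t3 : 1 <= (1 + X) * (1 + Y).
  by have := mulr_gt0 X0 Y0; lra.
have -> : (2 * (1 + a ^+ 2)) ^+ 3 = 8 * (1 + a ^+ 2) ^+ 3 * 1 by ring.
apply: ler_pM => //; first by rewrite mulr_ge0// exprn_ge0//; lra.
by rewrite ler_wpM2l.
Qed.

(** The last hypothesis says that a Laplacian is nonpositive at the maximum. Its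
    terms belong to [ln G], which is harmonic, to the logarithms of the two factors
    of the metric, and twice to [ln m], where [G = |g' z| ^ 2] and
    [m = r ^ 2 - |z - p| ^ 2]. *)
Lemma bound_at_max (G E m X Y r : R) : 0 <= G -> 0 < E -> 0 < m -> 0 < X -> 0 < Y ->
  0 <= r -> 1 <= X ^+ 2 + Y ^+ 2 ->
  E ^+ 2 = (1 + X) / X ^+ 6 * ((1 + Y) / Y ^+ 6) ->
  0 + (X / (1 + X) ^+ 2 / 32 * G / (X ^+ 2) ^+ 2 +
       Y / (1 + Y) ^+ 2 / 32 * G / (Y ^+ 2) ^+ 2) +
  (m^-1 * -1 + - m^-1 ^+ 2 / 2 * (2 ^+ 2 * (r ^+ 2 - m)) / 2 +
   (m^-1 * -1 + - m^-1 ^+ 2 / 2 * (2 ^+ 2 * (r ^+ 2 - m)) / 2)) <= 0 ->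
  G * E * m ^+ 2 <= 27 * (64 * r ^+ 2).
Proof.
move=> G0 E0 m0 X0 Y0 r0 XY1 E2.
have [nX nY nm] : [/\ X != 0, Y != 0 & m != 0] by rewrite !gt_eqF.
have [nX1 nY1] : 1 + X != 0 /\ 1 + Y != 0 by rewrite !gt_eqF ?addr_gt0.
have [X30 Y30] : 0 < X ^+ 3 /\ 0 < Y ^+ 3 by rewrite !exprn_gt0.
pose D := G * m ^+ 2 / (X ^+ 3 * Y ^+ 3).
have D0 : 0 <= D.
  by apply: divr_ge0; apply: mulr_ge0 => //; rewrite ?sqr_ge0 ?ltW.
set K := X / _ / _ * _ / _ + _ / _ / _ * _ / _.
have DK : D * (Y ^+ 3 / (1 + X) ^+ 2 + X ^+ 3 / (1 + Y) ^+ 2) = 32 * m ^+ 2 * K.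
  by rewrite /D /K; field; rewrite nX nY nX1 nY1.
rewrite add0r => KC.
have {}KC : K <= 2 * r ^+ 2 / m ^+ 2.
  rewrite -subr_le0; apply: le_trans KC.
  by rewrite le_eqVlt; apply/orP; left; apply/eqP; field.
have h32 : 32 * m ^+ 2 * K <= 64 * r ^+ 2.
  rewrite mulrC -ler_pdivlMr; last by rewrite mulr_gt0// exprn_gt0.
  by apply: le_trans KC _; rewrite le_eqVlt; apply/orP; left; apply/eqP; field.
have := @curvature_ineq D X Y (64 * r ^+ 2) D0 X0 Y0 XY1.
rewrite DK => /(_ h32).
have -> : D ^+ 2 * ((1 + X) * (1 + Y)) = (G * E * m ^+ 2) ^+ 2.
  by rewrite !exprMn E2 /D; field; rewrite nX nY.
have W0 : 0 <= G * E * m ^+ 2 by apply: mulr_ge0 (sqr_ge0 _); rewrite mulr_ge0// ltW.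
have c0 : 0 <= 27 * (64 * r ^+ 2) by rewrite !mulr_ge0.
by rewrite ler_pXn2r ?nnegrE.
Qed.

(** Ahlfors' lemma. The ratio of the pullback by [g] of the negatively curved
    metric to the hyperbolic metric of the disc vanishes on the boundary circle,
    so its maximum is attained inside, unless it is [0]. There the Laplacian of its logarithm is
    nonpositive. As [ln |g'|] is harmonic, this inequality compares the two
    curvatures and bounds the maximum. *)
Lemma spherical_bound U g p (r : R) : open U -> holo U g ->
  (forall z, U z -> g z != 0) -> (forall z, U z -> g z != 1) ->
  0 < r -> (forall z, modC (z - p) <= r -> U z) ->
  forall z, modC (z - p) <= r / 2 ->
    modC (cderiv g z) <= 100 / r * (1 + modC (g z) ^+ 2).
Proof.
move=> oU gU g0 g1 r0 rU.
have g'U := holo_holo_cderiv oU gU.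
pose g_ z := g z - 1.
have g_U : holo U g_.
  move=> z /gU[a [q [qc qa qE]]]; exists a, q; split => // w.
  by rewrite -qE /g_; ring.
have g_' z : U z -> cderiv g_ z = cderiv g z.
  move=> Uz; apply: cderivE; have [q [qc qa qE]] := holo_cderiv gU Uz.
  by exists q; split => // w; rewrite -qE /g_; ring.
have g_0 z : U z -> g_ z != 0 by move=> /g1; rewrite subr_eq0.
pose G z := modC (cderiv g z) ^+ 2.
pose m z := r ^+ 2 - modC (z - p) ^+ 2.
pose E z := metric_factor (g z) * metric_factor (g_ z).
(* the square of the ratio of the two metrics, up to a constant factor *)
pose W z := G z * E z * m z ^+ 2.
have GJ z : U z -> jet G z (2 * conjc (cderiv g z) * cderiv (cderiv g) z)
    (modC (cderiv (cderiv g) z) ^+ 2) by move=> Uz; exact: jet_holo_sqr Uz.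
have mJ z : jet m z (-1%:C * (2 * conjc (z - p) * 1)) (-1).
  have H0 h : modC h < 1 -> modC ((z + h - p) - (z - p) - 1 * h - 0 * h ^+ 2) <= 0 * modC h ^+ 3.
    move=> _; have -> : (z + h - p) - (z - p) - 1 * h - 0 * h ^+ 2 = 0 by ring.
    by rewrite modC0 mul0r.
  have J := @jet_modC_sqr R (fun w => w - p) z 1 0 0 1 ltr01 (lexx _) H0.
  have neg s : jet1 (fun x : R => r ^+ 2 - x) s (-1) 0.
    move=> e e0; exists 1 => // t _.
    have -> : r ^+ 2 - (s + t) - (r ^+ 2 - s + -1 * t + 0 * t ^+ 2) = 0 by ring.
    by rewrite normr0 mulr_ge0 ?sqr_ge0 ?ltW.
  apply: jet_conv (jet_comp (neg _) J); first by rewrite rmorphN.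
  by rewrite modC1; ring.
pose X z := root_mod (g z); pose Y z := root_mod (g_ z).
have EJ z : U z -> exists A, jet (fun w => ln (E w)) z A
    (X z / (1 + X z) ^+ 2 / 32 * G z / modC (g z) ^+ 2
     + Y z / (1 + Y z) ^+ 2 / 32 * G z / modC (g_ z) ^+ 2).
  move=> Uz; have [A JA] := jet_metric_factor oU gU Uz (g0 z Uz).
  have [B JB] := jet_metric_factor oU g_U Uz (g_0 z Uz); rewrite g_'// in JB.
  exists (A + B); have -> : (fun w => ln (E w)) =
      fun w => ln (metric_factor (g w)) + ln (metric_factor (g_ w)).
    by apply: funext => w; rewrite /E lnM// posrE metric_factor_gt0.
  exact: jetD JA JB.
have E0 z : 0 < E z by rewrite mulr_gt0// metric_factor_gt0.
have Ec z : U z -> rcont E z.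
  move=> Uz; have [A JA] := EJ z Uz.
  have -> : E = fun w => expR (ln (E w)) by apply: funext => w; rewrite lnK// posrE.
  exact: jet_rcont (jet_comp (jet1_exp _) JA).
have mc z : rcont m z := jet_rcont (mJ z).
have Gc z : U z -> rcont G z by move=> /GJ/jet_rcont.
have Wc z : modC (z - p) <= r -> rcont W z.
  move=> /rU Uz; apply: (@rcontM R (fun w => G w * E w) (fun w => m w ^+ 2)).
    by apply: rcontM; [exact: Gc|exact: Ec].
  by under eq_fun do rewrite expr2; exact: rcontM.
have [z0 z0K Wmax] := disc_max r0 Wc.
have r20 : 0 < r ^+ 2 by rewrite exprn_gt0.
have G0 z : 0 <= G z by rewrite exprn_ge0// modC_ge0.
have XX z : U z -> X z ^+ 2 = modC (g z) by move=> /g0; exact: root_mod_sqr.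
have YY z : U z -> Y z ^+ 2 = modC (g_ z) by move=> /g_0; exact: root_mod_sqr.
have X0 z : 0 < X z by exact: root_mod_gt0.
have Y0 z : 0 < Y z by exact: root_mod_gt0.
have E2 z : E z ^+ 2 = (1 + X z) / X z ^+ 6 * ((1 + Y z) / Y z ^+ 6).
  by rewrite /E exprMn (metric_factor_sqr (g z)) (metric_factor_sqr (g_ z)).
have W0 z : 0 <= W z by rewrite mulr_ge0 ?sqr_ge0// mulr_ge0// ltW.
have nX z : X z != 0 by rewrite gt_eqF.
have nY z : Y z != 0 by rewrite gt_eqF.
have nX1 z : 1 + X z != 0 by rewrite gt_eqF// addr_gt0.
have nY1 z : 1 + Y z != 0 by rewrite gt_eqF// addr_gt0.
have WB : W z0 <= 27 * (64 * r ^+ 2).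
  have [W00|Wpos] := leP (W z0) 0; first by apply: le_trans W00 _; rewrite !mulr_ge0 ?(ltW r0).
  have Uz0 := rU z0 z0K.
  have m0n : m z0 != 0.
    by apply/eqP => m0; move: Wpos; rewrite /W m0 expr0n mulr0 ltxx.
  have m0 : 0 < m z0.
    rewrite lt_neqAle eq_sym m0n /m subr_ge0 lerXn2r ?nnegrE ?modC_ge0//.
    exact: ltW.
  have Gpos : 0 < G z0.
    rewrite lt_neqAle G0 andbT eq_sym; apply/eqP => G00.
    by move: Wpos; rewrite /W G00 !mul0r ltxx.
  have g'0 : cderiv g z0 != 0.
    by apply/eqP => g'0; move: Gpos; rewrite /G g'0 modC0 expr0n ltxx.
  have z0r : modC (z0 - p) < r.
    rewrite lt_neqAle z0K andbT; apply/eqP => eqr; move: m0.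
    by rewrite /m eqr subrr ltxx.
  have [A1 J1 _] := jet_ln_holo oU g'U Uz0 g'0.
  have [A2 J2] := EJ z0 Uz0.
  have J3 := jet_comp (jet1_ln m0) (mJ z0).
  (* the logarithm of [W] at [z0] *)
  have J := jetD (jetD J1 J2) (jetD J3 J3).
  have locmax : exists2 d : R, 0 < d & forall w, modC (w - z0) < d ->
      ln (G w) + ln (E w) + (ln (m w) + ln (m w)) <=
      ln (G z0) + ln (E z0) + (ln (m z0) + ln (m z0)).
    have [d1 d10 H1] := Gc z0 Uz0 _ Gpos; have [d2 d20 H2] := mc z0 _ m0.
    have d30 : 0 < r - modC (z0 - p) by lra.
    exists (Num.min (Num.min d1 d2) (r - modC (z0 - p))).
      by rewrite lt_min d30 lt_min d10 d20.
    move=> w; rewrite lt_min => /andP[+ w3]; rewrite lt_min => /andP[w1 w2].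
    have Gw : 0 < G w by have := H1 w w1; rewrite ltr_norml => /andP[]; lra.
    have mw : 0 < m w by have := H2 w w2; rewrite ltr_norml => /andP[]; lra.
    have wK : modC (w - p) <= r.
      have := modCD (w - z0) (z0 - p); rewrite addrA subrK; lra.
    rewrite -ler_expR !expRD !lnK ?posrE//.
    by have := Wmax w wK; rewrite /W !expr2.
  have := jet_max J locmax.
  have -> : modC (-1%:C * (2 * conjc (z0 - p) * 1)) = 2 * modC (z0 - p).
    rewrite !modCM modC_conjc modC1 mulr1 -rmorphN modC_real normrN normr1 mul1r.
    by have := modC_real (2 : R); rewrite rmorph_nat ger0_norm// => ->.
  have XY1 : 1 <= X z0 ^+ 2 + Y z0 ^+ 2.
    rewrite XX// YY// -(@modC1 R).
    have -> : 1 = g z0 - g_ z0 by rewrite /g_; ring.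
    by have := modCD (g z0) (- g_ z0); rewrite modCN.
  rewrite -(XX z0 Uz0) -(YY z0 Uz0).
  have mr : modC (z0 - p) ^+ 2 = r ^+ 2 - m z0 by rewrite /m; ring.
  have -> : (2 * modC (z0 - p)) ^+ 2 = 2 ^+ 2 * (r ^+ 2 - m z0) by rewrite exprMn mr.
  apply: bound_at_max; [exact: G0|exact: E0|exact: m0|exact: X0
    |exact: Y0|exact: ltW|exact: XY1|exact: E2].
move=> z zr2.
have zK : modC (z - p) <= r by lra.
have Uz := rU z zK.
have WzB := le_trans (Wmax z zK) WB.
have mz : 3 / 4 * r ^+ 2 <= m z.
  have : modC (z - p) ^+ 2 <= (r / 2) ^+ 2.
    by rewrite lerXn2r ?nnegrE ?modC_ge0//; lra.
  by rewrite expr_div_n /m; lra.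
have GE : G z * E z <= 32 * 100 / r ^+ 2.
  rewrite ler_pdivlMr//.
  have GE0 : 0 <= G z * E z by rewrite mulr_ge0// ltW.
  have m2 : (3 / 4 * r ^+ 2) ^+ 2 <= m z ^+ 2.
    have q0 : 0 <= 3 / 4 * r ^+ 2 by apply: mulr_ge0 (ltW r20).
    by rewrite lerXn2r ?nnegrE// (le_trans q0 mz).
  have : G z * E z * (3 / 4 * r ^+ 2) ^+ 2 <= 27 * (64 * r ^+ 2).
    by apply: le_trans WzB; rewrite /W ler_wpM2l.
  have -> : G z * E z * (3 / 4 * r ^+ 2) ^+ 2 = 9 / 16 * (G z * E z * r ^+ 2) * r ^+ 2 by field.
  have -> : 27 * (64 * r ^+ 2) = 27 * 64 * r ^+ 2 by ring.
  by rewrite ler_pM2r//; lra.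
set a := modC (g z).
have ba : modC (g_ z) <= 1 + a.
  by rewrite /g_ addrC; apply: le_trans (modCD _ _) _; rewrite modCN modC1.
have low := density_lower (X0 z) (Y0 z) (XX z Uz) (YY z Uz) ba.
rewrite -E2 -/a in low.
have a1 : 0 < 1 + a ^+ 2 by rewrite ltr_wpDr// sqr_ge0.
have R0 : 0 <= 100 / r * (1 + a ^+ 2) by rewrite mulr_ge0 ?divr_ge0 ?(ltW r0) ?(ltW a1).
rewrite -(ler_pXn2r (n := 4)) ?nnegrE ?modC_ge0//.
have -> : modC (cderiv g z) ^+ 4 = G z ^+ 2 by rewrite /G -exprM.
have GE2 : (G z * E z) ^+ 2 <= (32 * 100 / r ^+ 2) ^+ 2.
  have q1 : 0 <= G z * E z by rewrite mulr_ge0// ltW.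
  by rewrite lerXn2r ?nnegrE// (le_trans q1).
apply: (@le_trans _ _ (8 * (1 + a ^+ 2) ^+ 4 * (G z * E z) ^+ 2)).
  have -> : 8 * (1 + a ^+ 2) ^+ 4 * (G z * E z) ^+ 2 =
    8 * (1 + a ^+ 2) ^+ 4 * E z ^+ 2 * G z ^+ 2 by ring.
  by rewrite ler_peMl ?sqr_ge0.
have a4 : 0 < (1 + a ^+ 2) ^+ 4 by rewrite exprn_gt0.
apply: (@le_trans _ _ (8 * (1 + a ^+ 2) ^+ 4 * (32 * 100 / r ^+ 2) ^+ 2)).
  by rewrite ler_wpM2l// mulr_ge0// ltW.
have -> : 8 * (1 + a ^+ 2) ^+ 4 * (32 * 100 / r ^+ 2) ^+ 2 =
  (100 / r ^+ 2) ^+ 2 * (1 + a ^+ 2) ^+ 4 * (8 * 32 ^+ 2) by ring.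
have -> : (100 / r * (1 + a ^+ 2)) ^+ 4 =
    (100 / r ^+ 2) ^+ 2 * (1 + a ^+ 2) ^+ 4 * 100 ^+ 2.
  by field; rewrite gt_eqF.
rewrite ler_wpM2l//; first by rewrite mulr_ge0 ?sqr_ge0// ltW.
by rewrite -subr_ge0; lra.
Qed.

End bound.

(** * The chordal metric and functions omitting two values *)

Section chordal_metric.
Variable R : realType.
Implicit Types (x y u : riemann_sphere R) (z w a b : R[i]).

Definition weight z : R := Num.sqrt (1 + modC z ^+ 2).

Lemma weight_sqr z : weight z ^+ 2 = 1 + modC z ^+ 2.
Proof. by rewrite /weight sqr_sqrtr// addr_ge0// sqr_ge0. Qed.

Lemma weight_gt0 z : 0 < weight z.
Proof. by rewrite /weight sqrtr_gt0 ltr_wpDr// sqr_ge0. Qed.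

(** Homogeneous coordinates of norm [1], at infinity as at finite points. The
    chordal distance is the modulus of their determinant, so that no case
    distinction is left in the triangle inequality. *)
Definition coord1 x : R[i] := if x is Some z then z / (weight z)%:C else 1.
Definition coord2 x : R[i] := if x is Some z then ((weight z)^-1)%:C else 0.

Lemma coord_norm x : modC (coord1 x) ^+ 2 + modC (coord2 x) ^+ 2 = 1.
Proof.
case: x => [z|]; rewrite /coord1 /coord2; last by rewrite modC1 modC0 expr0n addr0 expr1n.
have h0 := weight_gt0 z.
rewrite modCM modCV !modC_real normfV gtr0_norm// exprMn exprVn weight_sqr.
by field; rewrite -weight_sqr expf_neq0// gt_eqF.
Qed.

Lemma chordal_det x y :
  chordal x y = modC (coord1 x * coord2 y - coord2 x * coord1 y).
Proof.
case: x y => [z|] [w|]; rewrite /chordal /coord1 /coord2.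
- have h0 := weight_gt0 z; have k0 := weight_gt0 w.
  have hz : (weight z)%:C != 0 :> R[i] by rewrite -modC_eq0 modC_real normr_eq0 gt_eqF.
  have hw : (weight w)%:C != 0 :> R[i] by rewrite -modC_eq0 modC_real normr_eq0 gt_eqF.
  rewrite !fmorphV.
  have -> : z / (weight z)%:C * ((weight w)%:C)^-1 - ((weight z)%:C)^-1 * (w / (weight w)%:C)
     = (z - w) * ((weight z)%:C * (weight w)%:C)^-1 by field; rewrite hz hw.
  by rewrite modCM modCV modCM !modC_real !gtr0_norm.
- rewrite mulr0 sub0r modCN mulr1 modC_real ger0_norm ?invr_ge0 ?(ltW (weight_gt0 z))//.
  by rewrite div1r.
- by rewrite mul0r subr0 !mul1r modC_real ger0_norm ?invr_ge0 ?(ltW (weight_gt0 w)).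
- by rewrite mulr0 mul0r subrr modC0.
Qed.

Lemma chordal_ge0 x y : 0 <= chordal x y.
Proof. by rewrite chordal_det modC_ge0. Qed.

Lemma chordal_sym x y : chordal x y = chordal y x.
Proof. by rewrite !chordal_det -modCN; congr modC; ring. Qed.

Lemma chordal_triangle u x y : chordal x y <= chordal x u + chordal u y.
Proof.
rewrite !chordal_det.
move: (coord_norm x) (coord_norm y) (coord_norm u).
move: (coord1 x) (coord2 x) (coord1 y) (coord2 y) (coord1 u) (coord2 u).
move=> x1 x2 y1 y2 u1 u2 nx ny nu.
have uu : u1 * conjc u1 + u2 * conjc u2 = 1.
  have E z : z * conjc z = (modC z ^+ 2)%:C.
    by rewrite modC_sqr; case: z => p q; apply/eqP; rewrite eq_complex /=;
      apply/andP; split; apply/eqP; ring.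
  by rewrite !E -rmorphD nu.
have cs p q : modC p ^+ 2 + modC q ^+ 2 = 1 -> modC (p * conjc u1 + q * conjc u2) <= 1.
  move=> pq; apply: le_trans (modCD _ _) _; rewrite !modCM !modC_conjc.
  have := sqr_ge0 (modC p - modC u1); have := sqr_ge0 (modC q - modC u2).
  by rewrite !sqrrB; lra.
(* a determinant times the squared norm of [u], expanded along [u] *)
have -> : x1 * y2 - x2 * y1 = (x1 * u2 - x2 * u1) * (y1 * conjc u1 + y2 * conjc u2)
   + (u1 * y2 - u2 * y1) * (x1 * conjc u1 + x2 * conjc u2).
  by rewrite -[LHS]mulr1 -uu; ring.
apply: le_trans (modCD _ _) _; rewrite !modCM.
by apply: lerD; rewrite ler_piMr ?modC_ge0 ?cs.
Qed.

(** The [weight]s of two close values of [g] differ by a factor at most [2]. With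
    the bound [K] on the spherical derivative this gives the local Lipschitz
    constant [2 * K + 2], and the bisection of a segment makes it global. *)
Lemma chordal_lipschitz (g : R[i] -> R[i]) p (r K : R) : 0 <= K ->
  (forall z, modC (z - p) <= r -> exists2 l, cdiff g z l &
     modC l <= K * (1 + modC (g z) ^+ 2)) ->
  forall z w, modC (z - p) <= r -> modC (w - p) <= r ->
    chordal (Some (g z)) (Some (g w)) <= (2 * K + 2) * modC (w - z).
Proof.
move=> K0 gK z w zp wp.
pose L := 2 * K + 2; have L0 : 0 <= L by rewrite /L; lra.
pose c t := z + t%:C * (w - z).
have cE s t : c s - c t = (s - t)%:C * (w - z) by rewrite /c rmorphB; ring.
have cp t : 0 <= t -> t <= 1 -> modC (c t - p) <= r.
  move=> t0 t1; have -> : c t - p = (1 - t)%:C * (z - p) + t%:C * (w - p).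
    by rewrite /c rmorphB; ring.
  apply: le_trans (modCD _ _) _; rewrite !modCM !modC_real !ger0_norm ?subr_ge0//.
  have h1 : (1 - t) * modC (z - p) <= (1 - t) * r by rewrite ler_wpM2l// subr_ge0.
  have h2 : t * modC (w - p) <= t * r by rewrite ler_wpM2l.
  by lra.
suff : chordal (Some (g (c 0))) (Some (g (c 1))) <= L * modC (w - z) * (1 - 0).
  by rewrite subr0 mulr1 /c mul0r addr0 mul1r subrKC.
apply: (@cousin_itv R (fun s t => chordal (Some (g (c s))) (Some (g (c t)))
   <= L * modC (w - z) * (t - s))); first exact: ltr01.
  move=> s t u st tu h1 h2; apply: le_trans (chordal_triangle (Some (g (c t))) _ _) _.
  by apply: le_trans (lerD h1 h2) _; rewrite -mulrDr; have -> : t - s + (u - t) = u - s by ring.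
move=> t /andP[t0 t1]; have [l gl lK] := gK _ (cp t t0 t1).
set A := 1 + modC (g (c t)) ^+ 2 in lK.
have A1 : 1 <= A by rewrite lerDl sqr_ge0.
have [d1 d10 H1] := cdiff_eps gl ltr01.
have h20 : (0 : R) < 1 / 2 by lra.
have [d2 d20 H2] := cdiff_cont gl h20.
have M0 : 0 < modC (w - z) + 1 by have := modC_ge0 (w - z); lra.
have loc s : `|s - t| < Num.min d1 d2 / (modC (w - z) + 1) ->
    chordal (Some (g (c s))) (Some (g (c t))) <= L * modC (w - z) * `|s - t|.
  move=> st.
  have sm : modC (c s - c t) = `|s - t| * modC (w - z) by rewrite cE modCM modC_real.
  have sd : modC (c s - c t) < Num.min d1 d2.
    apply: le_lt_trans (_ : _ <= `|s - t| * (modC (w - z) + 1)) _.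
      by rewrite sm ler_wpM2l//; lra.
    by rewrite -ltr_pdivlMr.
  move: sd; rewrite lt_min => /andP[/H1 k1 /H2 k2].
  rewrite -mulrA [modC (w - z) * _]mulrC -sm; set h := modC (c s - c t) in k1 *.
  have h0 : 0 <= h by exact: modC_ge0.
  have e1 : modC (g (c s) - g (c t)) <= (K * A + 1) * h.
    have -> : g (c s) - g (c t) = (g (c s) - g (c t) - l * (c s - c t)) + l * (c s - c t).
      by rewrite subrK.
    apply: le_trans (modCD _ _) _; rewrite modCM -/h.
    have : modC l * h <= K * A * h by rewrite ler_wpM2r.
    by lra.
  rewrite /= -/(weight _) -/(weight _) ler_pdivrMr ?mulr_gt0 ?weight_gt0//.
  apply: le_trans e1 _.
  have hA : weight (g (c t)) ^+ 2 = A by exact: weight_sqr.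
  have t1' := weight_gt0 (g (c t)); have s1' := weight_gt0 (g (c s)).
  have hh : weight (g (c t)) <= 2 * weight (g (c s)).
    rewrite -(ler_pXn2r (n := 2)) ?nnegrE ?mulr_ge0 ?(ltW t1') ?(ltW s1')//.
    rewrite exprMn !weight_sqr.
    have k3 : modC (g (c t)) <= modC (g (c s)) + 1 / 2.
      have := modCD (g (c t) - g (c s)) (g (c s)); rewrite subrK modCB; lra.
    have k4 : modC (g (c t)) ^+ 2 <= (modC (g (c s)) + 1 / 2) ^+ 2.
      by rewrite lerXn2r ?nnegrE ?addr_ge0 ?modC_ge0//; lra.
    have := sqr_ge0 (modC (g (c s)) - 1 / 2).
    have := sqr_ge0 (modC (g (c s))).
    by move: k4; clear; rewrite sqrrB sqrrD; lra.
  have hAs : A <= 2 * (weight (g (c s)) * weight (g (c t))).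
    by rewrite -hA expr2 mulrA ler_pM2r.
  have -> : L * h * (weight (g (c s)) * weight (g (c t))) =
      L * (weight (g (c s)) * weight (g (c t))) * h by ring.
  rewrite ler_wpM2r// /L.
  have : K * A <= K * (2 * (weight (g (c s)) * weight (g (c t)))) by rewrite ler_wpM2l.
  by lra.
exists (Num.min d1 d2 / (modC (w - z) + 1)).
  by rewrite divr_gt0// lt_min d10.
move=> x y x0 xt ty y1 yx.
apply: le_trans (chordal_triangle (Some (g (c t))) _ _) _.
have xE : `|x - t| = t - x by rewrite distrC ger0_norm//; lra.
have yE : `|y - t| = y - t by rewrite ger0_norm//; lra.
have k1 := loc x; rewrite xE in k1; have k2 := loc y; rewrite yE chordal_sym in k2.
apply: le_trans (lerD (k1 _) (k2 _)) _; [lra|lra|].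
by rewrite -mulrDr; have -> : t - x + (y - t) = y - x by ring.
Qed.

(** The affine map that sends [a] to [0] and [b] to [1] changes spherical
    derivatives by a bounded factor, which reduces the statement to functions that
    omit [0] and [1]. The constants [r] and [L] do not depend on [f]. *)
Lemma omitting_equicontinuous (U : set R[i]) a b p : open U -> U p -> a != b ->
  exists r L : R, [/\ 0 < r, 0 <= L & forall f, holo U f ->
    (forall z, U z -> f z != a) -> (forall z, U z -> f z != b) ->
    forall z, modC (z - p) <= r ->
      chordal (Some (f z)) (Some (f p)) <= L * modC (z - p)].
Proof.
move=> oU Up ab; have [r r0 rU] := open_disc oU Up.
have ba0 : b - a != 0 by rewrite subr_eq0 eq_sym.
set B := modC (b - a); have B0 : 0 < B by rewrite modC_gt0.
pose M := 1 + 2 * (1 + modC a ^+ 2) / B ^+ 2.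
have B20 : 0 < B ^+ 2 by rewrite exprn_gt0.
have a1 : 1 <= 1 + modC a ^+ 2 by rewrite lerDl sqr_ge0.
have M0 : 0 <= M by rewrite addr_ge0// divr_ge0// ?(ltW B20)// mulr_ge0//; lra.
pose K := B * (100 / r * M).
have K0 : 0 <= K by rewrite mulr_ge0 ?(ltW B0)// mulr_ge0// divr_ge0// ltW.
exists (r / 2), (2 * K + 2); split; [lra|lra|].
move=> f fU fa fb z zr.
pose g z := (f z - a) / (b - a).
have fg (u : R[i]) : f u = a + (b - a) * g u by rewrite /g mulrCA mulfV// mulr1 subrKC.
have gd (u l : R[i]) : cdiff f u l -> cdiff g u (l / (b - a)).
  case=> q [qc <- qE]; exists (fun w => q w / (b - a)); split => //.
    by apply: ccontM => //; exact: ccont_cst.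
  by move=> w; rewrite mulrAC -qE /g -mulrBl; congr (_ * _); ring.
have gU : holo U g by move=> u /fU[l /gd]; exists (l / (b - a)).
have g0 (u : R[i]) : U u -> g u != 0.
  by move=> Uu; rewrite mulf_neq0 ?invr_neq0// subr_eq0 fa.
have g1 (u : R[i]) : U u -> g u != 1.
  move=> Uu; apply/eqP => gu; have := fb u Uu.
  by rewrite fg gu mulr1 subrKC eqxx.
have rU' (u : R[i]) : modC (u - p) <= r -> U u by move=> ur; apply: rU; lra.
have bnd := spherical_bound oU gU g0 g1 r0 rU'.
rewrite chordal_sym; apply: (@chordal_lipschitz f p (r / 2) K) => //; last first.
  by rewrite subrr modC0; lra.
move=> u ur; have Uu : U u by apply: rU'; lra.
have [l fl] := fU u Uu; exists l => //.
have := bnd u ur; rewrite (cderivE (gd u l fl)) modCM modCV -/B ler_pdivrMr// => h.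
apply: le_trans h _.
have gM : 1 + modC (g u) ^+ 2 <= M * (1 + modC (f u) ^+ 2).
  rewrite /g modCM modCV -/B exprMn exprVn.
  have h1 : modC (f u - a) ^+ 2 <= 2 * (1 + modC a ^+ 2) * (1 + modC (f u) ^+ 2).
    have h2 : modC (f u - a) ^+ 2 <= (modC (f u) + modC a) ^+ 2.
      rewrite lerXn2r ?nnegrE ?addr_ge0 ?modC_ge0//.
      by apply: le_trans (modCD _ _) _; rewrite modCN.
    apply: le_trans h2 _; rewrite sqrrD.
    have := sqr_ge0 (modC (f u) - modC a); rewrite sqrrB.
    by have := mulr_ge0 (sqr_ge0 (modC a)) (sqr_ge0 (modC (f u))); lra.
  rewrite /M mulrDl mul1r; apply: lerD; first by rewrite lerDl sqr_ge0.
  by rewrite [leRHS]mulrAC ler_pM2r ?invr_gt0.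
rewrite /K.
have -> : 100 / r * (1 + modC (g u) ^+ 2) * B =
    B * (100 / r) * (1 + modC (g u) ^+ 2) by ring.
have -> : B * (100 / r * M) * (1 + modC (f u) ^+ 2) =
    B * (100 / r) * (M * (1 + modC (f u) ^+ 2)) by ring.
by rewrite ler_wpM2l// mulr_ge0 ?(ltW B0)// divr_ge0// ltW.
Qed.

End chordal_metric.

(** * The theorem of Arzela and Ascoli on the bicomplex plane *)

Section sphere.
Variable R : realType.
Local Notation sphere := (one_point_compactification R[i]).
Implicit Types (x y : sphere) (z w : R[i]).

Lemma weight_ge1 z : 1 <= weight z.
Proof.
have h0 := weight_gt0 z.
by rewrite -(ler_pXn2r (n := 2)) ?nnegrE ?(ltW h0)// weight_sqr expr1n lerDl sqr_ge0.
Qed.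

Lemma weight_ge_modC z : modC z <= weight z.
Proof.
have h0 := weight_gt0 z.
by rewrite -(ler_pXn2r (n := 2)) ?nnegrE ?(ltW h0) ?modC_ge0// weight_sqr lerDr.
Qed.

Lemma compact_square (M : R) : 0 <= M ->
  compact [set z : R[i] | `|complex.Re z| <= M /\ `|complex.Im z| <= M].
Proof.
move=> M0.
have -> : [set z : R[i] | `|complex.Re z| <= M /\ `|complex.Im z| <= M] =
    (fun p : R * R => p.1 +i* p.2) @` (`[- M, M] `*` `[- M, M]).
  apply/seteqP; split => [[a b] [/= ha hb]|_ [[a b] [/= + +] <-]].
    by exists (a, b) => //; split => /=; rewrite in_itv /= -ler_norml.
  by rewrite !in_itv /= -!ler_norml.
apply: continuous_compact; last by apply: compact_setX; exact: segment_compact.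
apply: continuous_subspaceT => -[a b] A /nbhsC[d d0 dA].
have d2 : 0 < d / 2 by rewrite divr_gt0.
exists (ball a (d / 2), ball b (d / 2)); first by split; exact: nbhsx_ballx.
move=> [a' b'] [/= + +]; rewrite /ball /= => ha hb; apply: dA.
apply: le_lt_trans (modC_le_ReIm _) _; rewrite ReB ImB /=.
by move: ha hb; rewrite distrC (distrC b); lra.
Qed.

Lemma closed_square (M : R) :
  closed [set z : R[i] | `|complex.Re z| <= M /\ `|complex.Im z| <= M].
Proof.
move=> p clp.
have near (e : R) : 0 < e -> `|complex.Re p| <= M + e /\ `|complex.Im p| <= M + e.
  move=> e0; have /clp[z [[z1 z2] /= zp]] : nbhs p [set z | modC (z - p) < e].
    by apply/nbhsC; exists e.
  have := le_Re_modC (z - p); have := le_Im_modC (z - p); rewrite ReB ImB => h1 h2.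
  have := ler_normB (complex.Re z) (complex.Re z - complex.Re p).
  have := ler_normB (complex.Im z) (complex.Im z - complex.Im p).
  by rewrite !subKr; split; lra.
by split; apply/ler_addgt0Pr => e /near[].
Qed.

(** A chordal disc around infinity contains the complement of a compact square. *)
Lemma nbhs_chordal x (e : R) : 0 < e -> nbhs x [set y : sphere | chordal y x < e].
Proof.
move=> e0; case: x => [a|].
  apply/nbhsC; exists e => // b ba.
  rewrite /= -/(weight _) -/(weight _) ltr_pdivrMr ?mulr_gt0 ?weight_gt0//.
  apply: (lt_le_trans ba); rewrite ler_peMr ?(ltW e0)//.
  by rewrite -[leLHS]mulr1 ler_pM// weight_ge1.
have M0 : 0 <= e^-1 by rewrite invr_ge0 ltW.
exists [set z : R[i] | `|complex.Re z| <= e^-1 /\ `|complex.Im z| <= e^-1].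
  by split; [exact: compact_square|exact: closed_square].
move=> _ [[z zM <-]|->] /=; last exact: e0.
rewrite -/(weight z) div1r invf_plt ?posrE ?weight_gt0//.
apply: lt_le_trans (weight_ge_modC z); rewrite ltNge; apply/negP => h.
by apply: zM; split; apply: le_trans h; [exact: le_Re_modC|exact: le_Im_modC].
Qed.

End sphere.

Section extended_distance.
Variable R : realType.
Implicit Types (x y u : ebicomplex R).

(** The sum of the two chordal distances dominates their quadratic mean
    [bichordal], and inherits the triangle inequality term by term. *)
Definition chordal_sum x y : R := chordal x.1 y.1 + chordal x.2 y.2.

Lemma bichordal_le_sum x y : bichordal x y <= chordal_sum x y.
Proof.
rewrite /bichordal /chordal_sum.
have := chordal_ge0 x.1 y.1; have := chordal_ge0 x.2 y.2.
move: (chordal x.1 y.1) (chordal x.2 y.2) => a b b0 a0.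
have ab : 0 <= a + b by rewrite addr_ge0.
have -> : a + b = Num.sqrt ((a + b) ^+ 2) by rewrite sqrtr_sqr ger0_norm.
rewrite ler_sqrt ?sqr_ge0//.
have := mulr_ge0 a0 b0; have := sqr_ge0 a; have := sqr_ge0 b.
by rewrite sqrrD; lra.
Qed.

Lemma chordal_sum_sym x y : chordal_sum x y = chordal_sum y x.
Proof. by rewrite /chordal_sum chordal_sym (chordal_sym x.2). Qed.

Lemma chordal_sum_triangle u x y : chordal_sum x y <= chordal_sum x u + chordal_sum u y.
Proof. by rewrite /chordal_sum addrACA lerD// chordal_triangle. Qed.

Lemma nbhs_chordal_sum x (e : R) : 0 < e ->
  nbhs (x : one_point_compactification R[i] * one_point_compactification R[i])
    [set y | chordal_sum y x < e].
Proof.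
move=> e0; have e2 : 0 < e / 2 by rewrite divr_gt0.
exists ([set y | chordal y x.1 < e / 2], [set y | chordal y x.2 < e / 2]).
  by split; exact: nbhs_chordal.
by move=> y [/= h1 h2]; rewrite /chordal_sum; lra.
Qed.

Lemma nbhs_bicomplex (w : bicomplex R) (V : set (bicomplex R)) : nbhs w V <->
  exists2 d : R, 0 < d & forall v, modC (v.1 - w.1) < d -> modC (v.2 - w.2) < d -> V v.
Proof.
split=> [[[A B] [/= /nbhsC[d d0 dA] /nbhsC[d' d'0 dB]] AB]|[d d0 dV]].
  exists (Num.min d d'); first by rewrite lt_min d0.
  move=> v; rewrite !lt_min => /andP[v1 _] /andP[_ v2].
  by apply: AB; split => /=; [exact: dA|exact: dB].
exists ([set z | modC (z - w.1) < d], [set z | modC (z - w.2) < d]).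
  by split; apply/nbhsC; exists d.
by move=> v [/= h1 h2]; exact: dV.
Qed.

(** An enumeration of the points with rational coordinates. Numbers that are not
    codes are sent to [0]. *)
Definition rat_point (n : nat) : bicomplex R :=
  if unpickle n is Some (a, b, (c, d)) then
    ((ratr a : R) +i* (ratr b : R), (ratr c : R) +i* (ratr d : R))
  else 0.

Lemma rat_dense (z : R[i]) (d : R) : 0 < d ->
  exists a b : rat, modC ((ratr a : R) +i* (ratr b : R) - z) < d.
Proof.
move=> d0; have [|a] := @rat_in_itvoo R (complex.Re z) (complex.Re z + d / 2); first by lra.
have [|b] := @rat_in_itvoo R (complex.Im z) (complex.Im z + d / 2); first by lra.
rewrite !in_itv /= => /andP[b1 b2] /andP[a1 a2]; exists a, b.
apply: le_lt_trans (modC_le_ReIm _) _; rewrite ReB ImB /=.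
by rewrite !ger0_norm; lra.
Qed.

Lemma rat_point_dense (w : bicomplex R) V : nbhs w V -> exists k, V (rat_point k).
Proof.
case/nbhs_bicomplex => d d0 dV.
have [a [b ab]] := rat_dense w.1 d0; have [c [e ce]] := rat_dense w.2 d0.
exists (pickle (a, b, (c, e))); rewrite /rat_point pickleK.
exact: dV.
Qed.

(** Arzela and Ascoli: by Tychonoff's theorem the sequence has a pointwise
    cluster point [c]. Although the product topology is not first countable, a
    subsequence converges to [c] at the countably many rational points;
    equicontinuity turns this into locally uniform convergence. *)
Lemma ascoli (Omega : set (bicomplex R)) (f_ : nat -> bicomplex R -> ebicomplex R) :
  open Omega ->
  (forall p, Omega p -> forall e : R, 0 < e -> exists2 V, nbhs p V &
    forall n w, V w -> chordal_sum (f_ n w) (f_ n p) < e) ->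
  exists phi : nat -> nat, increasing_seq phi /\
    exists c : bicomplex R -> ebicomplex R,
      forall K : set (bicomplex R), compact K -> K `<=` Omega ->
        forall e : R, 0 < e -> exists n0 : nat, forall n w, (n0 <= n)%N -> K w ->
          chordal_sum (f_ (phi n) w) (c w) < e.
Proof.
move=> oO equi.
pose S := (one_point_compactification R[i] * one_point_compactification R[i])%type.
have cS : compact [set: S].
  rewrite -setXTT; apply: compact_setX; exact: one_point_compactification_compact.
have := @tychonoff (bicomplex R) (fun=> S) (fun=> [set: S]) (fun=> cS).
move=> /(_ (f_ @ \oo)); case.
  by exists 0%N.
move=> c [_ clc].
have visit (s : seq (bicomplex R)) (e : R) m : 0 < e ->
    exists2 k, (m <= k)%N & forall w, w \in s -> chordal_sum (f_ k w) (c w) < e.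
  move=> e0.
  have near : @nbhs _ (prod_topology (fun=> S)) c
      [set g | forall w, w \in s -> chordal_sum (g w) (c w) < e].
    have FN := @nbhs_filter (prod_topology (fun _ : bicomplex R => S)) c.
    elim: s => [|a s IH]; first by apply: filterS filterT => g _ w; rewrite in_nil.
    have na : @nbhs _ (prod_topology (fun=> S)) c [set g | chordal_sum (g a) (c a) < e].
      exact: (@proj_continuous (bicomplex R) (fun=> S) a c _ (nbhs_chordal_sum (c a) e0)).
    apply: filterS (filterI na IH) => g [/= ga gs] w.
    by rewrite in_cons => /predU1P[->|/gs].
  have tail : (f_ @ \oo) (f_ @` [set k | (m <= k)%N]).
    by exists m => // k /= mk; exists k.
  by have [_ [[k mk <-] gB]] := clc _ _ tail near; exists k.
have eps0 n : 0 < n.+1%:R^-1 :> R by rewrite invr_gt0.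
have sel (u : nat * nat) : exists k, (u.2 <= k)%N /\
    forall w, w \in map rat_point (iota 0 u.1) ->
      chordal_sum (f_ k w) (c w) < u.1.+1%:R^-1.
  by have [k uk H] := visit (map rat_point (iota 0 u.1)) _ u.2 (eps0 u.1); exists k.
have [nxt nxtP] := choice sel.
pose phi := fix phi n := if n is n'.+1 then nxt (n, (phi n').+1) else nxt (0%N, 0%N).
have phiE n : exists m, phi n = nxt (n, m) by case: n => [|n]; eexists.
(* [phi n] serves the first [n] rational points with precision [1 / (n + 1)] *)
have close n k : (k < n)%N ->
    chordal_sum (f_ (phi n) (rat_point k)) (c (rat_point k)) < n.+1%:R^-1.
  move=> kn; have [m ->] := phiE n; have [_] := nxtP (n, m); apply.
  by apply: map_f; rewrite mem_iota.
exists phi; split.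
  by apply/increasing_seqP => n; have [] := nxtP (n.+1, (phi n).+1).
exists c => K Kc KO e e0.
have e9 : 0 < e / 9 by rewrite divr_gt0.
have local p : K p -> \forall w \near p & n \near \oo,
    Omega w -> chordal_sum (f_ (phi n) w) (c w) < e.
  move=> /KO Op; have [V pV HV] := equi p Op _ e9.
  (* the cluster point inherits the equicontinuity *)
  have clim w : V w -> chordal_sum (c w) (c p) <= 3 * (e / 9).
    move=> Vw; have [k _ Hk] := visit [:: w; p] _ 0%N e9.
    have h1 := Hk w; have h2 := Hk p; rewrite !inE !eqxx ?orbT in h1 h2.
    have {}h1 := h1 isT; have {}h2 := h2 isT; rewrite chordal_sum_sym in h1.
    have := HV k w Vw.
    have := chordal_sum_triangle (f_ k w) (c w) (c p).
    have := chordal_sum_triangle (f_ k p) (f_ k w) (c p).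
    by lra.
  have [k kV] := rat_point_dense pV.
  have large : \forall n \near \oo,
      chordal_sum (f_ (phi n) (rat_point k)) (c (rat_point k)) < e / 9.
    exists (maxn k.+1 (Num.bound (e / 9)^-1)) => // n /=; rewrite geq_max => /andP[kn bn].
    apply: lt_trans (close n k kn) _; rewrite invf_plt ?posrE//.
    apply: (@lt_le_trans _ _ (Num.bound (e / 9)^-1)%:R).
      by apply: archi_boundP; rewrite invr_ge0 ltW.
    by rewrite ler_nat; apply: leqW.
  exists (V, [set n | chordal_sum (f_ (phi n) (rat_point k)) (c (rat_point k)) < e / 9]).
    by split.
  move=> [w n] [/= Vw kn] _.
  have h1 := HV (phi n) w Vw; have h2 := HV (phi n) _ kV; rewrite chordal_sum_sym in h2.
  have h3 := clim _ kV; have h4 := clim _ Vw; rewrite chordal_sum_sym in h4.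
  have := chordal_sum_triangle (f_ (phi n) p) (f_ (phi n) w) (c w).
  have := chordal_sum_triangle (f_ (phi n) (rat_point k)) (f_ (phi n) p) (c w).
  have := chordal_sum_triangle (c (rat_point k)) (f_ (phi n) (rat_point k)) (c w).
  have := chordal_sum_triangle (c p) (c (rat_point k)) (c w).
  by lra.
have /compact_near_coveringP/(_ nat \oo (fun n w => Omega w ->
    chordal_sum (f_ (phi n) w) (c w) < e) _ local)[n0 _ Hn0] := Kc.
by exists n0 => n w nn Kw; apply: (Hn0 n nn w Kw); exact: KO.
Qed.

End extended_distance.

(** * Idempotent components and the normality criterion *)

Section projections.
Variable R : rcfType.
Implicit Types (v w : bicomplex R) (a b : R[i]).

Lemma mul_i_i : 'i%C * 'i%C = -1 :> R[i].
Proof. by rewrite -expr2 sqr_i. Qed.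

Lemma P1B v w : P1 (v - w) = P1 v - P1 w.
Proof. by rewrite /P1 /=; ring. Qed.

Lemma P2B v w : P2 (v - w) = P2 v - P2 w.
Proof. by rewrite /P2 /=; ring. Qed.

Lemma P1P2 w : P1 w * P2 w = w.1 ^+ 2 + w.2 ^+ 2.
Proof.
have -> : P1 w * P2 w = w.1 ^+ 2 - w.2 ^+ 2 * ('i%C * 'i%C) by rewrite /P1 /P2; ring.
by rewrite mul_i_i; ring.
Qed.

Lemma null_coneE w : null_cone w <-> P1 w * P2 w = 0.
Proof. by rewrite P1P2. Qed.

(** Both components are read off an explicit element, whose idempotent
    representation is the given sum. *)
Lemma idempotent_coords a b :
  P1 (ofC a * e1 + ofC b * e2) = a /\ P2 (ofC a * e1 + ofC b * e2) = b.
Proof.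
pose w : bicomplex R := ((a + b) / 2, (a - b) * 'i%C / 2).
have n2 : (2 : R[i]) != 0 by rewrite pnatr_eq0.
have w1 : P1 w = a.
  have -> : P1 w = (a + b) / 2 - (a - b) * ('i%C * 'i%C) / 2 by rewrite /P1 /=; ring.
  by rewrite mul_i_i; field.
have w2 : P2 w = b.
  have -> : P2 w = (a + b) / 2 + (a - b) * ('i%C * 'i%C) / 2 by rewrite /P2 /=; ring.
  by rewrite mul_i_i; field.
by have := idempotent_repr w; rewrite w1 w2 => <-.
Qed.

End projections.

Section main.
Variable R : realType.
Implicit Types (Omega : set (bicomplex R)) (f : bicomplex R -> bicomplex R).

Lemma P1_open Omega : open Omega -> open (@P1 R @` Omega).
Proof.
rewrite !openE => oO _ [w Ow <-]; have /nbhs_bicomplex[d d0 dO] := oO w Ow.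
apply/nbhsC; exists d => // u ud; pose v : bicomplex R := (w.1 + (u - P1 w), w.2).
exists v; last by rewrite /v /P1 /=; ring.
apply: dO => /=; last by rewrite subrr modC0.
by rewrite addrAC subrr add0r.
Qed.

Lemma P2_open Omega : open Omega -> open (@P2 R @` Omega).
Proof.
rewrite !openE => oO _ [w Ow <-]; have /nbhs_bicomplex[d d0 dO] := oO w Ow.
apply/nbhsC; exists d => // u ud; pose v : bicomplex R := (w.1 + (u - P2 w), w.2).
exists v; last by rewrite /v /P2 /=; ring.
apply: dO => /=; last by rewrite subrr modC0.
by rewrite addrAC subrr add0r.
Qed.

Lemma modC_P1 (v w : bicomplex R) :
  modC (P1 v - P1 w) <= modC (v.1 - w.1) + modC (v.2 - w.2).
Proof.
have -> : P1 v - P1 w = (v.1 - w.1) + - ('i%C * (v.2 - w.2)) by rewrite /P1; ring.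
by apply: le_trans (modCD _ _) _; rewrite modCN modCM modCi mul1r.
Qed.

Lemma modC_P2 (v w : bicomplex R) :
  modC (P2 v - P2 w) <= modC (v.1 - w.1) + modC (v.2 - w.2).
Proof.
have -> : P2 v - P2 w = (v.1 - w.1) + 'i%C * (v.2 - w.2) by rewrite /P2; ring.
by apply: le_trans (modCD _ _) _; rewrite modCM modCi mul1r.
Qed.

Lemma holomorphic_on_holo (U : set R[i]) g : holomorphic_on U g -> holo U g.
Proof. by move=> gU z /gU/derivable_cdiff. Qed.

(** A bicomplex number is in the null-cone when one of its idempotent components
    vanishes. Hence a function avoids both translates exactly when each of its
    components omits the two corresponding components of [alpha] and [beta],
    which are distinct as the difference is invertible. *)
Lemma bicomplex_equicontinuous Omega (F : set (bicomplex R -> bicomplex R))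
    (alpha beta : bicomplex R) :
  open Omega -> (forall f, F f -> bicomplex_holomorphic Omega f) ->
  alpha - beta \is a GRing.unit ->
  (forall f, F f -> null_cone_translates alpha beta `&` (f @` Omega) = set0) ->
  forall p, Omega p -> forall e : R, 0 < e -> exists2 V, nbhs p V &
    forall f w, F f -> V w ->
      chordal_sum (ext_bicomplex (f w)) (ext_bicomplex (f p)) < e.
Proof.
move=> oO Fh uab Fo p Op e e0.
have : P1 alpha != P1 beta /\ P2 alpha != P2 beta.
  move/unit_null_cone: uab => nab; split; apply/eqP => E; apply: nab;
    by apply/null_coneE; rewrite P1B P2B E subrr ?mul0r ?mulr0.
case=> ab1 ab2.
have o1 := P1_open oO; have o2 := P2_open oO.
have p1 : (@P1 R @` Omega) (P1 p) by exists p.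
have p2 : (@P2 R @` Omega) (P2 p) by exists p.
have [r1 [L1 [r10 L10 H1]]] := omitting_equicontinuous o1 p1 ab1.
have [r2 [L2 [r20 L20 H2]]] := omitting_equicontinuous o2 p2 ab2.
have /nbhs_bicomplex[d d0 dO] : nbhs p Omega by exact: open_nbhs_nbhs.
have L0 : 0 < 2 * (L1 + L2 + 1) by rewrite mulr_gt0//; lra.
pose t := Num.min d (Num.min (Num.min (r1 / 2) (r2 / 2)) (e / (2 * (L1 + L2 + 1)))).
have t0 : 0 < t.
  by rewrite lt_min d0 lt_min (divr_gt0 e0 L0) andbT lt_min !divr_gt0.
exists [set w | modC (w.1 - p.1) < t /\ modC (w.2 - p.2) < t].
  by apply/nbhs_bicomplex; exists t.
move=> f w Ff [/= w1 w2].
have td : t <= d by rewrite /t ge_min lexx.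
have tr1 : t <= r1 / 2.
  by rewrite /t ge_min [X in _ || X]ge_min [X in _ || (X || _)]ge_min lexx /= orbT.
have tr2 : t <= r2 / 2.
  by rewrite /t ge_min [X in _ || X]ge_min [X in _ || (X || _)]ge_min lexx /= !orbT.
have te : t <= e / (2 * (L1 + L2 + 1)) by rewrite /t ge_min [X in _ || X]ge_min lexx !orbT.
clearbody t.
have Ow : Omega w by apply: dO; [exact: lt_le_trans td|exact: lt_le_trans td].
have [fe1 [fe2 [h1 h2 fE]]] := Fh f Ff.
have P1f v : Omega v -> P1 (f v) = fe1 (P1 v).
  by move=> /fE ->; have [] := idempotent_coords (fe1 (P1 v)) (fe2 (P2 v)).
have P2f v : Omega v -> P2 (f v) = fe2 (P2 v).
  by move=> /fE ->; have [] := idempotent_coords (fe1 (P1 v)) (fe2 (P2 v)).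
have omit v gamma : Omega v -> gamma = alpha \/ gamma = beta ->
    ~ null_cone (f v - gamma).
  move=> Ov gE nv; have : (null_cone_translates alpha beta `&` (f @` Omega)) (f v).
    by split; [case: gE nv => ->; [left|right]|exists v].
  by rewrite Fo.
have omit1 gamma : gamma = alpha \/ gamma = beta ->
    forall z, (@P1 R @` Omega) z -> fe1 z != P1 gamma.
  move=> gE _ [v Ov <-]; apply/eqP => E; apply: (omit v gamma Ov gE).
  by apply/null_coneE; rewrite P1B P1f// E subrr mul0r.
have omit2 gamma : gamma = alpha \/ gamma = beta ->
    forall z, (@P2 R @` Omega) z -> fe2 z != P2 gamma.
  move=> gE _ [v Ov <-]; apply/eqP => E; apply: (omit v gamma Ov gE).
  by apply/null_coneE; rewrite P2B P2f// E subrr mulr0.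
have w1p : modC (P1 w - P1 p) < 2 * t by have := modC_P1 w p; lra.
have w2p : modC (P2 w - P2 p) < 2 * t by have := modC_P2 w p; lra.
have r1w : modC (P1 w - P1 p) <= r1 by lra.
have r2w : modC (P2 w - P2 p) <= r2 by lra.
have k1 := H1 fe1 (holomorphic_on_holo h1) (omit1 alpha (or_introl erefl))
  (omit1 beta (or_intror erefl)) _ r1w.
have k2 := H2 fe2 (holomorphic_on_holo h2) (omit2 alpha (or_introl erefl))
  (omit2 beta (or_intror erefl)) _ r2w.
rewrite /chordal_sum /ext_bicomplex [(_, _).1]/= [(_, _).2]/= !P1f// !P2f//.
apply: le_lt_trans (lerD k1 k2) _.
have m1 : L1 * modC (P1 w - P1 p) <= L1 * (2 * t) by rewrite ler_wpM2l// ltW.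
have m2 : L2 * modC (P2 w - P2 p) <= L2 * (2 * t) by rewrite ler_wpM2l// ltW.
have : t * (2 * (L1 + L2 + 1)) <= e by rewrite -ler_pdivlMr.
by lra.
Qed.

End main.

Theorem theorem4p9 (R : realType) (Omega : set (bicomplex R))
    (F : set (bicomplex R -> bicomplex R)) (alpha beta : bicomplex R) :
  domain Omega ->
  (forall f, F f -> bicomplex_holomorphic Omega f) ->
  alpha - beta \is a GRing.unit ->
  (forall f, F f -> null_cone_translates alpha beta `&` (f @` Omega) = set0) ->
  normal_family Omega [set @ext_bicomplex R \o f | f in F].
Proof.
move=> [_ oO _] Fh uab Fo f_ fF.
have equi := bicomplex_equicontinuous oO Fh uab Fo.
have [|phi [phiI [c H]]] := @ascoli R Omega f_ oO.
  move=> p Op e e0; have [V pV HV] := equi p Op e e0; exists V => // n w Vw.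
  by have [g Fg <-] := fF n; exact: HV.
exists phi; split => //; exists c => K Kc KO e e0.
have [n0 Hn0] := H K Kc KO e e0; exists n0 => n w nn Kw.
exact: le_lt_trans (bichordal_le_sum _ _) (Hn0 n w nn Kw).
Qed.
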